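(* Let $\Lambda$ be a basic Artin algebra such that $\mathcal{P}^{<\infty}(\Lambda\text{-mod})$ is contravariantly finite in $\Lambda\text{-mod}$. Let ${}_\Lambda T$ be the corresponding basic strong tilting module, and $\widetilde{\Lambda}=\operatorname{End}_\Lambda(T)^{\mathrm{op}}$. Suppose that $\mathcal{P}^{<\infty}(\text{mod-}\widetilde{\Lambda})$ is in turn contravariantly finite in $\text{mod-}\widetilde{\Lambda}$, thus giving rise to a basic tilting bimodule ${}_{\widetilde{\widetilde{\Lambda}}}\widetilde{T}_{\widetilde{\Lambda}}$ which is strong in $\text{mod-}\widetilde{\Lambda}$, where $\widetilde{\widetilde{\Lambda}}=\operatorname{End}_{\widetilde\Lambda}(\widetilde T)$. Then $\widetilde{T}$ is strong on both sides, i.e., also ${}_{\widetilde{\widetilde{\Lambda}}}\widetilde{T}$ is a strong tilting module in $\widetilde{\widetilde{\Lambda}}\text{-mod}$. In particular, the process of strongly tilting $\Lambda\text{-mod}$ then allows for unlimited iteration, yielding a sequence of basic Artin algebras $\Lambda=\Lambda_0,\Lambda_1,\Lambda_2,\Lambda_3,\dots$ with the property that $\Lambda_i$ and $\Lambda_j$ are isomorphic whenever $i$ and $j$ are positive integers with the same parity. Moreover, the algebras $\Lambda_0$ and $\Lambda_2$ are isomorphic precisely when the tilting bimodule ${}_\Lambda T_{\widetilde{\Lambda}}$ is strong on both sides, i.e., when $T\cong\widetilde{T}$ as right $\widetilde{\Lambda}$-modules.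
   Context: For an Artin algebra $A$, $A\text{-mod}$ (resp. $\text{mod-}A$) is the category of finitely generated left (resp. right) $A$-modules, and $\mathcal{P}^{<\infty}(A\text{-mod})$ (resp. $\mathcal{P}^{<\infty}(\text{mod-}A)$) its full subcategory of modules of finite projective dimension. $A$ is basic if $A/J(A)$ is a product of division rings; a module is basic if it has no indecomposable direct summand of multiplicity $>1$. $\mathcal{P}^{<\infty}(A\text{-mod})$ is contravariantly finite in $A\text{-mod}$ if for each $M\in A\text{-mod}$ there is a map $\phi:X\to M$ with $X\in\mathcal{P}^{<\infty}(A\text{-mod})$ through which every homomorphism from an object of $\mathcal{P}^{<\infty}(A\text{-mod})$ to $M$ factors. Similarly for right modules. A module $T\in A\text{-mod}$ is a tilting module if (1) $T\in\mathcal{P}^{<\infty}(A\text{-mod})$, (2) $\operatorname{Ext}^i_A(T,T)=0$ for $i\ge1$, (3) there is an exact sequence $0\to A\to T_0\to\cdots\to T_m\to0$ with all $T_j\in\operatorname{add}(T)$. It is strong if, in addition, $\operatorname{Ext}^i_A(M,T)=0$ for all $M\in\mathcal{P}^{<\infty}(A\text{-mod})$ and $i\ge1$. Similarly for right modules. It is known (Auslander–Reiten) that a strong tilting module exists in $A\text{-mod}$ if and only if $\mathcal{P}^{<\infty}(A\text{-mod})$ is contravariantly finite, and that the basic strong tilting module is then unique up to isomorphism. If $T\in A\text{-mod}$ is tilting and $\widetilde A=\operatorname{End}_A(T)^{\mathrm{op}}$, then $T_{\widetilde A}$ is a tilting module with $\operatorname{End}_{\widetilde A}(T)\cong A$; one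 speaks of the tilting bimodule ${}_AT_{\widetilde A}$. For basic Artin algebras $A,B$: $\text{mod-}B$ results from $A\text{-mod}$ via strong tilting if $B\cong\operatorname{End}_A(T)^{\mathrm{op}}$, where $T$ is the basic strong tilting module in $A\text{-mod}$; $B\text{-mod}$ results from $\text{mod-}A$ via strong tilting if $B\cong\operatorname{End}_A(T)$, where $T$ is the basic strong tilting module in $\text{mod-}A$. The category $\Lambda\text{-mod}$ allows for unlimited iteration of strong tilting if there is an infinite sequence of basic algebras $(\Lambda_i)_{i\ge0}$ with $\Lambda_0=\Lambda$ such that $\text{mod-}\Lambda_{i+1}$ results from $\Lambda_i\text{-mod}$ via strong tilting for $i$ even, and $\Lambda_{i+1}\text{-mod}$ results from $\text{mod-}\Lambda_i$ via strong tilting for $i$ odd (so $\Lambda_1=\widetilde\Lambda$, $\Lambda_2=\widetilde{\widetilde\Lambda}$ up to isomorphism). *)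

(* Defs.v *)
From HB Require Import structures.
From mathcomp Require Import all_boot all_algebra.
From mathcomp Require Import boolp classical_sets.

Set Implicit Arguments.
Unset Strict Implicit.
Unset Printing Implicit Defensive.

Import GRing.Theory.

Local Open Scope classical_set_scope.
Local Open Scope ring_scope.

(* Left R-modules are the elements of lmodType R; right R-modules are left
   modules over the converse ring R^c. Every notion below is therefore stated
   for left modules only and is applied to R^c for right modules. *)

Section Modules.
Variable R : pzRingType.
Implicit Types M N X : lmodType R.

Definition finitely_generated M :=
  exists (n : nat) (v : 'I_n -> M), forall x : M,
    exists c : 'I_n -> R, x = \sum_(i < n) c i *: v i.

Definition zero_module M := forall x : M, x = 0.

Definition mod_iso M N := exists f : {linear M -> N}, bijective f.

Definition direct_summand X M :=
  exists (i : {linear X -> M}) (p : {linear M -> X}), cancel i p.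

Definition indecomposable X :=
  ~ zero_module X /\
  forall U V : lmodType R, mod_iso X (U * V)%type ->
    zero_module U \/ zero_module V.

Definition basic_module M :=
  forall X : lmodType R, indecomposable X -> ~ direct_summand (X * X)%type M.

(* add(T): direct summands of finite direct sums of copies of T *)
Definition in_add (T X : lmodType R) :=
  exists n : nat, direct_summand X {ffun 'I_n -> T}.

Definition surjective_map (X Y : Type) (f : X -> Y) := forall y, exists x, f x = y.

Definition exact_at (X Y Z : lmodType R) (f : {linear X -> Y})
    (g : {linear Y -> Z}) :=
  forall y : Y, g y = 0 <-> exists x : X, f x = y.

Definition projective (P : lmodType R) :=
  forall (X Y : lmodType R) (g : {linear X -> Y}) (f : {linear P -> Y}),
    surjective_map g -> exists h : {linear P -> X}, forall x, g (h x) = f x.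

Record projective_resolution M := ProjectiveResolution {
  res_obj :> nat -> lmodType R;
  res_d : forall i, {linear res_obj i.+1 -> res_obj i};
  res_aug : {linear res_obj 0%N -> M};
  res_projective : forall i, projective (res_obj i);
  res_aug_surj : surjective_map res_aug;
  res_exact0 : exact_at (res_d 0%N) res_aug;
  res_exactS : forall i, exact_at (res_d i.+1) (res_d i)
}.

Definition finite_projective_dimension M :=
  exists (P : projective_resolution M) (n : nat),
    forall i, (n < i)%N -> zero_module (P i).

Definition fin_pdim M := finitely_generated M /\ finite_projective_dimension M.

(* Ext^i(M, N) = 0, that is, H^i(Hom(P, N)) = 0 for the projective resolutions
   P of M: every module has one, and the cohomology does not depend on it. *)
Definition Ext_zero (i : nat) M N :=
  forall P : projective_resolution M,
    match i with
    | 0%N => forall f : {linear P 0%N -> N},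
        (forall x, f (res_d P 0%N x) = 0) -> forall x, f x = 0
    | j.+1 => forall f : {linear P j.+1 -> N},
        (forall x, f (res_d P j.+1 x) = 0) ->
        exists g : {linear P j -> N}, forall x, f x = g (res_d P j x)
    end.

(* 0 -> M -> T_0 -> ... -> T_m -> 0 exact with all T_j in add(T), continued
   by zero modules beyond T_m *)
Record finite_add_coresolution (T M : lmodType R) := FiniteAddCoresolution {
  cores_obj :> nat -> lmodType R;
  cores_len : nat;
  cores_aug : {linear M -> cores_obj 0%N};
  cores_d : forall i, {linear cores_obj i -> cores_obj i.+1};
  cores_add : forall i, (i <= cores_len)%N -> in_add T (cores_obj i);
  cores_zero : forall i, (cores_len < i)%N -> zero_module (cores_obj i);
  cores_aug_inj : injective cores_aug;
  cores_exact0 : exact_at cores_aug (cores_d 0%N);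
  cores_exactS : forall i, exact_at (cores_d i) (cores_d i.+1)
}.

Definition tilting (T : lmodType R) :=
  [/\ fin_pdim T,
      forall i, (1 <= i)%N -> Ext_zero i T T
    & inhabited (finite_add_coresolution T R^o)].

Definition strong_tilting (T : lmodType R) :=
  tilting T /\
  forall M, fin_pdim M -> forall i, (1 <= i)%N -> Ext_zero i M T.

End Modules.

Definition contravariantly_finite (R : pzRingType) :=
  forall M : lmodType R, finitely_generated M ->
    exists X : lmodType R, fin_pdim X /\
    exists phi : {linear X -> M},
      forall Y : lmodType R, fin_pdim Y -> forall f : {linear Y -> M},
        exists g : {linear Y -> X}, forall y, f y = phi (g y).

Definition left_ideal (R : pzRingType) (I : set R) :=
  [/\ I 0, forall x y, I x -> I y -> I (x + y) & forall a x, I x -> I (a * x)].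

Definition maximal_left_ideal (R : pzRingType) (I : set R) :=
  [/\ left_ideal I, ~ I 1
    & forall J : set R, left_ideal J -> ~ J 1 -> I `<=` J -> J = I].

Definition jacobson_radical (R : pzRingType) : set R :=
  [set x | forall I : set R, maximal_left_ideal I -> I x].

Definition division_ring (D : nzRingType) :=
  forall x : D, x != 0 -> exists y : D, y * x = 1 /\ x * y = 1.

(* R / J(R) is isomorphic to the product of the division rings D i: the maps
   pr i are the components of a surjective ring morphism from R onto that
   product, whose kernel is J(R). *)
Definition basic_ring (R : pzRingType) :=
  exists (n : nat) (D : 'I_n -> nzRingType) (pr : forall i, {rmorphism R -> D i}),
  [/\ forall i, division_ring (D i),
      forall y : (forall i, D i), exists x : R, forall i, pr i x = y i
    & forall x : R, jacobson_radical x <-> forall i, pr i x = 0].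

Definition artinian (k : comPzRingType) :=
  forall I : nat -> set k, (forall n, left_ideal (I n)) ->
    (forall n, I n.+1 `<=` I n) ->
    exists N, forall n, (N <= n)%N -> I n = I N.

(* Algebras over k. The library's algType forces 1 != 0, which fails for the
   endomorphism ring of a zero module. *)
Record kalg (k : comPzRingType) := KAlg {
  kalg_ring :> pzRingType;
  kalg_map : {rmorphism k -> kalg_ring};
  kalg_central : forall c (x : kalg_ring), kalg_map c * x = x * kalg_map c
}.

Definition artin_algebra (k : comPzRingType) (A : kalg k) :=
  artinian k /\
  exists (n : nat) (v : 'I_n -> A), forall x : A,
    exists c : 'I_n -> k, x = \sum_(i < n) kalg_map A (c i) * v i.

Definition alg_iso (k : comPzRingType) (A B : kalg k) :=
  exists f : {rmorphism A -> B},
    bijective f /\ forall c, f (kalg_map A c) = kalg_map B c.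

Section Opposite.
Variables (k : comPzRingType) (A : kalg k).

Definition op_map (c : k) : A^c := kalg_map A c.

Fact op_map_is_zmod_morphism : zmod_morphism op_map.
Proof. exact: (raddfB (kalg_map A)). Qed.

Fact op_map_is_monoid_morphism : monoid_morphism op_map.
Proof.
split; first exact: (rmorph1 (kalg_map A)).
by move=> x y; rewrite /op_map rmorphM; exact: kalg_central.
Qed.

HB.instance Definition _ :=
  GRing.isZmodMorphism.Build k A^c op_map op_map_is_zmod_morphism.
HB.instance Definition _ :=
  GRing.isMonoidMorphism.Build k A^c op_map op_map_is_monoid_morphism.

Fact op_central (c : k) (x : A^c) : op_map c * x = x * op_map c.
Proof. exact: esym (kalg_central c (x : A)). Qed.

Definition op_alg : kalg k := KAlg op_central.

End Opposite.

Notation rmodType A := (lmodType (op_alg A)).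

Section Endomorphisms.
Variables (R : pzRingType) (M : lmodType R).

Definition endo : Type := {linear M -> M}.

HB.instance Definition _ := gen_eqMixin endo.
HB.instance Definition _ := gen_choiceMixin endo.

Lemma endoP (f g : endo) : (forall x, f x = g x) -> f = g.
Proof.
case: f g => f [[nf] [sf]] [g [[ng] [sg]]] /= /funext fg.
by rewrite -{}fg in ng sg *; rewrite (Prop_irrelevance nf ng) (Prop_irrelevance sf sg).
Qed.

Definition endo_zero : endo := \0.
Definition endo_opp (f : endo) : endo := \- f.
Definition endo_add (f g : endo) : endo := f \+ g.
Definition endo_one : endo := idfun.
Definition endo_mul (f g : endo) : endo := f \o g.

Fact endo_addA : associative endo_add.
Proof. by move=> f g h; apply: endoP => x /=; rewrite addrA. Qed.
Fact endo_addC : commutative endo_add.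
Proof. by move=> f g; apply: endoP => x /=; rewrite addrC. Qed.
Fact endo_add0 : left_id endo_zero endo_add.
Proof. by move=> f; apply: endoP => x /=; rewrite add0r. Qed.
Fact endo_addN : left_inverse endo_zero endo_opp endo_add.
Proof. by move=> f; apply: endoP => x /=; rewrite addNr. Qed.

HB.instance Definition _ :=
  GRing.isZmodule.Build endo endo_addA endo_addC endo_add0 endo_addN.

Fact endo_mulA : associative endo_mul.
Proof. by move=> f g h; apply: endoP. Qed.
Fact endo_mul1 : left_id endo_one endo_mul.
Proof. by move=> f; apply: endoP. Qed.
Fact endo_1mul : right_id endo_one endo_mul.
Proof. by move=> f; apply: endoP. Qed.
Fact endo_mulDl : left_distributive endo_mul endo_add.
Proof. by move=> f g h; apply: endoP. Qed.
Fact endo_mulDr : right_distributive endo_mul endo_add.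
Proof. by move=> f g h; apply: endoP => x /=; rewrite raddfD. Qed.

HB.instance Definition _ := GRing.Zmodule_isPzRing.Build endo
  endo_mulA endo_mul1 endo_1mul endo_mulDl endo_mulDr.

(* M as a left module over its endomorphism ring, by evaluation *)
Definition endo_lmod : Type := M.
HB.instance Definition _ := GRing.Zmodule.on endo_lmod.

Definition endo_ev (f : endo) (x : endo_lmod) : endo_lmod := f x.

Fact endo_evA (f g : endo) x : endo_ev f (endo_ev g x) = endo_ev (f * g) x.
Proof. by []. Qed.
Fact endo_ev1 : left_id 1 endo_ev.
Proof. by []. Qed.
Fact endo_evDr : right_distributive endo_ev +%R.
Proof. by move=> f x y; exact: raddfD. Qed.
Fact endo_evDl x : {morph endo_ev^~ x : f g / f + g}.
Proof. by []. Qed.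

HB.instance Definition _ := GRing.Zmodule_isLmodule.Build endo endo_lmod
  endo_evA endo_ev1 endo_evDr endo_evDl.

(* M as a right module over endo^c: again evaluation, the two opposites
   cancelling each other *)
Definition endo_rmod : Type := M.
HB.instance Definition _ := GRing.Zmodule.on endo_rmod.

Definition endo_rev (f : endo^c^c) (x : endo_rmod) : endo_rmod := (f : endo) x.

Fact endo_revA (f g : endo^c^c) x : endo_rev f (endo_rev g x) = endo_rev (f * g) x.
Proof. by []. Qed.
Fact endo_rev1 : left_id 1 endo_rev.
Proof. by []. Qed.
Fact endo_revDr : right_distributive endo_rev +%R.
Proof. by move=> f x y; exact: (raddfD (f : endo)). Qed.
Fact endo_revDl x : {morph endo_rev^~ x : f g / f + g}.
Proof. by []. Qed.

HB.instance Definition _ := GRing.Zmodule_isLmodule.Build endo^c^c endo_rmod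
  endo_revA endo_rev1 endo_revDr endo_revDl.

End Endomorphisms.

Section EndomorphismAlgebra.
Variables (k : comPzRingType) (A : kalg k) (M : lmodType A).

Definition homothety (c : k) (x : M) : M := kalg_map A c *: x.

Fact homothety_is_linear c : linear (homothety c).
Proof.
by move=> a x y; rewrite /homothety scalerDr !scalerA kalg_central.
Qed.

HB.instance Definition _ c :=
  GRing.isLinear.Build A M M *:%R (homothety c) (homothety_is_linear c).

Definition endo_map (c : k) : endo M := homothety c.

Fact endo_map_is_zmod_morphism : zmod_morphism endo_map.
Proof.
by move=> c d; apply: endoP => x; rewrite /= /homothety raddfB scalerBl.
Qed.

Fact endo_map_is_monoid_morphism : monoid_morphism endo_map.
Proof.
split; first by apply: endoP => x; rewrite /= /homothety rmorph1 scale1r.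
by move=> c d; apply: endoP => x; rewrite /= /homothety rmorphM -scalerA.
Qed.

HB.instance Definition _ :=
  GRing.isZmodMorphism.Build k (endo M) endo_map endo_map_is_zmod_morphism.
HB.instance Definition _ :=
  GRing.isMonoidMorphism.Build k (endo M) endo_map endo_map_is_monoid_morphism.

Fact endo_central (c : k) (f : endo M) : endo_map c * f = f * endo_map c.
Proof. by apply: endoP => x; rewrite /= /homothety linearZ. Qed.

Definition endo_alg : kalg k := KAlg endo_central.

End EndomorphismAlgebra.

Section StrongTilting.
Variable k : comPzRingType.
Implicit Types A B : kalg k.

Definition tilt_alg A (T : lmodType A) : kalg k := op_alg (endo_alg T).

(* mod-B results from A-mod via strong tilting *)
Definition left_strong_tilt A B :=
  exists T : lmodType A,
    [/\ basic_module T, strong_tilting T & alg_iso B (tilt_alg T)].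

(* B-mod results from mod-A via strong tilting *)
Definition right_strong_tilt A B :=
  exists T : rmodType A,
    [/\ basic_module T, strong_tilting T & alg_iso B (endo_alg T)].

Definition strong_tilting_sequence A (L : nat -> kalg k) :=
  [/\ L 0%N = A,
      forall i, artin_algebra (L i) /\ basic_ring (L i),
      forall i, ~~ odd i -> left_strong_tilt (L i) (L i.+1)
    & forall i, odd i -> right_strong_tilt (L i) (L i.+1)].

Definition unlimited_strong_tilting A :=
  exists L, strong_tilting_sequence A L.

(* The tilting bimodule on T, with A on the left and tilt_alg T on the right *)
Definition left_strong_both_sides A (T : lmodType A) :=
  strong_tilting T /\ strong_tilting (endo_rmod T : rmodType (tilt_alg T)).

(* The tilting bimodule on T, with endo_alg T on the left and A on the right *)
Definition right_strong_both_sides A (T : rmodType A) :=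
  strong_tilting T /\ strong_tilting (endo_lmod T : lmodType (endo_alg T)).

End StrongTilting.

(* Main.v *)
Require Import Defs.
From HB Require Import structures.
From mathcomp Require Import all_boot all_algebra.
From mathcomp Require Import boolp classical_sets.

Set Implicit Arguments.
Unset Strict Implicit.
Unset Printing Implicit Defensive.

Import GRing.Theory.
Local Open Scope ring_scope.

(* Write A = Lambda, B = End_A(T)^op and C = End_B(T'). Strength of T over A
   forces every nonzero finitely generated B-module H to admit a nonzero map to
   T_B: a presentation of H by a matrix over B gives an A-linear map
   T^n -> T^m, injective when Hom_B(H, T) = 0, with cokernel of finite
   projective dimension; maps to T extend along it, so the presentation map is
   onto and H = 0. As T_B has finite projective dimension and T' is strong, T_B
   is reflexive with respect to T' and thus cogenerated by T', so T' also
   detects nonzero modules. Given N = coker(K -> F) of finite projective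
   dimension over C, with F free, the restriction Hom_C(F, T') -> Hom_C(K, T')
   has a cokernel with no maps to T', because K is reflexive and embeds in F; it
   is therefore onto, that is, Ext^1_C(N, T') = 0, and induction along a
   resolution gives the strength of T' over C.

   The statements on iterations follow since the double centralizer property
   makes T' a basic strong tilting module over C with End_C(T')^op = B, and
   since basic strong tilting modules are unique. *)

(** * Submodules and quotients *)

(** Ext and projective dimension are handled through syzygies. A syzygy is determined only up to
    projective summands, so the properties fed into [syz] are shown to be stable under [proj_equiv]
    and closed under extensions; Schanuel's lemma and the horseshoe lemma then do the work of long
    exact sequences.

    The duality Hom(-, T) is exact only on sequences along which maps to T extend, so the inductive
    claims about duals carry an Ext vanishing with them. Detection is asked of finitely generated
    modules only, so kernels and duals have to be kept finitely generated. This is where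
    Noetherianity enters: it is proved for an Artinian commutative ring k and passed on to Artin
    algebras over k and their endomorphism algebras.

    Basicness is not followed through the duality on modules. It is read off the idempotents of
    endomorphism rings, which the double centralizer property identifies with Lambda and with the
    opposite of B. *)

Section Submodules.
Variables (R : pzRingType) (M : lmodType R).

Definition submodule (S : set M) :=
  [/\ S 0, forall x y, S x -> S y -> S (x + y) & forall a x, S x -> S (a *: x)].

(** Linear maps are produced existentially, so each one is known only through its pointwise
    equation. *)
Lemma linear_ext (N : lmodType R) (f : M -> N) :
  linear f -> exists g : {linear M -> N}, forall x, g x = f x.
Proof.
move=> fL; by exists (HB.pack_for {linear M -> N} f (GRing.isLinear.Build R M N *:%R f fL)).
Qed.

Lemma linZ (N : lmodType R) (f : {linear M -> N}) a x : f (a *: x) = a *: f x.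
Proof. exact: linearZ. Qed.

Lemma submoduleN (S : set M) x : submodule S -> S x -> S (- x).
Proof. by case=> _ _ SZ Sx; rewrite -scaleN1r; apply: SZ. Qed.

Lemma submoduleB (S : set M) x y : submodule S -> S x -> S y -> S (x - y).
Proof. by move=> SS Sx Sy; case: (SS) => _ SD _; apply: SD => //; apply: submoduleN. Qed.

Lemma submodule_sum (S : set M) (I : Type) (r : seq I) (P : pred I) (F : I -> M) :
  submodule S -> (forall i, P i -> S (F i)) -> S (\sum_(i <- r | P i) F i).
Proof. by case=> S0 SD _ SF; apply: big_ind. Qed.

End Submodules.

Section SubQuot.
Variables (R : pzRingType) (M : lmodType R) (S : set M).

Definition sub_carrier (SS : submodule S) : Type := {x : M | `[< S x >]}.

(** The guard [submodule S] makes a witness exist for every S (namely x, as 0 lies in S), so that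
    the choice of representatives takes no proof argument. *)
Fact quo_ex x : exists y, `[< submodule S -> S (y - x) >].
Proof. by exists x; apply/asboolP => -[S0 _ _]; rewrite subrr. Qed.

Definition quo_repr (x : M) : M := xchoose (quo_ex x).
(** Congruent elements satisfy equivalent predicates and so receive the same representative; the
    fixed points of [quo_repr] thus form a copy of M/S. *)
Definition quo_carrier (SS : submodule S) : Type := {x : M | quo_repr x == x}.
End SubQuot.

Section SubInstances.
Variables (R : pzRingType) (M : lmodType R) (S : set M) (SS : submodule S).
Local Notation subS := (sub_carrier SS).
HB.instance Definition _ := Choice.on subS.

Let mk (x : M) (Sx : S x) : subS := exist _ x (introT (asboolP _) Sx).
Let sP (x : subS) : S (sval x) := elimT (asboolP _) (svalP x).
Let sI (x y : subS) : sval x = sval y -> x = y.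
Proof. by move=> h; apply: val_inj. Qed.
Let S0 : S 0. Proof. by case: SS. Qed.
Let SD x y : S x -> S y -> S (x + y). Proof. by case: SS => _ h _; apply: h. Qed.
Let SZ a x : S x -> S (a *: x). Proof. by case: SS => _ _; apply. Qed.

Definition sub_zero : subS := mk S0.
Definition sub_add (x y : subS) : subS := mk (SD (sP x) (sP y)).
Definition sub_opp (x : subS) : subS := mk (submoduleN SS (sP x)).
Definition sub_scale a (x : subS) : subS := mk (SZ a (sP x)).

Fact sub_addA : associative sub_add.
Proof. by move=> x y z; apply: sI; rewrite /= addrA. Qed.
Fact sub_addC : commutative sub_add.
Proof. by move=> x y; apply: sI; rewrite /= addrC. Qed.
Fact sub_add0 : left_id sub_zero sub_add.
Proof. by move=> x; apply: sI; rewrite /= add0r. Qed.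
Fact sub_addN : left_inverse sub_zero sub_opp sub_add.
Proof. by move=> x; apply: sI; rewrite /= addNr. Qed.
HB.instance Definition _ :=
  GRing.isZmodule.Build subS sub_addA sub_addC sub_add0 sub_addN.

Fact sub_scaleA a b x : sub_scale a (sub_scale b x) = sub_scale (a * b) x.
Proof. by apply: sI; rewrite /= scalerA. Qed.
Fact sub_scale1 : left_id 1 sub_scale.
Proof. by move=> x; apply: sI; rewrite /= scale1r. Qed.
Fact sub_scaleDr : right_distributive sub_scale +%R.
Proof. by move=> a x y; apply: sI; rewrite /= scalerDr. Qed.
Fact sub_scaleDl x : {morph sub_scale^~ x : a b / a + b}.
Proof. by move=> a b; apply: sI; rewrite /= scalerDl. Qed.
HB.instance Definition _ := GRing.Zmodule_isLmodule.Build R subS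
  sub_scaleA sub_scale1 sub_scaleDr sub_scaleDl.

Lemma submodule_type : exists (K : lmodType R) (i : {linear K -> M}),
  injective i /\ forall x, S x <-> exists k, i k = x.
Proof.
have [|i iE] := @linear_ext R subS M sval; first by [].
exists subS, i; split=> [x y|x].
  by rewrite !iE => /sI.
split=> [Sx|[k <-]]; last by rewrite iE; apply: sP.
by exists (mk Sx); rewrite iE.
Qed.

Local Notation quoS := (quo_carrier SS).
Local Notation rep := (quo_repr S).
HB.instance Definition _ := Choice.on quoS.

Let repP x : S (rep x - x).
Proof. by move: (xchooseP (quo_ex S x)) => /asboolP/(_ SS). Qed.
Let repE x y : S (x - y) -> rep x = rep y.
Proof.
move=> Sxy; apply: eq_xchoose => z; apply: asbool_equiv_eq; split=> h _.
  by rewrite -[z](subrK x) -addrA; apply: SD => //; apply: h.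
rewrite -[z](subrK y) -addrA; apply: SD; first exact: h.
by rewrite -opprB; apply: submoduleN.
Qed.
Let repK x : rep (rep x) = rep x. Proof. exact/repE/repP. Qed.
Let qpr (x : M) : quoS := exist _ (rep x) (introT eqP (repK x)).
Let qI (x y : quoS) : sval x = sval y -> x = y.
Proof. by move=> h; apply: val_inj. Qed.
Let qE x y : S (x - y) -> qpr x = qpr y.
Proof. by move=> h; apply: qI; apply: repE. Qed.
Let qK (x : quoS) : qpr (sval x) = x.
Proof. by apply: qI; rewrite /=; apply/eqP; apply: (svalP x). Qed.
Let qP x : S (sval (qpr x) - x). Proof. exact: repP. Qed.

Definition quo_zero : quoS := qpr 0.
Definition quo_add (x y : quoS) : quoS := qpr (sval x + sval y).
Definition quo_opp (x : quoS) : quoS := qpr (- sval x).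
Definition quo_scale a (x : quoS) : quoS := qpr (a *: sval x).

Let qDl a b : qpr (sval (qpr a) + b) = qpr (a + b).
Proof. by apply: qE; rewrite opprD addrACA subrr addr0; apply: qP. Qed.
Let qDr a b : qpr (b + sval (qpr a)) = qpr (b + a).
Proof. by rewrite addrC qDl addrC. Qed.
Let qZ a x : qpr (a *: sval (qpr x)) = qpr (a *: x).
Proof. by apply: qE; rewrite -scalerBr; apply: SZ; apply: qP. Qed.

Fact quo_addA : associative quo_add.
Proof. by move=> x y z; rewrite /quo_add qDl qDr addrA. Qed.
Fact quo_addC : commutative quo_add.
Proof. by move=> x y; rewrite /quo_add addrC. Qed.
Fact quo_add0 : left_id quo_zero quo_add.
Proof. by move=> x; rewrite /quo_add qDl add0r qK. Qed.
Fact quo_addN : left_inverse quo_zero quo_opp quo_add.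
Proof. by move=> x; rewrite /quo_add qDl addNr. Qed.
HB.instance Definition _ :=
  GRing.isZmodule.Build quoS quo_addA quo_addC quo_add0 quo_addN.

Fact quo_scaleA a b x : quo_scale a (quo_scale b x) = quo_scale (a * b) x.
Proof. by rewrite /quo_scale qZ scalerA. Qed.
Fact quo_scale1 : left_id 1 quo_scale.
Proof. by move=> x; rewrite /quo_scale scale1r qK. Qed.
Fact quo_scaleDr : right_distributive quo_scale +%R.
Proof.
move=> a x y; rewrite /quo_scale [x + y]/(quo_add x y) qZ.
by rewrite [RHS]/(quo_add _ _) /quo_add qDl qDr scalerDr.
Qed.
Fact quo_scaleDl x : {morph quo_scale^~ x : a b / a + b}.
Proof.
move=> a b; rewrite /quo_scale [RHS]/(quo_add _ _) /quo_add qDl qDr.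
by rewrite scalerDl.
Qed.
HB.instance Definition _ := GRing.Zmodule_isLmodule.Build R quoS
  quo_scaleA quo_scale1 quo_scaleDr quo_scaleDl.

Lemma quotient_type : exists (Q : lmodType R) (p : {linear M -> Q}),
  surjective_map p /\ forall x, p x = 0 <-> S x.
Proof.
have [|p pE] := @linear_ext R M quoS qpr.
  move=> a x y; rewrite [RHS]/(quo_add _ _) /quo_add qDr.
  by rewrite [a *: qpr x]/(quo_scale _ _) /quo_scale qZ qDl.
exists quoS, p; split=> [y|x]; first by exists (sval y); rewrite pE qK.
rewrite pE; split=> [|Sx]; last by apply: qE; rewrite subr0.
move/(congr1 sval) => /= h; rewrite -[x](subrK (rep x)) h.
apply: SD; last by have := repP 0; rewrite subr0.
by rewrite -h -opprB; apply: submoduleN.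
Qed.

End SubInstances.

(** * Short exact sequences *)

Section ShortExact.
Variable R : pzRingType.
Implicit Types (K M N P Q X Y Z W : lmodType R).

Definition ses X Y Z (i : {linear X -> Y}) (p : {linear Y -> Z}) :=
  [/\ injective i, exact_at i p & surjective_map p].

Lemma linear_inj X Y (f : {linear X -> Y}) :
  (forall x, f x = 0 -> x = 0) -> injective f.
Proof.
by move=> h x y e; apply/subr0_eq/h; rewrite linearB e subrr.
Qed.

Lemma linear_inj0 X Y (f : {linear X -> Y}) x : injective f -> f x = 0 -> x = 0.
Proof. by move=> fI e; apply: fI; rewrite e linear0. Qed.

Lemma ses0 X Y Z (i : {linear X -> Y}) (p : {linear Y -> Z}) x :
  ses i p -> p (i x) = 0.
Proof. by case=> _ h _; apply/h; exists x. Qed.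

Lemma kernel_type X Y (f : {linear X -> Y}) : exists (K : lmodType R) (i : {linear K -> X}),
  injective i /\ exact_at i f.
Proof.
apply: (@submodule_type R X (fun x => f x = 0)); split; first exact: linear0.
  by move=> x y hx hy; rewrite linearD hx hy addr0.
by move=> a x hx; rewrite linZ hx scaler0.
Qed.

Lemma ses_kernel X Y (f : {linear X -> Y}) :
  surjective_map f -> exists (K : lmodType R) (i : {linear K -> X}), ses i f.
Proof.
by move=> fS; have [K [i [iI iE]]] := kernel_type f; exists K, i.
Qed.

Lemma image_submodule X Y (f : {linear X -> Y}) :
  submodule (fun y => exists x, f x = y).
Proof.
split; first by exists 0; rewrite linear0.
  by move=> _ _ [x <-] [y <-]; exists (x + y); rewrite linearD.
by move=> a _ [x <-]; exists (a *: x); rewrite linZ.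
Qed.

Lemma cokernel_type X Y (f : {linear X -> Y}) : exists (Z : lmodType R) (p : {linear Y -> Z}),
  surjective_map p /\ exact_at f p.
Proof. exact/quotient_type/image_submodule. Qed.

Lemma ses_cokernel X Y (f : {linear X -> Y}) :
  injective f -> exists (Z : lmodType R) (p : {linear Y -> Z}), ses f p.
Proof.
by move=> fI; have [Z [p [pS pE]]] := cokernel_type f; exists Z, p.
Qed.

Lemma factor_surj X Y W (p : {linear X -> Y}) (f : {linear X -> W}) :
  surjective_map p -> (forall x, p x = 0 -> f x = 0) ->
  exists g : {linear Y -> W}, forall x, g (p x) = f x.
Proof.
move=> pS h; have [s sE] := choice pS.
have fE x y : p x = p y -> f x = f y.
  by move=> e; apply/subr0_eq; rewrite -linearB h // linearB e subrr.
have [|g gE] := @linear_ext R Y W (fun y => f (s y)).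
  by move=> a x y; rewrite -linearP; apply: fE; rewrite linearP !sE.
by exists g => x; rewrite gE; apply: fE; rewrite sE.
Qed.

Lemma factor_inj X Y W (i : {linear X -> Y}) (f : {linear W -> Y}) :
  injective i -> (forall w, exists x, i x = f w) ->
  exists g : {linear W -> X}, forall w, i (g w) = f w.
Proof.
move=> iI /choice[s sE].
have [|g gE] := @linear_ext R W X s; last by exists g => w; rewrite gE.
by move=> a x y; apply: iI; rewrite linearP !sE linearP.
Qed.

Lemma factor_ses X Y Z W (i : {linear X -> Y}) (p : {linear Y -> Z})
    (f : {linear W -> Y}) :
  ses i p -> (forall w, p (f w) = 0) ->
  exists g : {linear W -> X}, forall w, i (g w) = f w.
Proof. by case=> iI e _ h; apply: factor_inj => // w; apply/e. Qed.

Lemma pair_linear X Y W (f : {linear W -> X}) (g : {linear W -> Y}) :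
  exists h : {linear W -> (X * Y)%type}, forall w, h w = (f w, g w).
Proof. by apply: linear_ext => a x y; rewrite !linearP. Qed.

Lemma sum_linear X Y W (f : {linear X -> W}) (g : {linear Y -> W}) :
  exists h : {linear (X * Y)%type -> W}, forall w, h w = f w.1 + g w.2.
Proof.
apply: linear_ext => a x y; rewrite !linearP /= scalerDr.
by rewrite !addrA; congr (_ + _); rewrite -!addrA; congr (_ + _); rewrite addrC.
Qed.

Lemma inverse_linear X Y (f : {linear X -> Y}) g :
  cancel f g -> cancel g f -> exists h : {linear Y -> X}, h =1 g.
Proof.
move=> fK gK; apply: linear_ext => a x y.
by apply: (can_inj fK); rewrite linearP !gK.
Qed.

Lemma mod_isoP X Y : mod_iso X Y <->
  exists (f : {linear X -> Y}) (g : {linear Y -> X}), cancel f g /\ cancel g f.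
Proof.
split=> [[f [g fK gK]]|[f [g [fK gK]]]]; last by exists f, g.
have [h hE] := inverse_linear fK gK.
by exists f, h; split=> x; rewrite hE ?fK ?gK.
Qed.

Lemma mod_iso_bij X Y (f : {linear X -> Y}) :
  injective f -> surjective_map f -> mod_iso X Y.
Proof.
move=> fI /choice[g gK]; exists f, g => // x; apply: fI; exact: gK.
Qed.

Lemma mod_iso_refl X : mod_iso X X.
Proof. by exists idfun, idfun. Qed.
Lemma mod_iso_sym X Y : mod_iso X Y -> mod_iso Y X.
Proof. by move=> /mod_isoP[f [g [fK gK]]]; exists g, f. Qed.
Lemma mod_iso_trans X Y Z : mod_iso X Y -> mod_iso Y Z -> mod_iso X Z.
Proof.
move=> /mod_isoP[f [g [fK gK]]] /mod_isoP[f' [g' [fK' gK']]].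
by exists (f' \o f), (g \o g') => x /=; rewrite ?fK' ?gK' ?fK ?gK.
Qed.

Lemma mod_iso_pair X X' Y Y' :
  mod_iso X X' -> mod_iso Y Y' -> mod_iso (X * Y)%type (X' * Y')%type.
Proof.
move=> /mod_isoP[f [g [fK gK]]] /mod_isoP[f' [g' [fK' gK']]].
have [h hE] := pair_linear (f \o fst) (f' \o snd).
exists h, (fun z => (g z.1, g' z.2)) => -[a b]; rewrite hE /=.
  by rewrite fK fK'.
by rewrite gK gK'.
Qed.

Lemma mod_iso_pairC X Y : mod_iso (X * Y)%type (Y * X)%type.
Proof.
have [h hE] := @pair_linear Y X (X * Y)%type snd fst.
by exists h, (fun z => (z.2, z.1)) => -[a b]; rewrite hE.
Qed.

Lemma mod_iso_pairA X Y Z : mod_iso (X * (Y * Z))%type ((X * Y) * Z)%type.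
Proof.
have [|h hE] := @linear_ext R (X * (Y * Z))%type ((X * Y) * Z)%type
  (fun z => ((z.1, z.2.1), z.2.2)); first by [].
by exists h, (fun z => (z.1.1, (z.1.2, z.2))) => -[]; [move=> a [b c] | move=> [a b] c]; rewrite hE.
Qed.

Lemma mod_iso_summand X Y : mod_iso X Y -> direct_summand X Y.
Proof. by move=> /mod_isoP[f [g [fK gK]]]; exists f, g. Qed.

Lemma summand_trans X Y Z :
  direct_summand X Y -> direct_summand Y Z -> direct_summand X Z.
Proof.
move=> [i [p pK]] [i' [p' pK']]; exists (i' \o i), (p \o p') => x /=.
by rewrite pK' pK.
Qed.

Lemma ses_inl X Y : exists (i : {linear X -> (X * Y)%type})
  (p : {linear (X * Y)%type -> Y}),
  [/\ ses i p, (forall x, i x = (x, 0)) & p =1 snd].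
Proof.
have [i iE] := @pair_linear X Y X idfun \0; exists i, snd; split=> //; split.
- by move=> x y; rewrite !iE => -[].
- move=> [x y] /=; split=> [->|[x' h]]; first by exists x; rewrite iE.
  by rewrite iE in h; case: h.
- by move=> y; exists (0, y).
Qed.

Lemma summand_complement X Y (i : {linear X -> Y}) (p : {linear Y -> X}) :
  cancel i p -> exists (X' : lmodType R) (j : {linear X' -> Y}), ses j p /\ mod_iso Y (X * X')%type.
Proof.
move=> iK; have [|X' [j jp]] := @ses_kernel _ _ p; first by move=> x; exists (i x).
exists X', j; split=> //; apply: mod_iso_sym.
have [h hE] := sum_linear i j.
apply: (@mod_iso_bij _ _ h) => [|y].
  apply: linear_inj => -[x x']; rewrite hE /= => e.
  have x0 : x = 0.
    by rewrite -[x]iK -[i x](addrK (j x')) e sub0r linearN (ses0 _ jp) oppr0.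
  move: e; rewrite x0 linear0 add0r => e; congr (_, _).
  by case: jp => jI _ _; apply: linear_inj0 e.
have [_ /(_ (y - i (p y))) [h1 _] _] := jp.
have [|x' ex'] := h1; first by rewrite linearB iK subrr.
by exists (p y, x'); rewrite hE /= ex' addrC subrK.
Qed.

(** A section makes Z a summand of Y whose complement is the kernel of p, and X is another copy of
    that kernel. *)
Lemma ses_split X Y Z (i : {linear X -> Y}) (p : {linear Y -> Z})
    (s : {linear Z -> Y}) :
  ses i p -> cancel s p -> mod_iso Y (X * Z)%type.
Proof.
move=> ip sK; have [X' [j [jp h]]] := summand_complement sK.
apply: (mod_iso_trans h); apply: (mod_iso_trans (mod_iso_pairC _ _)).
apply: mod_iso_pair (mod_iso_refl _).
have [g gE] := factor_ses ip (fun w => ses0 w jp).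
apply: (@mod_iso_bij _ _ g) => [x y e|x].
  by case: jp => jI _ _; apply: jI; rewrite -!gE e.
have [_ /(_ (i x))[h1 _] _] := jp; have [|x' e] := h1; first exact: ses0.
by exists x'; case: ip => iI _ _; apply: iI; rewrite gE.
Qed.

Lemma projective_summand X P : direct_summand X P -> projective P -> projective X.
Proof.
move=> [i [p iK]] Ppr Y Z g f gS.
by have [h hE] := Ppr Y Z g (f \o p) gS; exists (h \o i) => x /=; rewrite hE /= iK.
Qed.

Lemma projective_pair P Q : projective P -> projective Q -> projective (P * Q)%type.
Proof.
have [i1 [_ [_ i1E _]]] := ses_inl P Q.
have [i2 i2E] := @pair_linear P Q Q \0 idfun.
move=> Ppr Qpr Y Z g f gS.
have [h1 h1E] := Ppr Y Z g (f \o i1) gS.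
have [h2 h2E] := Qpr Y Z g (f \o i2) gS.
have [h hE] := sum_linear h1 h2.
exists h => -[x y]; rewrite hE linearD h1E h2E /= i1E i2E -linearD.
by congr (f _); congr (_, _); rewrite /= ?addr0 ?add0r.
Qed.

Lemma projective_section P X (p : {linear X -> P}) :
  projective P -> surjective_map p -> exists s : {linear P -> X}, cancel s p.
Proof. by move=> Ppr pS; have [s sE] := Ppr X P p idfun pS; exists s. Qed.

Lemma projective_iso X Y : mod_iso X Y -> projective X -> projective Y.
Proof. by move/mod_iso_sym/mod_iso_summand; apply: projective_summand. Qed.

Lemma zero_projective X : zero_module X -> projective X.
Proof.
by move=> X0 Y Z g f gS; exists \0 => x; rewrite (X0 x) !linear0.
Qed.

Lemma zero_ex : exists X, zero_module X.
Proof.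
exists {ffun 'I_0 -> R^o} => x; apply/ffunP => -[]//.
Qed.

Lemma ses_iso_r X Y Z Z' (i : {linear X -> Y}) (p : {linear Y -> Z}) :
  ses i p -> mod_iso Z Z' -> exists p' : {linear Y -> Z'}, ses i p'.
Proof.
move=> [iI e pS] /mod_isoP[f [g [fK gK]]]; exists (f \o p); split=> //.
  move=> y; rewrite -e /=; split=> [h|->]; last by rewrite linear0.
  by rewrite -[p y]fK h linear0.
by move=> z; have [y ey] := pS (g z); exists y; rewrite /= ey.
Qed.

Lemma ses_iso_l X X' Y Z (i : {linear X -> Y}) (p : {linear Y -> Z}) :
  ses i p -> mod_iso X X' -> exists i' : {linear X' -> Y}, ses i' p.
Proof.
move=> [iI e pS] /mod_isoP[f [g [fK gK]]]; exists (i \o g); split=> //.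
  by move=> x y /= /iI /(can_inj gK).
move=> y; rewrite e; split=> -[x h]; last by exists (g x).
by exists (f x); rewrite /= fK.
Qed.

Lemma ses_pairr X Y Z Q (i : {linear X -> Y}) (p : {linear Y -> Z}) :
  ses i p -> exists (i' : {linear X -> (Y * Q)%type})
    (p' : {linear (Y * Q)%type -> (Z * Q)%type}), ses i' p'.
Proof.
move=> [iI e pS].
have [i' iE] := pair_linear i (\0 : {linear X -> Q}).
have [p' pE] := pair_linear (p \o fst) (snd : {linear (Y * Q)%type -> Q}).
exists i', p'; split=> [x y|[y q]|[z q]].
- by rewrite !iE => -[/iI].
- rewrite pE /=; split=> [[/e[x ex] ->]|[x]]; first by exists x; rewrite iE ex.
  rewrite iE => -[h <-]; congr (_, _); apply/e; by exists x.
- by have [y ey] := pS z; exists (y, q); rewrite pE /= ey.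
Qed.

(** With a and b comparing the two projectives over M, the isomorphism is explicit: (k, x) goes to
    (k', i k + a x), where i' k' is the defect x - b (i k + a x). The symmetric formula is its
    inverse. *)
Lemma schanuel (M K P K' P' : lmodType R) (i : {linear K -> P}) (p : {linear P -> M})
    (i' : {linear K' -> P'}) (p' : {linear P' -> M}) :
  ses i p -> ses i' p' -> projective P -> projective P' ->
  mod_iso (K * P')%type (K' * P)%type.
Proof.
move=> ip ip' Ppr Ppr'; have [iI e pS] := ip; have [iI' e' pS'] := ip'.
have [a aE] := Ppr' P M p p' pS; have [b bE] := Ppr P' M p' p pS'.
have [h1 h1E] := sum_linear i a.
have [h2 h2E] := sum_linear i' b.
have [|f fE] := @factor_ses _ _ _ (K * P')%type i' p' (snd \- (b \o h1)) ip'.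
  by move=> w /=; rewrite linearB bE h1E linearD (ses0 _ ip) add0r aE subrr.
have [|g gE] := @factor_ses _ _ _ (K' * P)%type i p (snd \- (a \o h2)) ip.
  by move=> w /=; rewrite linearB aE h2E linearD (ses0 _ ip') add0r bE subrr.
have [F FE] := pair_linear f h1; have [G GE] := pair_linear g h2.
exists F, G => w.
  rewrite GE FE; case: w => k x.
  have h2x : h2 (f (k, x), h1 (k, x)) = x by rewrite h2E /= fE /= subrK.
  by rewrite h2x; congr (_, _); apply: iI; rewrite gE /= h2x h1E /= addrK.
rewrite FE GE; case: w => k x.
have h1x : h1 (g (k, x), h2 (k, x)) = x by rewrite h1E /= gE /= subrK.
by rewrite h1x; congr (_, _); apply: iI'; rewrite fE /= h1x h2E /= addrK.
Qed.

(** The last clause lifts compatible pairs; uniqueness of lifts is recovered where it is needed from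
    the exact sequence and the equation for g on the image of j. *)
Lemma pullback X Y Z W (i : {linear X -> Y}) (p : {linear Y -> Z})
    (f : {linear W -> Z}) :
  ses i p -> exists (E : lmodType R) (j : {linear X -> E}) (q : {linear E -> W})
    (g : {linear E -> Y}),
    [/\ ses j q, (forall x, g (j x) = i x), (forall v, p (g v) = f (q v))
      & forall y w, p y = f w -> exists v, g v = y /\ q v = w].
Proof.
move=> ip; have [iI e pS] := ip.
have [E [u [uI uE]]] := kernel_type ((p \o fst) \- (f \o snd) :
  {linear (Y * W)%type -> Z}).
have [i' iE] := @pair_linear Y W X i \0.
have [|j jE] := @factor_inj _ _ _ u i' uI.
  by move=> w; apply/uE; rewrite /= iE /= linear0 subr0 (ses0 _ ip).
have pf v : p (u v).1 = f (u v).2.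
  apply/subr0_eq.
  by have [_ /(_ (ex_intro _ v erefl))] := uE (u v).
have ex y w : p y = f w -> exists v, u v = (y, w).
  by move=> h; apply/uE; rewrite /= h subrr.
exists E, j, (snd \o u), (fst \o u); split.
- split.
  + by move=> x y /(congr1 u); rewrite !jE !iE => -[/iI].
  + move=> v /=; split=> [h|[x <-]]; last by rewrite jE iE.
    have /e[x ex1] : p (u v).1 = 0 by rewrite pf h linear0.
    by exists x; apply: uI; rewrite jE iE ex1 /= -h; case: (u v).
  + by move=> w; have [y ey] := pS (f w); have [v ev] := ex _ _ ey; exists v; rewrite /= ev.
- by move=> x /=; rewrite jE iE.
- exact: pf.
- by move=> y w /ex[v ev]; exists v; rewrite /= ev.
Qed.

(** L is the preimage of K in Y, so the kernel of a composite of surjections is an extension of the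
    second kernel by the first. *)
Lemma ses_comp X Y Z K Q (i : {linear X -> Y}) (p : {linear Y -> Z})
    (j : {linear K -> Z}) (q : {linear Z -> Q}) :
  ses i p -> ses j q -> exists (L : lmodType R) (u : {linear L -> Y}) (a : {linear X -> L})
    (b : {linear L -> K}),
    [/\ ses u (q \o p), ses a b, (forall x, u (a x) = i x)
      & forall l, j (b l) = p (u l)].
Proof.
move=> ip jq.
have [|L [u uqp]] := @ses_kernel _ _ (q \o p).
  move=> y; case: ip jq => _ _ pS [_ _ qS].
  by have [z <-] := qS y; have [x <-] := pS z; exists x.
have [b bE] : exists b : {linear L -> K}, forall l, j (b l) = p (u l).
  exact: (@factor_ses _ _ _ L j q (p \o u) jq (fun l => ses0 l uqp)).
have [|a aE] := factor_ses (f := i) uqp.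
  by move=> x /=; rewrite (ses0 _ ip) linear0.
exists L, u, a, b; split=> //.
have [iI e pS] := ip; have [uI ue _] := uqp; have [jI _ _] := jq.
split=> [x y /(congr1 u)|l|k].
- by rewrite !aE => /iI.
- split=> [h|[x <-]]; last by apply: jI; rewrite bE aE (ses0 _ ip) linear0.
  have /e[x ex] : p (u l) = 0 by rewrite -bE h linear0.
  by exists x; apply: uI; rewrite aE.
- have [y ey] := pS (j k).
  have /ue[l el] : (q \o p) y = 0 by rewrite /= ey (ses0 _ jq).
  by exists l; apply: jI; rewrite bE el.
Qed.

Lemma horseshoe X Y Z (i : {linear X -> Y}) (p : {linear Y -> Z})
    (KX P : lmodType R) (iX : {linear KX -> P}) (pX : {linear P -> X})
    (KZ P' : lmodType R) (iZ : {linear KZ -> P'}) (pZ : {linear P' -> Z}) :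
  ses i p -> ses iX pX -> ses iZ pZ -> projective P' ->
  exists (KY : lmodType R) (iY : {linear KY -> (P * P')%type}) (pY : {linear (P * P')%type -> Y})
    (a : {linear KX -> KY}) (b : {linear KY -> KZ}), ses iY pY /\ ses a b.
Proof.
move=> ip ipX ipZ Ppr.
have [iI e pS] := ip; have [iXI eX pXS] := ipX; have [iZI eZ pZS] := ipZ.
have [s sE] := Ppr Y Z p pZ pS.
have [pY pYE] := sum_linear (i \o pX) s.
have [|KY [iY ipY]] := @ses_kernel _ _ pY.
  move=> y; have [z ez] := pZS (p y).
  have /e[x ex] : p (y - s z) = 0 by rewrite linearB sE ez subrr.
  have [w ew] := pXS x.
  by exists (w, z); rewrite pYE /= ew ex subrK.
have [iYI eY _] := ipY.
have pZY w : pZ w.2 = p (pY w).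
  by rewrite pYE linearD /= (ses0 _ ip) add0r sE.
have [|b /= bE] := @factor_ses _ _ _ KY iZ pZ (snd \o iY) ipZ.
  by move=> w /=; rewrite pZY (ses0 _ ipY) linear0.
have [iX' iX'E] := @pair_linear P P' KX iX \0.
have [|a aE] := @factor_ses _ _ _ KX iY pY iX' ipY.
  by move=> w /=; rewrite iX'E pYE /= (ses0 _ ipX) !linear0 addr0.
exists KY, iY, pY, a, b; split=> //; split.
- by move=> x y /(congr1 iY); rewrite !aE !iX'E => -[/iXI].
- move=> y; split=> [h|[x <-]]; last by apply: iZI; rewrite bE aE iX'E linear0.
  have h2 : (iY y).2 = 0 by rewrite -[LHS]bE h linear0.
  have := ses0 y ipY; rewrite pYE h2 linear0 addr0 => h3.
  have /eX[x ex] := linear_inj0 iI h3.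
  by exists x; apply: iYI; rewrite aE iX'E ex /= -h2; case: (iY y).
(* s (iZ z) is killed by p, hence comes from some w in P through X; subtracting w puts (- w, iZ z)
   in the kernel of pY. *)
- move=> z; have /e[x ex] : p (s (iZ z)) = 0 by rewrite sE (ses0 _ ipZ).
  have [w ew] := pXS x.
  have /eY[y ey] : pY (- w, iZ z) = 0.
    by rewrite pYE /= linearN linearN ew ex addNr.
  by exists y; apply: iZI; rewrite bE ey.
Qed.

Lemma kernel_id Z : zero_module Z -> exists (K : lmodType R) (i : {linear K -> Z}),
  ses i (idfun : {linear Z -> Z}) /\ zero_module K.
Proof.
move=> Z0; have [|K [i ip]] := @ses_kernel _ _ (idfun : {linear Z -> Z}).
  by move=> x; exists x.
exists K, i; split=> // k; case: (ip) => iI _ _.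
by apply: iI; rewrite [LHS]Z0 linear0.
Qed.

End ShortExact.

(** * Syzygies and vanishing of Ext *)

Section Syzygies.
Variable R : pzRingType.
Implicit Types (K M N P Q X Y Z W : lmodType R) (Phi : lmodType R -> Prop).

Definition extends_along X Y N (i : {linear X -> Y}) :=
  forall f : {linear X -> N}, exists g : {linear Y -> N}, forall x, g (i x) = f x.

(* Ext^1(M, N) = 0 *)
Definition ext1_zero N M := forall K X (i : {linear K -> X}) (p : {linear X -> M}),
  ses i p -> extends_along N i.

Definition proj_equiv X Y := exists P Q,
  [/\ projective P, projective Q & mod_iso (X * P)%type (Y * Q)%type].

Definition stable Phi := forall X Y, proj_equiv X Y -> Phi X -> Phi Y.

Definition ext_closed Phi := forall X Y Z (i : {linear X -> Y}) (p : {linear Y -> Z}),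
  ses i p -> Phi X -> Phi Z -> Phi Y.

Definition summand_closed Phi := forall X Y, direct_summand X Y -> Phi Y -> Phi X.

(** Some n-th syzygy of M satisfies Phi. For Phi = [projective] this is projective dimension at most
    n; for Phi = [ext1_zero N] it is the vanishing of Ext^(n+1)(M, N), by dimension shifting. When
    Phi is stable the choice of syzygy does not matter, see [syz_all]. *)
Fixpoint syz Phi n M :=
  if n is m.+1 then
    exists (K P : lmodType R) (i : {linear K -> P}) (p : {linear P -> M}),
      [/\ ses i p, projective P & syz Phi m K]
  else Phi M.

Lemma proj_equiv_iso X Y : mod_iso X Y -> proj_equiv X Y.
Proof.
move=> XY; have [Z Z0] := zero_ex R; exists Z, Z.
by split; [exact: zero_projective..|exact: mod_iso_pair (mod_iso_refl _)].
Qed.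

Lemma proj_equiv_pair X Q : projective Q -> proj_equiv (X * Q)%type X.
Proof.
move=> Qpr; have [Z Z0] := zero_ex R; exists Z, (Q * Z)%type; split.
- exact: zero_projective.
- by apply: projective_pair => //; apply: zero_projective.
- exact/mod_iso_sym/mod_iso_pairA.
Qed.

Lemma syzygy_equiv X Y (K P K' P' : lmodType R) (i : {linear K -> P})
    (p : {linear P -> X}) (i' : {linear K' -> P'}) (p' : {linear P' -> Y}) :
  ses i p -> ses i' p' -> projective P -> projective P' ->
  proj_equiv X Y -> proj_equiv K K'.
Proof.
move=> ip ip' Ppr Ppr' [Q [Q' [Qpr Qpr' XY]]].
have [i1 [p1 ip1]] := ses_pairr Q ip; have [i2 [p2 ip2]] := ses_pairr Q' ip'.
have [p3 ip3] := ses_iso_r ip1 XY.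
have PQ := projective_pair Ppr Qpr; have PQ' := projective_pair Ppr' Qpr'.
by exists (P' * Q')%type, (P * Q)%type; split=> //; apply: schanuel ip3 ip2 _ _.
Qed.

(** The presentation of Y is made from that of X: P * Q maps onto X * Q, hence onto Y * Q' and onto
    Y. *)
Lemma syzygy_ex X Y (K P : lmodType R) (i : {linear K -> P})
    (p : {linear P -> X}) : ses i p -> projective P -> proj_equiv X Y ->
  exists (K' P' : lmodType R) (i' : {linear K' -> P'}) (p' : {linear P' -> Y}),
    ses i' p' /\ projective P'.
Proof.
move=> ip Ppr [Q [Q' [Qpr Qpr' XY]]].
have [i1 [p1 ip1]] := ses_pairr Q ip.
have [p3 [_ _ p3S]] := ses_iso_r ip1 XY.
have [|K' [i' ip']] := @ses_kernel _ _ _ (fst \o p3).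
  by move=> y; have [x ex] := p3S (y, 0); exists x; rewrite /= ex.
exists K', (P * Q)%type, i', (fst \o p3); split=> //; exact: projective_pair.
Qed.

Lemma syz_stable Phi n : stable Phi -> stable (syz Phi n).
Proof.
move=> PhiS; elim: n => //= n IHn X Y XY [K [P [i [p [ip Ppr hK]]]]].
have [K' [P' [i' [p' [ip' Ppr']]]]] := syzygy_ex ip Ppr XY.
exists K', P', i', p'; split=> //.
by apply: IHn hK; apply: syzygy_equiv ip ip' _ _ XY.
Qed.

Lemma syz_all Phi n M K P (i : {linear K -> P}) (p : {linear P -> M}) :
  stable Phi -> syz Phi n.+1 M -> ses i p -> projective P -> syz Phi n K.
Proof.
move=> PhiS [K' [P' [i' [p' [ip' Ppr' hK]]]]] ip Ppr.
apply: (syz_stable PhiS) hK; apply: syzygy_equiv ip' ip _ _ _ => //.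
exact/proj_equiv_iso/mod_iso_refl.
Qed.

Lemma stable_iso Phi X Y : stable Phi -> mod_iso X Y -> Phi X -> Phi Y.
Proof. by move=> h /proj_equiv_iso; apply: h. Qed.

Lemma syz_ext_closed Phi n : ext_closed Phi -> ext_closed (syz Phi n).
Proof.
move=> PhiE; elim: n => //= n IHn X Y Z i p ip.
move=> [K [P [iX [pX [ipX Ppr hK]]]]] [K' [P' [iZ [pZ [ipZ Ppr' hK']]]]].
have [KY [iY [pY [a [b [ipY ab]]]]]] := horseshoe ip ipX ipZ Ppr'.
exists KY, (P * P')%type, iY, pY; split=> //; first exact: projective_pair.
exact: IHn ab _ _.
Qed.

(* The pullback of p along a projective cover of Z is both an extension of Y
   by a syzygy of Z and the sum of X with a projective module. *)
Lemma syz_kernel Phi n X Y Z (i : {linear X -> Y}) (p : {linear Y -> Z}) :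
  stable Phi -> ext_closed Phi -> ses i p -> syz Phi n Y -> syz Phi n.+1 Z ->
  syz Phi n X.
Proof.
move=> PhiS PhiE ip hY [K [P [iZ [pZ [ipZ Ppr hK]]]]].
have [E [j [q [g [jq gj gq ex]]]]] := pullback pZ ip.
(* A pullback does not change kernels: q identifies the kernel of g with K. *)
have [j' j'g] : exists j' : {linear K -> E}, ses j' g.
  have [iZI eZ pZS] := ipZ.
  have gS' : surjective_map g.
    move=> y; have [w ew] := pZS (p y).
    by have [v [ev _]] := ex _ _ (esym ew); exists v.
  have [L [u ug]] := ses_kernel gS'; have [uI eu _] := ug.
  have [|a aE] := @factor_ses _ _ _ _ L iZ pZ (q \o u) ipZ.
    by move=> w /=; rewrite -gq (ses0 _ ug) linear0.
  have inj : forall v, g v = 0 -> q v = 0 -> v = 0.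
    move=> v gv qv; have [jI ej _] := jq.
    have /ej[x ex1] := qv; move: gv; rewrite -ex1 gj => /linear_inj0 x0.
    by rewrite x0 ?linear0 //; case: ip.
  have La : mod_iso L K.
    apply: (@mod_iso_bij _ _ _ a).
      apply: linear_inj => l al; apply: uI; rewrite linear0; apply: inj.
        exact: ses0 ug.
      by rewrite -[LHS]aE al linear0.
    move=> k; have [|v [gv qv]] := ex 0 (iZ k).
      by rewrite linear0 (ses0 _ ipZ).
    by have /eu[l el] := gv; exists l; apply: iZI; rewrite aE /= el.
  by have [j' h] := ses_iso_l ug La; exists j'.
have hE : syz Phi n E by apply: (syz_ext_closed PhiE) j'g hK hY.
have [_ _ qS] := jq.
have [s sK] := projective_section Ppr qS.
apply: (syz_stable PhiS) hE.
case: (proj_equiv_pair X Ppr) => A [B [Apr Bpr h]].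
exists A, B; split=> //; apply: mod_iso_trans h.
by apply: mod_iso_pair (mod_iso_refl _); apply: ses_split jq sK.
Qed.

(** A projective cover P of Y also covers Z, and the syzygy of Z so obtained is an extension of X by
    the syzygy of Y. *)
Lemma syz_cokernel Phi n X Y Z (i : {linear X -> Y}) (p : {linear Y -> Z}) :
  stable Phi -> ext_closed Phi -> ses i p -> syz Phi n X -> syz Phi n.+1 Y ->
  syz Phi n.+1 Z.
Proof.
move=> PhiS PhiE ip hX [K [P [iY [pY [ipY Ppr hK]]]]].
have [L [u [a [b [up ab _ _]]]]] := ses_comp ipY ip.
exists L, P, u, (p \o pY); split=> //.
exact: (syz_ext_closed PhiE) ab _ _.
Qed.

Lemma projective_stable : stable (@projective R).
Proof.
move=> X Y [P [Q [Ppr Qpr XY]]] Xpr.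
have := projective_iso XY (projective_pair Xpr Ppr).
apply: projective_summand.
have [i [_ [_ iE _]]] := ses_inl Y Q.
by exists i, fst => y; rewrite iE.
Qed.

Lemma projective_ext_closed : ext_closed (@projective R).
Proof.
move=> X Y Z i p ip Xpr Zpr; have [_ _ pS] := ip.
have [s sK] := projective_section Zpr pS.
by apply: projective_iso (projective_pair Xpr Zpr); apply/mod_iso_sym/(ses_split ip sK).
Qed.

Lemma projective_summand_closed : summand_closed (@projective R).
Proof. by move=> X P; apply: projective_summand. Qed.

Lemma syz_projectiveS n M : syz (@projective R) n M -> syz (@projective R) n.+1 M.
Proof.
elim: n M => [|n IHn] M.
  move=> Mpr; have [|K [i ip]] := @ses_kernel _ _ _ (idfun : {linear M -> M}).
    by move=> x; exists x.
  exists K, M, i, idfun; split=> //=; apply: zero_projective => k.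
  by case: (ip) => iI _ _; apply: linear_inj0 iI (ses0 k ip).
move=> [K [P [i [p [ip Ppr hK]]]]].
by exists K, P, i, p; split=> //; apply: IHn.
Qed.

Lemma syz_impl (Phi Psi : lmodType R -> Prop) n M :
  (forall X, Phi X -> Psi X) -> syz Phi n M -> syz Psi n M.
Proof.
move=> h; elim: n M => [|n IHn] M /=; first exact: h.
by move=> [K [P [i [p [ip Ppr hK]]]]]; exists K, P, i, p; split=> //; apply: IHn.
Qed.

Lemma syz_projective_leq m n M :
  (m <= n)%N -> syz (@projective R) m M -> syz (@projective R) n M.
Proof.
by move=> /subnK <-; elim: (n - m)%N => //= d IHd /IHd/syz_projectiveS.
Qed.

Lemma projective_ext1 N P : projective P -> ext1_zero N P.
Proof.
move=> Ppr K X i p ip f; have [_ _ pS] := ip.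
have [s sK] := projective_section Ppr pS.
have [|a aE] := @factor_ses _ _ _ _ X i p (idfun \- (s \o p)) ip.
  by move=> w /=; rewrite linearB sK subrr.
exists (f \o a) => x /=; congr (f _); case: ip (ip) => iI _ _ ip.
by apply: iI; rewrite aE /= (ses0 _ ip) linear0 subr0.
Qed.

(** One projective presentation controls all sequences ending in M: X is the quotient of K' * P by
    the pairs (- a0 x, i x), so f on K' and an extension g of f a0 to P glue to a map on X. *)
Lemma ext1_of_projective N M K P (i : {linear K -> P}) (p : {linear P -> M}) :
  ses i p -> projective P -> extends_along N i -> ext1_zero N M.
Proof.
move=> ip Ppr iN K' X i' p' ip' f; have [_ _ pS'] := ip'.
have [a aE] := Ppr X M p' p pS'.
have [|a0 a0E] := @factor_ses _ _ _ _ K i' p' (a \o i) ip'.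
  by move=> w /=; rewrite aE (ses0 _ ip).
have [g gE] := iN (f \o a0).
have [h hE] := sum_linear i' a; have [h' h'E] := sum_linear f g.
have [||w wE] := @factor_surj _ _ _ N h h'.
- move=> x; have [_ e' _] := ip'; have [_ _ pS] := ip.
  have [y ey] := pS (p' x).
  have /e'[k ek] : p' (x - a y) = 0 by rewrite linearB aE ey subrr.
  by exists (k, y); rewrite hE /= ek subrK.
- move=> [k y]; rewrite hE h'E /= => e.
  have [_ ep _] := ip.
  have /ep[x ex] : p y = 0.
    by rewrite -aE -[a y](addKr (i' k)) e addr0 linearN (ses0 _ ip') oppr0.
  have [iI' _ _] := ip'.
  have -> : k = - a0 x.
    apply: iI'; rewrite linearN a0E /= ex; apply/eqP.
    by rewrite -addr_eq0 e.
  by rewrite -ex gE linearN addNr.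
- exists w => k.
  have := wE (k, 0); rewrite hE h'E /= !linear0 !addr0.
  by [].
Qed.

(** A map on K is extended first to the preimage of X in W, then from there to W. *)
Lemma ext1_ext_closed N : ext_closed (ext1_zero N).
Proof.
move=> X Y Z i p ip hX hZ K W j q jq f.
have [L [u [a [b [uqp ab ua _]]]]] := ses_comp jq ip.
have [g gE] := hX _ _ _ _ ab f.
have [h hE] := hZ _ _ _ _ uqp g.
by exists h => k; rewrite -ua hE gE.
Qed.

(** A sequence ending in X is pulled back along the retraction r to one ending in Y, where f
    extends; W maps back into the pullback through the section s. *)
Lemma ext1_summand_closed N : summand_closed (ext1_zero N).
Proof.
move=> X Y [s [r sK]] hY K W j q jq f.
have [E [j' [q' [g [jq' gj gq ex]]]]] := pullback r jq.
have [h hE] := hY _ _ _ _ jq' f.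
have [qj [jI ej _]] : (forall w, q' (j' w) = 0) /\ ses j' q' by split=> // w; apply: ses0 jq'.
have uniq v v' : g v = g v' -> q' v = q' v' -> v = v'.
  move=> e1 e2; apply/subr0_eq.
  have /ej[k ek] : q' (v - v') = 0 by rewrite linearB e2 subrr.
  have : g (v - v') = 0 by rewrite linearB e1 subrr.
  rewrite -ek gj => /linear_inj0 -> //; rewrite ?linear0 //.
  by case: jq.
have /choice[t tE] w : exists v, g v = w /\ q' v = s (q w).
  by apply: ex; rewrite sK.
have [|t' t'E] := @linear_ext R W E t.
  move=> c x y; have [h1 h2] := tE (c *: x + y).
  have [h3 h4] := tE x; have [h5 h6] := tE y.
  by apply: uniq; rewrite ?h1 ?h2 !linearP ?h3 ?h5 ?h4 ?h6.
exists (h \o t') => k /=; rewrite -hE; congr (h _); rewrite t'E.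
have [h1 h2] := tE (j k).
by apply: uniq; rewrite ?h1 ?h2 ?gj ?qj // (ses0 _ jq) linear0.
Qed.

Lemma ext1_stable N : stable (ext1_zero N).
Proof.
move=> X Y [P [Q [Ppr Qpr XY]]] hX.
have [i [p [ip _ _]]] := ses_inl X P.
have hXP := ext1_ext_closed ip hX (projective_ext1 (N := N) Ppr).
have [i' [_ [_ iE' _]]] := ses_inl Y Q.
apply: (@ext1_summand_closed N Y (X * P)%type) => //.
apply: summand_trans (mod_iso_summand (mod_iso_sym XY)).
by exists i', fst => y; rewrite iE'.
Qed.

(* Ext^i(M, N) = 0 for all i >= 1 *)
Definition ext_zero N M := forall n, syz (ext1_zero N) n M.

Lemma ext_zero_ext1 N M : ext_zero N M -> ext1_zero N M.
Proof. by move/(_ 0%N). Qed.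

Lemma ext_zero_syzygy N M K P (i : {linear K -> P}) (p : {linear P -> M}) :
  ses i p -> projective P -> ext_zero N M -> ext_zero N K.
Proof. by move=> ip Ppr h n; apply: syz_all (h n.+1) ip Ppr; apply: ext1_stable. Qed.

Lemma ext_zero_of_syzygy N M K P (i : {linear K -> P}) (p : {linear P -> M}) :
  ses i p -> projective P -> extends_along N i -> ext_zero N K -> ext_zero N M.
Proof.
move=> ip Ppr iN h [|n] /=; first exact: ext1_of_projective ip Ppr iN.
by exists K, P, i, p.
Qed.

Lemma ext_zero_projective N P : projective P -> ext_zero N P.
Proof.
move=> Ppr n; apply: (@syz_impl (@projective R)) => [X|]; first exact: projective_ext1.
by elim: n => // n; apply: syz_projectiveS.
Qed.

Lemma ext_zero_stable N : stable (ext_zero N).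
Proof. by move=> X Y XY h n; apply: (syz_stable (@ext1_stable N)) (h n). Qed.

Lemma ext_zero_kernel N X Y Z (i : {linear X -> Y}) (p : {linear Y -> Z}) :
  ses i p -> ext_zero N Y -> ext_zero N Z -> ext_zero N X.
Proof.
move=> ip hY hZ n; apply: syz_kernel ip (hY n) (hZ n.+1).
  exact: ext1_stable.
exact: ext1_ext_closed.
Qed.

End Syzygies.

(** * Finitely generated modules, free modules and finite powers *)

Section Finite.
Variable R : pzRingType.
Implicit Types (K M N P Q X Y Z W T : lmodType R) (Phi : lmodType R -> Prop).

Definition free_mod n : lmodType R := {ffun 'I_n -> R^o}.

Definition free_delta n (i : 'I_n) : free_mod n := [ffun j => (i == j)%:R].

Lemma free_delta_sum n (x : free_mod n) : x = \sum_i (x i : R) *: free_delta i.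
Proof.
apply/ffunP => j; rewrite sum_ffunE (bigD1 j) //= big1 => [|i ij].
  by rewrite !ffunE eqxx addr0; exact: esym (mulr1 _).
by rewrite !ffunE (negbTE ij); exact: mulr0.
Qed.

Lemma free_linear n M (v : 'I_n -> M) : exists f : {linear free_mod n -> M},
  (forall x, f x = \sum_i (x i : R) *: v i) /\ forall i, f (free_delta i) = v i.
Proof.
have [|f fE] := @linear_ext R (free_mod n) M (fun x => \sum_i (x i : R) *: v i).
  move=> a x y; rewrite scaler_sumr -big_split; apply: eq_bigr => i _ /=.
  by rewrite !ffunE scalerDl scalerA.
exists f; split=> // i; rewrite fE (bigD1 i) //= big1 => [|j ji].
  by rewrite ffunE eqxx scale1r addr0.
by rewrite ffunE eq_sym (negbTE ji) scale0r.
Qed.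

Lemma free_ext n M (f g : {linear free_mod n -> M}) :
  (forall i, f (free_delta i) = g (free_delta i)) -> f =1 g.
Proof.
move=> h x; rewrite (free_delta_sum x) !linear_sum.
by apply: eq_bigr => i _; rewrite !linZ h.
Qed.

Lemma free_projective n : projective (free_mod n).
Proof.
move=> X Y g f gS; have [s sE] := choice gS.
have [h [_ hE]] := free_linear (fun i => s (f (free_delta i))).
exists h => x; have := @free_ext n Y (g \o h) f; apply => i /=.
by rewrite hE sE.
Qed.

Lemma finitely_generatedP M : finitely_generated M <->
  exists n (p : {linear free_mod n -> M}), surjective_map p.
Proof.
split=> [[n [v vE]]|[n [p pS]]].
  have [p [pE _]] := free_linear v; exists n, p => x.
  by have [c ->] := vE x; exists [ffun i => c i]; rewrite pE; apply: eq_bigr => i _; rewrite ffunE.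
exists n, (fun i => p (free_delta i)) => x; have [y <-] := pS x.
exists y; rewrite {1}(free_delta_sum y) linear_sum.
by apply: eq_bigr => i _; rewrite linZ.
Qed.

Lemma fg_surj X Y (p : {linear X -> Y}) :
  surjective_map p -> finitely_generated X -> finitely_generated Y.
Proof.
move=> pS /finitely_generatedP[n [q qS]]; apply/finitely_generatedP.
exists n, (p \o q) => y; have [x <-] := pS y; have [z <-] := qS x.
by exists z.
Qed.

Lemma fg_iso X Y : mod_iso X Y -> finitely_generated X -> finitely_generated Y.
Proof.
by move=> [f [g _ gK]]; apply: (@fg_surj _ _ f) => y; exists (g y).
Qed.

Lemma fg_summand X Y : direct_summand X Y -> finitely_generated Y -> finitely_generated X.
Proof. by move=> [i [p iK]]; apply: (@fg_surj _ _ p) => x; exists (i x). Qed.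

Lemma fg_free n : finitely_generated (free_mod n).
Proof. by apply/finitely_generatedP; exists n, idfun => x; exists x. Qed.

Lemma fg_ext X Y Z (i : {linear X -> Y}) (p : {linear Y -> Z}) :
  ses i p -> finitely_generated X -> finitely_generated Z -> finitely_generated Y.
Proof.
move=> [_ e pS] [n [v vE]] [m [w wE]].
have [s sE] := choice pS.
exists (n + m)%N, (fun j => match split j with inl a => i (v a) | inr b => s (w b) end).
move=> y; have [c cE] := wE (p y).
have /e[x ex] : p (y - \sum_i c i *: s (w i)) = 0.
  rewrite linearB linear_sum cE; apply/eqP; rewrite subr_eq0; apply/eqP.
  by apply: eq_bigr => j _; rewrite linZ sE.
have [d dE] := vE x.
exists (fun j => match split j with inl a => d a | inr b => c b end).
rewrite -[y in LHS](subrK (\sum_i c i *: s (w i))) -ex dE linear_sum big_split_ord /=.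
congr (_ + _); apply: eq_bigr => j _.
  by rewrite linZ (unsplitK (inl _ j)).
by rewrite (unsplitK (inr _ j)).
Qed.

Lemma ses_sum X Y Z X' Y' Z' (i : {linear X -> Y}) (p : {linear Y -> Z})
    (i' : {linear X' -> Y'}) (p' : {linear Y' -> Z'}) :
  ses i p -> ses i' p' -> exists (u : {linear (X * X')%type -> (Y * Y')%type})
    (q : {linear (Y * Y')%type -> (Z * Z')%type}), ses u q.
Proof.
move=> [iI e pS] [iI' e' pS'].
have [u uE] := pair_linear (i \o fst) (i' \o snd).
have [q qE] := pair_linear (p \o fst) (p' \o snd).
exists u, q; split=> [[x x'] [y y']|[y y']|[z z']].
- by rewrite !uE => -[/iI/= -> /iI'/= ->].
- rewrite qE /=; split=> [[/e[x <-] /e'[x' <-]]|[[x x']]].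
    by exists (x, x'); rewrite uE.
  rewrite uE /= => -[<- <-]; congr (_, _).
    by apply/e; exists x.
  by apply/e'; exists x'.
- have [y ey] := pS z; have [y' ey'] := pS' z'.
  by exists (y, y'); rewrite qE /= ey ey'.
Qed.

Lemma summand_fst X Y : direct_summand X (X * Y)%type.
Proof.
by have [i [_ [_ iE _]]] := ses_inl X Y; exists i, fst => x; rewrite iE.
Qed.

Lemma fg_zero X : zero_module X -> finitely_generated X.
Proof.
move=> X0; exists 0%N, (fun _ => 0) => x; exists (fun _ => 0).
by rewrite [LHS]X0 [RHS]X0.
Qed.

Lemma ffun0_zero T : zero_module {ffun 'I_0 -> T}.
Proof. by move=> x; apply/ffunP => -[]. Qed.

Lemma ffunS_iso n T : mod_iso (T * {ffun 'I_n -> T})%type {ffun 'I_n.+1 -> T}.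
Proof.
have [|f fE] := @linear_ext R (T * {ffun 'I_n -> T})%type {ffun 'I_n.+1 -> T}
  (fun x => [ffun i => if unlift ord0 i is Some j then x.2 j else x.1]).
  move=> a x y; apply/ffunP => i; rewrite !ffunE.
  by case: (unlift ord0 i) => [j|] //; rewrite /= !ffunE.
exists f, (fun x : {ffun 'I_n.+1 -> T} =>
  (x ord0, [ffun j : 'I_n => x (lift ord0 j)])) => x; rewrite fE.
  case: x => t x; congr (_, _); first by rewrite ffunE unlift_none.
  by apply/ffunP => j; rewrite !ffunE liftK.
apply/ffunP => i; rewrite !ffunE; case: unliftP => [j ->|->] //=.
by rewrite ffunE.
Qed.

Lemma power_iso n X Y : mod_iso X Y -> mod_iso {ffun 'I_n -> X} {ffun 'I_n -> Y}.
Proof.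
move=> /mod_isoP[f [g [fK gK]]].
have [|F FE] := @linear_ext R {ffun 'I_n -> X} {ffun 'I_n -> Y}
    (fun x => [ffun j => f (x j)]).
  by move=> r x y; apply/ffunP => j; rewrite !ffunE linearP.
exists F, (fun y : {ffun 'I_n -> Y} => [ffun j => g (y j)]) => x.
  by rewrite FE; apply/ffunP => j; rewrite !ffunE fK.
by rewrite FE; apply/ffunP => j; rewrite !ffunE gK.
Qed.

Lemma power_closed Phi T n : stable Phi -> ext_closed Phi ->
  (forall Z, zero_module Z -> Phi Z) -> Phi T -> Phi {ffun 'I_n -> T}.
Proof.
move=> PhiS PhiE Phi0 hT; elim: n => [|n IHn].
  exact/Phi0/ffun0_zero.
apply: (stable_iso PhiS (ffunS_iso n T)).
by have [i [p [ip _ _]]] := ses_inl T {ffun 'I_n -> T}; apply: PhiE ip hT IHn.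
Qed.

Lemma fg_power T n : finitely_generated T -> finitely_generated {ffun 'I_n -> T}.
Proof.
move=> hT; elim: n => [|n IHn]; first exact/fg_zero/ffun0_zero.
apply: fg_iso (ffunS_iso n T) _.
by have [i [p [ip _ _]]] := ses_inl T {ffun 'I_n -> T}; apply: fg_ext ip hT IHn.
Qed.

Definition noetherian := forall M, finitely_generated M ->
  forall K (i : {linear K -> M}), injective i -> finitely_generated K.

Lemma fg_cover M : finitely_generated M -> exists n (K : lmodType R)
  (i : {linear K -> free_mod n}) (p : {linear free_mod n -> M}), ses i p.
Proof.
move=> /finitely_generatedP[n [p pS]]; have [K [i ip]] := ses_kernel pS.
by exists n, K, i, p.
Qed.

Hypothesis noethR : noetherian.

Lemma fg_cover_noetherian M : finitely_generated M -> exists n (K : lmodType R)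
  (i : {linear K -> free_mod n}) (p : {linear free_mod n -> M}),
  ses i p /\ finitely_generated K.
Proof.
move=> /fg_cover[n [K [i [p ip]]]]; exists n, K, i, p; split=> //.
by case: (ip) => iI _ _; apply: noethR (fg_free n) _ _ iI.
Qed.

(** X and its complement X' are covered separately, so that the sum of the two presentations is one
    of Y and its syzygy has that of X as a summand. Noetherianity keeps these syzygies finitely
    generated for the next round. *)
Lemma syz_summand_closed Phi n X Y : stable Phi -> summand_closed Phi ->
  finitely_generated Y -> direct_summand X Y -> syz Phi n Y -> syz Phi n X.
Proof.
move=> PhiS PhiD; elim: n X Y => [|n IHn] X Y Yfg XY hY; first exact: PhiD XY hY.
case: XY (XY) => i [p iK] XY.
have [X' [j [jp YE]]] := summand_complement iK.
have X'fg : finitely_generated X'.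
  by case: jp => jI _ _; apply: noethR Yfg _ _ jI.
have [m [K [u [q [uq Kfg]]]]] := fg_cover_noetherian (fg_summand XY Yfg).
have [m' [K' [u' [q' [uq' Kfg']]]]] := fg_cover_noetherian X'fg.
exists K, (free_mod m), u, q; split=> //; first exact: free_projective.
have [u1 [q1 uq1]] := ses_sum uq uq'.
have hK : syz Phi n (K * K')%type.
  apply: syz_all uq1 _ => //.
    exact: stable_iso (syz_stable PhiS) YE hY.
  exact: projective_pair (@free_projective _) (@free_projective _).
apply: IHn hK.
  have [i1 [p1 [ip1 _ _]]] := ses_inl K K'; exact: fg_ext ip1 Kfg Kfg'.
exact: summand_fst.
Qed.

Lemma power_summand_closed Phi n T X : stable Phi -> ext_closed Phi ->
  (forall Z, projective Z -> Phi Z) -> summand_closed Phi -> finitely_generated T ->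
  in_add T X -> syz Phi n T -> syz Phi n X.
Proof.
move=> PhiS PhiE Phi0 PhiD Tfg [m XT] hT.
apply: syz_summand_closed XT _ => //; first exact: fg_power.
apply: power_closed hT; [exact: syz_stable|exact: syz_ext_closed|].
move=> Z Z0; elim: n Z Z0 => [|n IHn] Z Z0; first exact/Phi0/zero_projective.
have [K [i [ip K0]]] := kernel_id Z0.
by exists K, Z, i, idfun; split=> //; [exact: zero_projective|apply: IHn].
Qed.

End Finite.

(** * Resolutions and coresolutions *)

Section Resolutions.
Variable R : pzRingType.
Implicit Types (K M N P Q X Y Z W T : lmodType R).

(** Vanishing of H^(j+1)(Hom(P, N)); the index is shifted so that it counts syzygies. *)
Definition coh_zero M (P : projective_resolution M) N j :=
  forall f : {linear P j.+1 -> N}, (forall x, f (res_d P j.+1 x) = 0) ->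
  exists g : {linear P j -> N}, forall x, f x = g (res_d P j x).

(** Dimension shifting: dropping P 0 leaves a resolution of K, and cohomology moves down one degree,
    the lowest degree turning into extension of maps from K to P 0. *)
Lemma resolution_shift M (P : projective_resolution M) :
  exists K (i : {linear K -> P 0%N}) (P' : projective_resolution K),
  [/\ ses i (res_aug P), forall j, zero_module (P j.+1) -> zero_module (P' j),
      forall N, coh_zero P N 0 <-> extends_along N i
    & forall N j, coh_zero P N j.+1 <-> coh_zero P' N j].
Proof.
have [K [i ip]] := ses_kernel (res_aug_surj P); have [iI e pS] := ip.
have [|a aE] := @factor_ses _ _ _ _ (P 1%N) i (res_aug P) (res_d P 0%N) ip.
  by move=> w; apply/res_exact0; exists w.
have aS : surjective_map a.
  move=> k; have [h _] := @res_exact0 _ _ P (i k); have [|x ex] := h; first exact: ses0 ip.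
  by exists x; apply: iI; rewrite aE.
have ae : exact_at (res_d P 1%N) a.
  move=> x; rewrite -(@res_exactS _ _ P 0%N x) -aE; split=> [->|]; first exact: linear0.
  exact: linear_inj0.
exists K, i, (ProjectiveResolution (fun j => @res_projective _ _ P j.+1) aS ae
   (fun j => @res_exactS _ _ P j.+1)); split=> //.
move=> N; split=> [h f|h f f0].
  have [|g gE] := h (f \o a).
    by move=> x /=; have [_ ->] := ae (res_d P 1%N x); rewrite ?linear0 //; exists x.
  by exists g => k; have [x <-] := aS k; rewrite aE -gE.
have [|f' f'E] := factor_surj aS (f := f); first by move=> x /ae[y <-].
by have [g gE] := h f'; exists g => x; rewrite -aE gE f'E.
Qed.

Lemma resolution_splice K P M (i : {linear K -> P}) (p : {linear P -> M})
    (P' : projective_resolution K) : ses i p -> projective P ->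
  exists Q : projective_resolution M,
    forall j, zero_module (P' j) -> zero_module (Q j.+1).
Proof.
move=> ip Ppr; have [iI e pS] := ip.
pose obj j := if j is j'.+1 then P' j' else P.
pose d j : {linear obj j.+1 -> obj j} :=
  match j with 0%N => i \o res_aug P' | j'.+1 => res_d P' j' end.
have pr j : projective (obj j) by case: j => //= j; apply: res_projective.
have ex0 : exact_at (d 0%N) p.
  move=> y; rewrite e; split=> [[k <-]|[x <-]]; last by exists (res_aug P' x).
  by have [x <-] := res_aug_surj P' k; exists x.
have exS j : exact_at (d j.+1) (d j).
  case: j => [|j]; last exact: res_exactS.
  move=> x; rewrite -(@res_exact0 _ _ P' x) /=; split=> [|->]; last exact: linear0.
  exact: linear_inj0.
by exists (ProjectiveResolution pr pS ex0 exS).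
Qed.

Lemma syz_of_resolution n M (P : projective_resolution M) :
  (forall j, (n < j)%N -> zero_module (P j)) -> syz (@projective R) n M.
Proof.
elim: n M P => [|n IHn] M P P0; have [K [i [P' [ip Pz _ _]]]] := resolution_shift P.
  have P'0 : zero_module (P' 0%N) by apply/Pz/P0.
  have K0 : zero_module K.
    by move=> k; have [x <-] := res_aug_surj P' k; rewrite [x]P'0 linear0.
  apply: projective_iso (@res_projective _ _ P 0%N).
  apply: (@mod_iso_bij _ _ _ (res_aug P)); last exact: res_aug_surj.
  apply: linear_inj => x; case: ip => _ e _ /e[k <-].
  by rewrite [k]K0 linear0.
exists K, (P 0%N), i, (res_aug P); split=> //; first exact: res_projective.
by apply: (IHn _ P') => j nj; apply/Pz/P0.
Qed.

Lemma resolution_of_syz n M :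
  syz (@projective R) n M -> finite_projective_dimension M.
Proof.
suff h : syz (@projective R) n M -> exists P : projective_resolution M,
  forall i, (n < i)%N -> zero_module (P i) by move=> /h[P PE]; exists P, n.
elim: n M => [|n IHn] M.
  move=> Mpr; have [Z Z0] := zero_ex R.
  pose obj j := if j is _.+1 then Z else M.
  pose d j : {linear obj j.+1 -> obj j} := \0.
  have pr j : projective (obj j) by case: j => //= j; apply: zero_projective.
  have pS : surjective_map (idfun : {linear obj 0%N -> M}) by move=> x; exists x.
  have ex0 : exact_at (d 0%N) (idfun : {linear obj 0%N -> M}).
    by move=> y; split=> [/= ->|[x /= <-]//]; exists 0.
  have exS j : exact_at (d j.+1) (d j).
    by move=> x; split=> // _; exists 0; rewrite [RHS](Z0 x).
  by exists (ProjectiveResolution pr pS ex0 exS) => -[].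
move=> [K [P [i [p [ip Ppr hK]]]]].
have [P' P'E] := IHn _ hK; have [Q QE] := resolution_splice P' ip Ppr.
by exists Q => -[//|j] nj; apply/QE/P'E.
Qed.

(** The right-hand side does not mention P, so the vanishing of cohomology is independent of the
    resolution. *)
Lemma coh_zeroP M (P : projective_resolution M) N j :
  coh_zero P N j <-> syz (ext1_zero N) j M.
Proof.
elim: j M P => [|j IHj] M P; have [K [i [P' [ip _ h0 hS]]]] := resolution_shift P.
  rewrite h0; split=> [|h]; last exact: h ip.
  by move/(ext1_of_projective ip); apply; apply: res_projective.
rewrite hS IHj; split=> [h|h].
  by exists K, (P 0%N), i, (res_aug P); split=> //; apply: res_projective.
by apply: syz_all h ip _; [exact: ext1_stable|exact: res_projective].
Qed.

(** [Ext_zero] quantifies over all resolutions of M and would hold vacuously if there were none,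
    hence the existence assumption. *)
Lemma ext_zeroP M N : (exists P : projective_resolution M, True) ->
  (forall i, (1 <= i)%N -> Ext_zero i M N) <-> ext_zero N M.
Proof.
move=> [P _]; split=> [h n|h [//|i] _ Q].
  by apply/(coh_zeroP P); apply: (h n.+1).
exact/coh_zeroP.
Qed.

Definition fin_pd M := finitely_generated M /\ exists n, syz (@projective R) n M.

Lemma fin_pdimP M : fin_pdim M <-> fin_pd M.
Proof.
split=> -[Mfg]; first by move=> [P [n nP]]; split=> //; exists n; apply: syz_of_resolution nP.
by move=> [n hn]; split=> //; apply: resolution_of_syz hn.
Qed.

Lemma fin_pd_resolution M : fin_pd M -> exists P : projective_resolution M, True.
Proof. by move/fin_pdimP => [_ [P _]]; exists P. Qed.

(** A finite coresolution cut into short exact sequences, which replaces induction on its length by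
    structural induction. *)
Inductive add_cores T : lmodType R -> Prop :=
| AddCores0 M of in_add T M : add_cores T M
| AddCoresS M Q X (i : {linear M -> Q}) (p : {linear Q -> X}) of
    ses i p & in_add T Q & add_cores T X : add_cores T M.

Lemma in_add_iso T X Y : mod_iso X Y -> in_add T X -> in_add T Y.
Proof.
move=> /mod_iso_sym/mod_iso_summand XY [n Xn]; exists n; exact: summand_trans Xn.
Qed.

Lemma add_cores_iso T X Y : mod_iso X Y -> add_cores T X -> add_cores T Y.
Proof.
move=> XY hX; elim: hX XY => {}X.
  by move=> hX XY; apply/AddCores0/(in_add_iso XY).
move=> Q Z i p ip hQ hZ _ XY; have [i' ip'] := ses_iso_l ip XY.
exact: AddCoresS ip' hQ hZ.
Qed.

Lemma add_cores_of_coresolution T M :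
  inhabited (finite_add_coresolution T M) -> add_cores T M.
Proof.
move=> [C]; move en: (cores_len C) => n.
elim: n M C en => [|n IHn] M C en.
  have Z1 : zero_module (C 1%N) by apply: cores_zero; rewrite en.
  apply/AddCores0/(@in_add_iso _ (C 0%N)); last by apply: cores_add; rewrite en.
  apply/mod_iso_sym/(mod_iso_bij (@cores_aug_inj _ _ _ C)) => y.
  by apply/cores_exact0; apply: Z1.
have [Z [p ip]] := ses_cokernel (@cores_aug_inj _ _ _ C); have [_ e pS] := ip.
have [|a aE] := factor_surj pS (f := cores_d C 0%N).
  by move=> x /e[m <-]; apply/cores_exact0; exists m.
have aI : injective a.
  apply: linear_inj => z; have [x <-] := pS z; rewrite aE => /cores_exact0[m <-].
  exact: ses0 ip.
have ae : exact_at a (cores_d C 1%N).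
  move=> y; rewrite (@cores_exactS _ _ _ C 0%N y); split=> -[x <-].
    by exists (p x); rewrite aE.
  by have [w <-] := pS x; exists w; rewrite aE.
apply: (AddCoresS ip); first by apply: cores_add; rewrite en.
have hadd i : (i <= n)%N -> in_add T (C i.+1) by move=> h; apply: cores_add; rewrite en.
have hzero i : (n < i)%N -> zero_module (C i.+1) by move=> h; apply: cores_zero; rewrite en.
exact: (IHn _ (FiniteAddCoresolution hadd hzero aI ae
  (fun j => @cores_exactS _ _ _ C j.+1))).
Qed.

Lemma coresolution_of_add_cores T M :
  add_cores T M -> inhabited (finite_add_coresolution T M).
Proof.
elim=> {}M.
  move=> hM; have [Z Z0] := zero_ex R.
  pose obj j := if j is _.+1 then Z else M.
  pose d j : {linear obj j -> obj j.+1} := \0.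
  have hadd i : (i <= 0)%N -> in_add T (obj i) by case: i.
  have hzero i : (0 < i)%N -> zero_module (obj i) by case: i.
  have iI : injective (idfun : {linear M -> obj 0%N}) by [].
  have ex0 : exact_at (idfun : {linear M -> obj 0%N}) (d 0%N).
    by move=> y; split=> // _; exists y.
  have exS j : exact_at (d j) (d j.+1).
    by move=> x; split=> // _; exists 0; rewrite [RHS](Z0 x).
  by constructor; apply: FiniteAddCoresolution hadd hzero iI ex0 exS.
move=> Q X i p ip hQ _ [C]; have [iI e pS] := ip.
pose obj j := if j is j'.+1 then C j' else Q.
pose d j : {linear obj j -> obj j.+1} :=
  match j with 0%N => cores_aug C \o p | j'.+1 => cores_d C j' end.
have hadd j : (j <= (cores_len C).+1)%N -> in_add T (obj j).
  by case: j => //= j; apply: cores_add.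
have hzero j : ((cores_len C).+1 < j)%N -> zero_module (obj j).
  by case: j => //= j; apply: cores_zero.
have ex0 : exact_at (i : {linear M -> obj 0%N}) (d 0%N).
  move=> y; rewrite -e /=; split=> [|->]; last exact: linear0.
  exact/linear_inj0/cores_aug_inj.
have exS j : exact_at (d j) (d j.+1).
  case: j => [|j]; last exact: cores_exactS.
  move=> y; rewrite (@cores_exact0 _ _ _ C y) /=; split=> -[x <-].
    by have [w <-] := pS x; exists w.
  by exists (p x).
by constructor; apply: FiniteAddCoresolution hadd hzero iI ex0 exS.
Qed.

Lemma tiltingP T : tilting T <->
  [/\ fin_pd T, ext_zero T T & add_cores T R^o].
Proof.
split=> [[/fin_pdimP hT hE hC]|[hT hE hC]]; split.
- by [].
- by apply/(ext_zeroP _ (fin_pd_resolution hT)).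
- exact: add_cores_of_coresolution.
- exact/fin_pdimP.
- by apply/(ext_zeroP _ (fin_pd_resolution hT)).
- exact: coresolution_of_add_cores.
Qed.

Lemma strong_tiltingP T : strong_tilting T <->
  [/\ fin_pd T, add_cores T R^o & forall M, fin_pd M -> ext_zero T M].
Proof.
split=> [[/tiltingP[hT hE hC] h]|[hT hC h]].
  split=> // M hM; apply/(ext_zeroP _ (fin_pd_resolution hM)).
  exact/h/fin_pdimP.
split; first by apply/tiltingP; split=> //; apply: h.
by move=> M /fin_pdimP hM; apply/(ext_zeroP _ (fin_pd_resolution hM))/h.
Qed.

Lemma fin_pd_iso X Y : mod_iso X Y -> fin_pd X -> fin_pd Y.
Proof.
move=> XY [Xfg [n hn]]; split; first exact: fg_iso XY Xfg.
by exists n; apply: stable_iso (syz_stable (@projective_stable R)) XY hn.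
Qed.

Lemma ext_zero_iso N X Y : mod_iso X Y -> ext_zero N X -> ext_zero N Y.
Proof. by move=> XY; apply: stable_iso XY; apply: ext_zero_stable. Qed.

Lemma fin_pd_cokernel X Y Z (i : {linear X -> Y}) (p : {linear Y -> Z}) :
  ses i p -> fin_pd X -> fin_pd Y -> fin_pd Z.
Proof.
move=> ip [_ [n hX]] [Yfg [m hY]]; split; first by case: ip => _ _ pS; apply: fg_surj pS Yfg.
exists (maxn n m).+1; apply: syz_cokernel ip _ _.
- exact: projective_stable.
- exact: projective_ext_closed.
- by apply: syz_projective_leq hX; apply: leq_maxl.
- by apply: syz_projective_leq hY; apply: leqW; apply: leq_maxr.
Qed.

Lemma fin_pd_kernel X Y Z (i : {linear X -> Y}) (p : {linear Y -> Z}) :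
  noetherian R -> ses i p -> fin_pd Y -> fin_pd Z -> fin_pd X.
Proof.
move=> nR ip [Yfg [n hY]] [_ [m hZ]]; split.
  by case: ip => iI _ _; apply: nR Yfg _ _ iI.
exists (maxn n m); apply: syz_kernel ip _ _.
- exact: projective_stable.
- exact: projective_ext_closed.
- by apply: syz_projective_leq hY; apply: leq_maxl.
- by apply: syz_projective_leq hZ; apply: leqW; apply: leq_maxr.
Qed.

Lemma fin_pd_in_add T X : noetherian R -> in_add T X -> fin_pd T -> fin_pd X.
Proof.
move=> nR XT [Tfg [n hT]]; split.
  by case: XT => m /fg_summand; apply; apply: fg_power.
exists n; apply: power_summand_closed XT hT => //.
- exact: projective_stable.
- exact: projective_ext_closed.
- exact: projective_summand_closed.
Qed.

Lemma fin_pd_power T n : noetherian R -> fin_pd T -> fin_pd {ffun 'I_n -> T}.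
Proof.
move=> nR; apply: fin_pd_in_add => //; exists n.
exact/mod_iso_summand/mod_iso_refl.
Qed.

Lemma ext_zero_in_add N T X : noetherian R -> in_add T X -> finitely_generated T ->
  ext_zero N T -> ext_zero N X.
Proof.
move=> nR XT Tfg hT n; apply: power_summand_closed XT (hT n) => //.
- exact: ext1_stable.
- exact: ext1_ext_closed.
- by move=> Z; apply: projective_ext1.
- exact: ext1_summand_closed.
Qed.

(** The step supplies [fin_pd] for both K and M, so that hypotheses about all modules of finite
    projective dimension, such as strength, can be applied there. *)
Lemma fin_pd_ind (Phi : lmodType R -> Prop) : noetherian R ->
  (forall P, finitely_generated P -> projective P -> Phi P) ->
  (forall n K M (i : {linear K -> free_mod R n}) (p : {linear free_mod R n -> M}),
     ses i p -> fin_pd K -> fin_pd M -> Phi K -> Phi M) ->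
  forall M, fin_pd M -> Phi M.
Proof.
move=> nR h0 hS M [Mfg [n]]; elim: n M Mfg => [|n IHn] M Mfg hM; first exact: h0.
have [m [K [i [p [ip Kfg]]]]] := fg_cover_noetherian nR Mfg.
have hK : syz (@projective R) n K.
  by apply: syz_all hM ip _; [exact: projective_stable|exact: free_projective].
by apply: (hS _ _ _ _ _ ip); [split=> //; exists n|split=> //; exists n.+1|exact: IHn].
Qed.

End Resolutions.

(** * Chain conditions and Artin algebras *)

Section Span.
Variables (R : pzRingType) (M : lmodType R).
Implicit Types (s t : seq M) (S : set M) (x y v : M).

(** The span is defined by recursion on the list so that the chain-condition proofs can split off
    one generator at a time. *)
Fixpoint lspan s x : Prop :=
  if s is v :: s' then exists a, lspan s' (x - a *: v) else x = 0.

Lemma lspan_submodule s : submodule (lspan s).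
Proof.
elim: s => [|v s [h0 hD hZ]] /=.
  split=> [//|x y -> ->|a x ->]; [exact: addr0|exact: scaler0].
split.
- by exists 0; rewrite scale0r subr0.
- move=> x y [a ha] [b hb]; exists (a + b).
  by rewrite scalerDl opprD addrACA; apply: hD.
- move=> c x [a ha]; exists (c * a).
  by rewrite -scalerA -scalerBr; apply: hZ.
Qed.

Lemma lspan_min S s x : submodule S -> (forall v, v \in s -> S v) -> lspan s x -> S x.
Proof.
move=> SS; elim: s x => [|v s IHs] x /= h; first by move=> ->; case: SS.
move=> [a ha]; rewrite -[x](subrK (a *: v)); have [_ SD SZ] := SS.
apply: SD; first by apply: IHs => // w ws; apply: h; rewrite inE ws orbT.
by apply/SZ/h; rewrite inE eqxx.
Qed.

Lemma lspan_mem s v : v \in s -> lspan s v.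
Proof.
have [h0 _ _] := lspan_submodule s.
elim: s {h0} => //= w s IHs; rewrite inE => /orP[/eqP->|/IHs h].
  by exists 1; rewrite scale1r subrr; case: (lspan_submodule s).
by exists 0; rewrite scale0r subr0.
Qed.

Lemma lspan_sub s t x : {subset s <= t} -> lspan s x -> lspan t x.
Proof.
by move=> st; apply: lspan_min (lspan_submodule t) _ => v /st; apply: lspan_mem.
Qed.

Lemma lspanP s x : lspan s x <-> exists c : 'I_(size s) -> R,
  x = \sum_i c i *: s`_i.
Proof.
elim: s x => [|v s IHs] x /=.
  by split=> [->|[c ->]]; [exists (fun=> 0)|]; rewrite big_ord0.
split=> [[a /IHs[c e]]|[c ->]].
  exists (fun i => if unlift ord0 i is Some j then c j else a).
  rewrite big_ord_recl unlift_none /= -[LHS](subrK (a *: v)) addrC e; congr (_ + _).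
  by apply: eq_bigr => i _; rewrite liftK.
exists (c ord0); apply/IHs; exists (fun i => c (lift ord0 i)).
by rewrite big_ord_recl /= addrC addKr.
Qed.

Lemma fg_lspan : finitely_generated M <-> exists s, forall x, lspan s x.
Proof.
split=> [[n [v vE]]|[s sE]]; last first.
  by exists (size s), (fun i => s`_i) => x; apply/lspanP.
exists (codom v) => x; have [c ->] := vE x.
apply: submodule_sum; first exact: lspan_submodule.
by move=> i _; have [_ _ hZ] := lspan_submodule (codom v); apply/hZ/lspan_mem/codom_f.
Qed.

Definition fg_set S := exists s, (forall v, v \in s -> S v) /\ forall x, S x -> lspan s x.

Definition dcc := forall S : nat -> set M, (forall n, submodule (S n)) ->
  (forall n x, S n.+1 x -> S n x) ->
  exists N, forall n, (N <= n)%N -> S n = S N.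

Lemma dcc_min (P : set M -> Prop) : dcc -> (exists S, submodule S /\ P S) ->
  exists S, [/\ submodule S, P S & forall S', submodule S' -> P S' ->
    (forall x, S' x -> S x) -> S' = S].
Proof.
move=> hdcc [S0 [S0S PS0]]; apply: contrapT => hmin.
pose T := {S : set M | submodule S /\ P S}.
have next (S : T) : exists S' : T, (forall x, sval S' x -> sval S x) /\ sval S' <> sval S.
  apply: contrapT => h; apply: hmin; exists (sval S); have [h1 h2] := svalP S.
  split=> // S' S'S PS' sub; apply: contrapT => ne; apply: h.
  by exists (exist _ S' (conj S'S PS')).
have [f fE] := choice next.
pose t0 : T := exist _ S0 (conj S0S PS0).
pose F n := sval (iter n f t0).
have [|n x Fx|N /(_ N.+1 (leqnSn N)) e] := hdcc F.
- by move=> n; rewrite /F; case: (svalP (iter n f t0)).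
- by have [h _] := fE (iter n f t0); apply: h.
- by have [_] := fE (iter N f t0); apply.
Qed.

(** Zorn's lemma in a form that serves twice: v = 1 gives maximal left ideals, and a nonzero v in an
    ideal gives the submodule used for Artinian rings. *)
Lemma maximal_avoiding S v : submodule S -> ~ S v -> exists W,
  [/\ submodule W, (forall x, S x -> W x), ~ W v
    & forall W', submodule W' -> (forall x, W x -> W' x) -> ~ W' v -> W' = W].
Proof.
move=> SS Sv.
pose T := {W : set M | [/\ submodule W, (forall x, S x -> W x) & ~ W v]}.
pose t0 : T := exist _ S (And3 SS (fun _ h => h) Sv).
have [||||[W [h1 h2 h3]] hW] := @Zorn T (fun A B => `[< forall x, sval A x -> sval B x >]).
- by move=> A; apply/asboolP.
- by move=> A B C /asboolP h /asboolP h'; apply/asboolP => x /h/h'.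
- move=> [A hA] [B hB] /asboolP /= h /asboolP /= h'; apply: eq_exist.
  by apply/funext => x; apply/propext; split; [apply: h|apply: h'].
- move=> A Atot.
  have [[B AB]|An] := pselect (exists B, A B); last by exists t0 => B AB; case: An; exists B.
  pose U : set M := fun x => exists2 C, A C & sval C x.
  have hU : [/\ submodule U, (forall x, S x -> U x) & ~ U v].
    split.
    - split.
      + by exists B => //; case: (svalP B) => -[].
      + move=> x y [C AC Cx] [D AD Dy].
        have [/asboolP h|/asboolP h] := Atot _ _ AC AD.
          by exists D => //; case: (svalP D) => -[_ hD _] _ _; apply: hD => //; apply: h.
        by exists C => //; case: (svalP C) => -[_ hD _] _ _; apply: hD => //; apply: h.
      + by move=> a x [C AC Cx]; exists C => //; case: (svalP C) => -[_ _ hZ] _ _; apply: hZ.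
    - by move=> x Sx; exists B => //; case: (svalP B) => _ h _; apply: h.
    - by move=> [C AC]; case: (svalP C).
  by exists (exist _ U hU) => C AC; apply/asboolP => x Cx; exists C.
exists W; split=> // W' W'S sub W'v.
have hW' : [/\ submodule W', (forall x, S x -> W' x) & ~ W' v].
  by split=> // x /h2/sub.
by have /(congr1 sval) := hW (exist _ W' hW') (introT (asboolP _) sub).
Qed.

End Span.

Section ChainConditions.
Variable R : pzRingType.

Definition fg_ideals := forall I : set R^o, submodule I -> fg_set I.

(** Induction on the generators, as for Hilbert's basis theorem: the coefficients at v of elements
    of S form a left ideal I. Lifts to S of finitely many generators of I, together with generators
    of the intersection of S with the span of s, generate S. *)
Lemma fg_set_lspan (M : lmodType R) (s : seq M) (S : set M) :
  fg_ideals -> submodule S -> (forall x, S x -> lspan s x) -> fg_set S.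
Proof.
move=> hR; elim: s S => [|v s IHs] S SS Ss; first by exists [::].
have [S0 SD SZ] := SS; have [s0 sD sZ] := lspan_submodule s.
pose I : set R^o := fun a => exists x, S x /\ lspan s (x - (a : R) *: v).
have IS : submodule I.
  split.
  - by exists 0; rewrite scale0r subr0.
  - move=> a b [x [Sx hx]] [y [Sy hy]]; exists (x + y); split; first exact: SD.
    by rewrite scalerDl opprD addrACA; apply: sD.
  - move=> c a [x [Sx hx]]; exists ((c : R) *: x); split; first exact: SZ.
    by rewrite -scalerA -scalerBr; apply: sZ.
have [r [rI rE]] := hR I IS.
have [f fE] : exists f : R^o -> M, forall a, a \in r ->
    S (f a) /\ lspan s (f a - (a : R) *: v).
  suff /choice[f fE] : forall a : R^o, exists x, a \in r -> S x /\ lspan s (x - (a : R) *: v).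
    by exists f => a /fE.
  move=> a; have [/rI[x hx]|] := boolP (a \in r); last by exists 0.
  by exists x.
have [||t [tS tE]] := IHs (fun x => S x /\ lspan s x).
- split; first by [].
    by move=> x y [Sx sx] [Sy sy]; split; [apply: SD|apply: sD].
  by move=> a x [Sx sx]; split; [apply: SZ|apply: sZ].
- by move=> x [].
exists (map f r ++ t); split=> [w|x Sx].
  by rewrite mem_cat => /orP[/mapP[a ar ->]|/tS[]//]; case: (fE a ar).
have [a ha] := Ss x Sx.
have /rE : I a by exists x.
have lift_comb : forall b : R^o, lspan r b -> exists y,
    [/\ S y, lspan (map f r) y & lspan s (y - (b : R) *: v)].
  move=> b; apply: (@lspan_min _ R^o (fun b : R^o => exists y,
    [/\ S y, lspan (map f r) y & lspan s (y - (b : R) *: v)])).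
    have [r0 rD rZ] := lspan_submodule (map f r).
    split.
    - by exists 0; rewrite scale0r subr0.
    - move=> c d [y [h1 h2 h3]] [z [h4 h5 h6]]; exists (y + z); split.
      + exact: SD.
      + exact: rD.
      + by rewrite scalerDl opprD addrACA; apply: sD.
    - move=> c d [y [h1 h2 h3]]; exists ((c : R) *: y); split.
      + exact: SZ.
      + exact: rZ.
      + by rewrite -scalerA -scalerBr; apply: sZ.
  move=> c cr; have [h1 h2] := fE c cr; exists (f c); split=> //.
  exact/lspan_mem/map_f.
move=> /lift_comb[y [Sy ry sy]].
rewrite -[x](subrK y).
have [_ hD _] := lspan_submodule (map f r ++ t); apply: hD.
  apply: (@lspan_sub _ _ t); first by move=> w wt; rewrite mem_cat wt orbT.
  apply: tE; split; first exact: submoduleB.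
  have -> : x - y = (x - a *: v) - (y - a *: v) by rewrite opprB addrA subrK.
  exact: submoduleB (lspan_submodule s) _ _.
by apply: lspan_sub ry => w wt; rewrite mem_cat wt.
Qed.

Lemma fg_submodule (M K : lmodType R) (i : {linear K -> M}) (s : seq K) :
  injective i -> (forall k, lspan (map i s) (i k)) -> forall k, lspan s k.
Proof.
move=> iI h k; have := h k; elim: s k {h} => [|v s IHs] k /=.
  by apply: linear_inj0.
by move=> [a ha]; exists a; apply: IHs; rewrite linearB linZ.
Qed.

Lemma noetherian_of_fg_ideals : fg_ideals -> noetherian R.
Proof.
move=> hR M /fg_lspan[s sE] K i iI; apply/fg_lspan.
have [t [tS tE]] := fg_set_lspan hR (image_submodule i) (fun x _ => sE x).
have [g gE] : exists g : M -> K, forall x, x \in t -> i (g x) = x.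
  suff /choice[g gE] : forall x : M, exists k, x \in t -> i k = x by exists g.
  move=> x; have [/tS[k <-]|] := boolP (x \in t); last by exists 0.
  by exists k.
exists (map g t); apply: (@fg_submodule M K i) => // k.
have -> : map i (map g t) = t.
  by rewrite -map_comp -[RHS]map_id; apply/eq_in_map => x /gE.
by apply: tE; exists k.
Qed.

(** The coefficient ideals at v and the intersections with the span of s both stabilise. Once both
    are constant, so is the chain, because an element of the larger term differs from one of the
    smaller term by an element of the intersection. *)
Lemma dcc_lspan (M : lmodType R) (s : seq M) (S : nat -> set M) : dcc R^o ->
  (forall n, submodule (S n)) -> (forall n x, S n.+1 x -> S n x) ->
  (forall x, S 0%N x -> lspan s x) ->
  exists N, forall n, (N <= n)%N -> S n = S N.
Proof.
move=> hR.
have mono (T : nat -> set M) : (forall n x, T n.+1 x -> T n x) ->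
    forall m n, (m <= n)%N -> forall x, T n x -> T m x.
  by move=> h m n /subnK <-; elim: (n - m)%N => //= d IHd x /h/IHd.
elim: s S => [|v s IHs] S SS dec S0.
  exists 0%N => n _; apply/funext => x; apply/propext.
  split; first exact: (mono _ dec).
  by move=> /S0/= ->; case: (SS n).
pose I n : set R^o := fun a => exists x, S n x /\ lspan s (x - (a : R) *: v).
have [s0 sD sZ] := lspan_submodule s.
have IS n : submodule (I n).
  have [h0 hD hZ] := SS n; split.
  - by exists 0; rewrite scale0r subr0.
  - move=> a b [x [Sx hx]] [y [Sy hy]]; exists (x + y); split; first exact: hD.
    by rewrite scalerDl opprD addrACA; apply: sD.
  - move=> c a [x [Sx hx]]; exists ((c : R) *: x); split; first exact: hZ.
    by rewrite -scalerA -scalerBr; apply: sZ.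
have [|N1 hN1] := hR I IS; first by move=> n a [x [/dec Sx h]]; exists x.
have [|||N2 hN2] := IHs (fun n x => S n x /\ lspan s x).
- move=> n; have [h0 hD hZ] := SS n; split; first by [].
    by move=> x y [Sx sx] [Sy sy]; split; [apply: hD|apply: sD].
  by move=> a x [Sx sx]; split; [apply: hZ|apply: sZ].
- by move=> n x [/dec Sx sx].
- by move=> x [].
exists (maxn N1 N2) => n nN; apply/funext => x; apply/propext.
split; first exact: (mono _ dec).
move=> Sx; set N := maxn N1 N2 in nN Sx.
have [a ha] := S0 x (mono _ dec 0%N N (leq0n _) x Sx).
have : I N a by exists x.
have N1n : (N1 <= n)%N by apply: leq_trans nN; apply: leq_maxl.
have N2n : (N2 <= n)%N by apply: leq_trans nN; apply: leq_maxr.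
rewrite (hN1 N (leq_maxl _ _)) -(hN1 n N1n) => -[y [Sy sy]].
rewrite -[x](subrK y); have [_ hD _] := SS n; apply: hD => //.
have : S N (x - y) /\ lspan s (x - y).
  split; first by apply: submoduleB => //; apply: (mono _ dec) Sy.
  have -> : x - y = (x - a *: v) - (y - a *: v) by rewrite opprB addrA subrK.
  exact: submoduleB (lspan_submodule s) _ _.
move=> h; have /= e1 := congr1 (fun A : set M => A (x - y)) (hN2 N (leq_maxr _ _)).
have /= e2 := congr1 (fun A : set M => A (x - y)) (hN2 n N2n).
by move: h; rewrite e1 -e2 => -[].
Qed.

Lemma dcc_fg (M : lmodType R) : dcc R^o -> finitely_generated M -> dcc M.
Proof.
by move=> hR /fg_lspan[s sE] S SS dec; apply: (dcc_lspan hR SS dec) => x _; apply: sE.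
Qed.

End ChainConditions.

Section Artinian.
Variable k : comPzRingType.
Hypothesis k_artinian : artinian k.

Lemma artinian_dcc : dcc k^o.
Proof.
move=> S SS dec; apply: k_artinian; last by move=> n x; apply: dec.
by move=> n; case: (SS n) => h0 hD hZ; split.
Qed.

Lemma power_stabilises (c : k) : exists n d, c ^+ n = c ^+ n * (c * d).
Proof.
pose S n : set k^o := fun x => exists y, x = c ^+ n * y.
have [|n x [y ->]|N hN] := artinian_dcc (S := S).
- move=> n; split; first by exists 0; rewrite mulr0.
    by move=> _ _ [y ->] [z ->]; exists (y + z); rewrite mulrDr.
  by move=> a _ [y ->]; exists (a * y); rewrite mulrCA.
- by exists (c * y); rewrite exprSr mulrA.
have : S N (c ^+ N) by exists 1; rewrite mulr1.
rewrite -(hN N.+1 (leqnSn N)) => -[d e].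
by exists N, d; rewrite mulrA -exprSr.
Qed.

(* An ideal I minimal among those that are not finitely generated satisfies
   x I = 0 or x I = I for every x; the elements of the second kind act
   invertibly on I, so that I is spanned by any nonzero v together with a
   submodule maximal among those avoiding v. *)
Lemma artinian_fg_ideals : fg_ideals k.
Proof.
move=> I0 I0S; apply: contrapT => I0n.
have [|I [IS In Imin]] := dcc_min (P := fun I => ~ fg_set I) artinian_dcc.
  by exists I0.
have [Izero ID IZ] := IS.
have Ifg (J : set k^o) : submodule J -> (forall x, J x -> I x) -> J <> I -> fg_set J.
  by move=> JS JI ne; apply: contrapT => Jn; apply: ne; apply: Imin.
(* If x I is proper, it is finitely generated by minimality. Were the annihilator of x in I proper
   too, its generators and lifts of those of x I would generate I. *)
have dich (x : k) : (forall y, I y -> x * y = 0) \/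
    (forall y, I y -> exists2 z, I z & y = x * z).
  pose xI : set k^o := fun y => exists2 z, I z & y = x * z.
  have xIS : submodule xI.
    split; first by exists 0; rewrite ?mulr0.
      by move=> _ _ [y Iy ->] [z Iz ->]; exists (y + z); [apply: ID|rewrite mulrDr].
    by move=> a _ [y Iy ->]; exists (a * y); [apply: IZ|rewrite mulrCA].
  have [xE|ne] := pselect (xI = I).
    by right=> y; rewrite -{1}xE.
  left; have [|r [rI rE]] := Ifg xI xIS _ ne.
    by move=> _ [z Iz ->]; apply: IZ.
  have [g gE] : exists g : k^o -> k^o, forall y, y \in r -> I (g y) /\ y = x * g y.
    suff /choice[g gE] : forall y : k^o, exists z, y \in r -> I z /\ y = x * z by exists g.
    move=> y; have [/rI[z Iz ->]|] := boolP (y \in r); last by exists 0.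
    by exists z.
  pose A : set k^o := fun y => I y /\ x * y = 0.
  have AS : submodule A.
    split; first by split=> //; rewrite mulr0.
      by move=> y z [Iy xy] [Iz xz]; split; [apply: ID|rewrite mulrDr xy xz addr0].
    by move=> a y [Iy xy]; split; [apply: IZ|rewrite mulrCA xy mulr0].
  have [AE y|neA] := pselect (A = I); first by rewrite -AE => -[].
  case: In; have [|t [tA tE]] := Ifg A AS _ neA; first by move=> y [].
  exists (map g r ++ t); split=> [w|y Iy].
    by rewrite mem_cat => /orP[/mapP[z zr ->]|/tA[]//]; case: (gE z zr).
  have [z [Iz xz zs]] : exists z, [/\ I z, x * z = x * y & lspan (map g r) z].
    have : lspan r (x * y : k^o) by apply: rE; exists y.
    apply: (@lspan_min _ k^o (fun w => exists z,
      [/\ I z, x * z = w & lspan (map g r) z])).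
      have [r0 rD rZ] := lspan_submodule (map g r).
      split.
      - by exists 0; rewrite mulr0.
      - move=> u w [a [h1 h2 h3]] [b [h4 h5 h6]]; exists (a + b).
        by rewrite mulrDr h2 h5; split=> //; [apply: ID|apply: rD].
      - move=> c u [a [h1 h2 h3]]; exists (c *: a : k^o).
        by split; [apply: IZ|rewrite -h2; apply: mulrCA|apply: rZ].
    move=> w wr; have [h1 h2] := gE w wr; exists (g w); split=> //.
    exact/lspan_mem/map_f.
  rewrite -[y](subrK z); have [_ hD _] := lspan_submodule (map g r ++ t); apply: hD.
    apply: (@lspan_sub _ _ t); first by move=> w wt; rewrite mem_cat wt orbT.
    apply: tE; split; first exact: submoduleB.
    by rewrite mulrBr xz subrr.
  by apply: lspan_sub zs => w wt; rewrite mem_cat wt.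
have [v Iv v0] : exists2 v, I v & v <> 0.
  apply: contrapT => h; apply: In; exists [::]; split=> // x Ix /=.
  by apply: contrapT => x0; apply: h; exists x.
have [|W [WS _ Wv Wmax]] := @maximal_avoiding _ k^o (fun x => x = 0) v _ v0.
  by split=> [//|x y -> ->|a x ->]; [rewrite addr0|rewrite scaler0].
have [W0 WD WZ] := WS.
have [|||w [wW wE]] := Ifg (fun x => W x /\ I x).
- split=> //; first by move=> x y [h1 h2] [h3 h4]; split; [apply: WD|apply: ID].
  by move=> a x [h1 h2]; split; [apply: WZ|apply: IZ].
- by move=> x [].
- by move=> e; move: Iv; rewrite -e => -[].
apply: In; exists (v :: w); split=> [x|u Iu].
  by rewrite inE => /orP[/eqP->|/wW[]].
have [Wu|nWu] := pselect (W u).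
  by exists 0; rewrite scale0r subr0; apply: wE.
(* W + k u is larger than W, so by maximality it contains v. *)
have [w0 [c [Ww0 vE]]] : exists w0 c, W w0 /\ v = w0 + c * u.
  apply: contrapT => h; apply: nWu.
  have <- : (fun x => exists w0 c, W w0 /\ x = w0 + (c : k) * u) = W.
    apply: Wmax => //; last 1 first.
    - by move=> x Wx; exists x, 0; rewrite mul0r addr0.
    split; first by exists 0, 0; rewrite mul0r addr0.
      move=> _ _ [a [c [Wa ->]]] [b [d [Wb ->]]]; exists (a + b), (c + d).
      by rewrite mulrDl addrACA; split=> //; apply: WD.
    move=> e _ [a [c [Wa ->]]]; exists (e *: a : k^o), (e * c).
    by split; [apply: WZ|rewrite -mulrA; apply: mulrDr].
  by exists 0, 1; rewrite mul1r add0r.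
(* Otherwise v would lie in W. So c does not annihilate I, and c I = I by the dichotomy. *)
have cu : ~ W (c * u : k^o).
  by move=> h; apply: Wv; rewrite vE; apply: WD.
have cI : forall y, I y -> exists2 z, I z & y = c * z.
  by case: (dich c) => // h; case: cu; rewrite h.
(* u is a multiple of c^n, and c^n = c^n c d, so c d fixes u: the element d inverts c there, and v =
   w0 + c u can be solved for u. *)
have [n [d cd]] := power_stabilises c.
have cnI m : forall y, I y -> exists2 z, I z & y = c ^+ m * z.
  elim: m => [|m IHm] y Iy; first by exists y; rewrite ?mul1r.
  have [z Iz ->] := IHm y Iy; have [z' Iz' ->] := cI z Iz.
  by exists z'; rewrite // mulrA -exprSr.
have uE : u = d * v - d * w0.
  rewrite -mulrBr vE [w0 + _]addrC addrK mulrA [d * c]mulrC.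
  by have [z _ ->] := cnI n u Iu; rewrite mulrA [c * d * _]mulrC -cd.
exists d; apply: wE.
have -> : u - d *: (v : k^o) = - (d *: (w0 : k^o)).
  by rewrite {1}uE [d *: v]/(d * v) addrAC subrr add0r.
have Iw0 : I w0.
  rewrite (_ : w0 = v - c * u); last by rewrite vE addrK.
  by apply: submoduleB => //; apply: IZ.
by split; apply: submoduleN => //; [apply: WZ|apply: IZ].
Qed.

Lemma artinian_noetherian : noetherian k.
Proof. exact/noetherian_of_fg_ideals/artinian_fg_ideals. Qed.

End Artinian.

(* restriction of scalars along f *)
Definition twist_mod (S R : pzRingType) (f : {rmorphism S -> R}) (M : lmodType R) :
  Type := M.

Section Twist.
Variables (S R : pzRingType) (f : {rmorphism S -> R}).
Local Notation twist M := (twist_mod f M).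

Section Instances.
Variable M : lmodType R.
HB.instance Definition _ := GRing.Zmodule.on (twist M).

Definition twist_scale (a : S) (x : twist M) : twist M := f a *: (x : M).

Fact twist_scaleA a b x : twist_scale a (twist_scale b x) = twist_scale (a * b) x.
Proof. by rewrite /twist_scale rmorphM scalerA. Qed.
Fact twist_scale1 : left_id 1 twist_scale.
Proof. by move=> x; rewrite /twist_scale rmorph1 scale1r. Qed.
Fact twist_scaleDr : right_distributive twist_scale +%R.
Proof. by move=> a x y; apply: scalerDr. Qed.
Fact twist_scaleDl x : {morph twist_scale^~ x : a b / a + b}.
Proof. by move=> a b; rewrite /twist_scale rmorphD scalerDl. Qed.

HB.instance Definition _ := GRing.Zmodule_isLmodule.Build S (twist M)
  twist_scaleA twist_scale1 twist_scaleDr twist_scaleDl.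

Lemma twistE (a : S) (x : M) : a *: (x : twist M) = f a *: x.
Proof. by []. Qed.
End Instances.

Lemma twist_linear (M N : lmodType R) (g : {linear M -> N}) :
  exists h : {linear twist M -> twist N}, forall x, h x = g x.
Proof.
by apply: (@linear_ext S (twist M) (twist N) g) => a x y; apply: linearP.
Qed.

End Twist.

Definition twist (S R : pzRingType) (f : {rmorphism S -> R}) (M : lmodType R) :
  lmodType S := twist_mod f M.

Section ArtinAlgebras.
Variables (k : comPzRingType) (A : kalg k).
Hypothesis A_artin : artin_algebra A.
Local Notation kmod M := (twist (kalg_map A) M).

Lemma artin_fg (M : lmodType A) : finitely_generated M -> finitely_generated (kmod M : lmodType k).
Proof.
case: A_artin => _ [n [v vE]] [m [w wE]].
pose g := enum_val : 'I_#|{: 'I_m * 'I_n}| -> _.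
exists #|{: 'I_m * 'I_n}|, (fun j => v (g j).2 *: w (g j).1 : kmod M) => x.
have [c ->] := wE x; have [d dE] := choice (fun j => vE (c j)).
exists (fun j => d (g j).1 (g j).2).
rewrite (eq_bigr (fun i => \sum_j kalg_map A (d i j) *: (v j *: w i))); last first.
  by move=> i _; rewrite {1}dE scaler_suml; apply: eq_bigr => j _; rewrite scalerA.
rewrite pair_big /= (reindex g) //.
by exists enum_rank => z _; [exact: enum_valK|exact: enum_rankK].
Qed.

Lemma fg_of_kfg (M : lmodType A) : finitely_generated (kmod M : lmodType k) -> finitely_generated M.
Proof.
by move=> [n [v vE]]; exists n, v => x; have [c ->] := vE x; exists (fun i => kalg_map A (c i)).
Qed.

Lemma artin_noetherian : noetherian A.
Proof.
move=> M Mfg K i iI; apply: fg_of_kfg.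
have [h hE] := twist_linear (kalg_map A) i.
apply: (artinian_noetherian (proj1 A_artin) (artin_fg Mfg) (i := h)).
by move=> x y; rewrite !hE => /iI.
Qed.

Lemma artin_dcc : dcc (A : pzRingType)^o.
Proof.
have hk : dcc (kmod (A : pzRingType)^o : lmodType k).
  apply: dcc_fg (artinian_dcc (proj1 A_artin)) (artin_fg _).
  exists 1%N, (fun _ => 1) => x; exists (fun _ => x).
  by rewrite big_ord1; exact: esym (mulr1 _).
move=> S SS dec; apply: hk => // n; have [h0 hD hZ] := SS n; split=> //.
by move=> a x; apply: hZ.
Qed.

Lemma artin_op : artin_algebra (op_alg A).
Proof.
case: A_artin => kA [n [v vE]]; split=> //; exists n, v => x.
have [c {1}->] := vE x; exists c; apply: eq_bigr => i _.
exact: (@kalg_central k A (c i) (v i)).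
Qed.

(** Values on m generators embed End(M) in M^m, which is finitely generated over the Noetherian ring
    k. *)
Lemma artin_endo (M : lmodType A) : finitely_generated M -> artin_algebra (endo_alg M).
Proof.
move=> Mfg; have [kA _] := A_artin; split=> //.
have [m [w wE]] := Mfg.
have [|i iE] := @linear_ext k (twist (kalg_map (endo_alg M)) (endo M)^o)
   {ffun 'I_m -> kmod M} (fun f => [ffun j => (f : endo M) (w j)]).
  by move=> a f g; apply/ffunP => j; rewrite !ffunE.
have iI : injective i.
  move=> f g; rewrite !iE => /ffunP e; apply: endoP => x.
  have [c ->] := wE x; rewrite !linear_sum; apply: eq_bigr => j _.
  by have := e j; rewrite !ffunE !linZ => ->.
have [n [v vE]] := artinian_noetherian kA (fg_power m (artin_fg Mfg)) iI.
exists n, v => x; exact: (vE x).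
Qed.

End ArtinAlgebras.

(** * Duality with respect to a bimodule *)

(* An A-R-bimodule with both actions written on the left: the two module
   structures live on carriers identified by mutually inverse maps. *)
Record bimodule (A R : pzRingType) := Bimodule {
  bL : lmodType A;
  bR : lmodType R;
  bth : bL -> bR;
  bht : bR -> bL;
  bthK : cancel bth bht;
  bhtK : cancel bht bth;
  bthD : {morph bth : x y / x + y};
  bcomm : forall a r t, bth (a *: bht (r *: bth t)) = r *: bth (a *: t)
}.
Arguments bht {A R} b _.

Section BimoduleTheory.
Variables (A R : pzRingType) (b : bimodule A R).

Lemma bhtD : {morph bht b : x y / x + y}.
Proof. by move=> x y; apply: (can_inj (@bthK _ _ b)); rewrite bthD !bhtK. Qed.

Lemma bcomm_flip r a s : bht b (r *: bth (a *: bht b s)) = a *: bht b (r *: s).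
Proof. by rewrite -bcomm bthK bhtK. Qed.

Definition flip : bimodule R A :=
  Bimodule (@bhtK _ _ b) (@bthK _ _ b) bhtD bcomm_flip.

Lemma bth0 : bth (0 : bL b) = 0.
Proof. by apply: (addrI (bth (0 : bL b))); rewrite -bthD !addr0. Qed.
Lemma bthN (x : bL b) : bth (- x) = - bth x.
Proof. by apply: (addrI (bth x)); rewrite -bthD !subrr bth0. Qed.
Lemma bht0 : bht b 0 = 0.
Proof. by rewrite -bth0 bthK. Qed.

End BimoduleTheory.

Definition dual (A R : pzRingType) (b : bimodule A R) (M : lmodType A) : Type :=
  {linear M -> bL b}.

Section Dual.
Variables (A R : pzRingType) (b : bimodule A R) (M : lmodType A).
Local Notation D := (dual b M).

HB.instance Definition _ := gen_eqMixin D.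
HB.instance Definition _ := gen_choiceMixin D.

Lemma dualP (f g : D) : (forall x, f x = g x) -> f = g.
Proof.
case: f g => f [[nf] [sf]] [g [[ng] [sg]]] /= /funext fg.
by rewrite -{}fg in ng sg *; rewrite (Prop_irrelevance nf ng) (Prop_irrelevance sf sg).
Qed.

Definition dual_zero : D := \0.
Definition dual_opp (f : D) : D := \- f.
Definition dual_add (f g : D) : D := f \+ g.

Fact dual_addA : associative dual_add.
Proof. by move=> f g h; apply: dualP => x /=; rewrite addrA. Qed.
Fact dual_addC : commutative dual_add.
Proof. by move=> f g; apply: dualP => x /=; rewrite addrC. Qed.
Fact dual_add0 : left_id dual_zero dual_add.
Proof. by move=> f; apply: dualP => x /=; rewrite add0r. Qed.
Fact dual_addN : left_inverse dual_zero dual_opp dual_add.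
Proof. by move=> f; apply: dualP => x /=; rewrite addNr. Qed.

HB.instance Definition _ :=
  GRing.isZmodule.Build D dual_addA dual_addC dual_add0 dual_addN.

Definition dual_scale_fun (r : R) (f : D) (x : M) : bL b := bht b (r *: bth (f x)).

Fact dual_scale_linear r f : linear (dual_scale_fun r f).
Proof.
move=> a x y; rewrite /dual_scale_fun linearP bthD scalerDr bhtD; congr (_ + _).
by rewrite -bcomm bthK.
Qed.

HB.instance Definition _ r f :=
  GRing.isLinear.Build A M (bL b) *:%R (dual_scale_fun r f) (dual_scale_linear r f).

Definition dual_scale (r : R) (f : D) : D := dual_scale_fun r f.

Fact dual_scaleA r s f : dual_scale r (dual_scale s f) = dual_scale (r * s) f.
Proof. by apply: dualP => x /=; rewrite /dual_scale_fun /= /dual_scale_fun bhtK scalerA. Qed.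
Fact dual_scale1 : left_id 1 dual_scale.
Proof. by move=> f; apply: dualP => x /=; rewrite /dual_scale_fun scale1r bthK. Qed.
Fact dual_scaleDr : right_distributive dual_scale +%R.
Proof.
by move=> r f g; apply: dualP => x /=; rewrite /dual_scale_fun /= bthD scalerDr bhtD.
Qed.
Fact dual_scaleDl f : {morph dual_scale^~ f : r s / r + s}.
Proof.
by move=> r s; apply: dualP => x /=; rewrite /dual_scale_fun /= scalerDl bhtD.
Qed.

HB.instance Definition _ := GRing.Zmodule_isLmodule.Build R D
  dual_scaleA dual_scale1 dual_scaleDr dual_scaleDl.

Lemma dual0E x : (0 : D) x = 0. Proof. by []. Qed.
Lemma dualDE (f g : D) x : (f + g) x = f x + g x. Proof. by []. Qed.
Lemma dualZE r (f : D) x : (r *: f) x = bht b (r *: bth (f x)). Proof. by []. Qed.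

Lemma dual_sumE (I : Type) (r : seq I) (P : pred I) (F : I -> D) x :
  (\sum_(i <- r | P i) F i : D) x = \sum_(i <- r | P i) (F i : D) x.
Proof. exact: (big_morph (fun f : D => f x) (fun f g => dualDE f g x) (dual0E x)). Qed.

End Dual.

Section DualTheory.
Variables (A R : pzRingType) (b : bimodule A R).
Local Notation T := (bL b).
Local Notation T' := (bR b).
Local Notation D := (dual b).
Implicit Types (K M N P Q X Y Z W : lmodType A).

Lemma dual_map M N (f : {linear M -> N}) :
  exists h : {linear D N -> D M}, forall g x, (h g : D M) x = (g : D N) (f x).
Proof.
have [|h hE] := @linear_ext R (D N) (D M) (fun g : D N => ((g : {linear N -> T}) \o f : D M)).
  by move=> r g g'; apply: dualP.
by exists h => g x; rewrite hE.
Qed.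

Lemma evaluation M (x : M) : exists h : {linear D M -> T'},
  forall g, h g = bth ((g : D M) x).
Proof.
have [|h hE] := @linear_ext R (D M) T' (fun g : D M => bth (g x)); last by exists h.
by move=> r g g'; rewrite dualDE dualZE bthD bhtK.
Qed.

Definition torsionless M := forall x : M, (forall g : D M, g x = 0) -> x = 0.

(** The two clauses say that evaluation M -> Hom_R(D M, T') is injective and surjective. *)
Definition reflexive_mod M := torsionless M /\
  forall phi : {linear D M -> T'}, exists x : M, forall g, phi g = bth ((g : D M) x).

Lemma dual_ses X Y Z (i : {linear X -> Y}) (p : {linear Y -> Z}) :
  ses i p -> extends_along T i ->
  exists (p' : {linear D Z -> D Y}) (i' : {linear D Y -> D X}),
  [/\ ses p' i', (forall g y, (p' g : D Y) y = (g : D Z) (p y))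
    & forall g x, (i' g : D X) x = (g : D Y) (i x)].
Proof.
move=> ip iT; have [p' pE] := dual_map p; have [i' iE] := dual_map i.
have [iI e pS] := ip.
exists p', i'; split=> //; split=> [g g' h|g|f].
- apply: dualP => z; have [y <-] := pS z; by rewrite -!pE h.
- split=> [h|[f <-]]; last by apply: dualP => x; rewrite iE pE (ses0 _ ip) linear0.
  have [||f fE] := @factor_surj _ _ _ T p (g : {linear Y -> T}) => //.
    by move=> y /e[x <-]; rewrite -iE h.
  by exists (f : D Z); apply: dualP => y; rewrite pE fE.
- by have [g gE] := iT f; exists (g : D Y); apply: dualP => x; rewrite iE gE.
Qed.

Lemma dual_summand X Y : direct_summand X Y ->
  direct_summand (D X : lmodType R) (D Y : lmodType R).
Proof.
move=> [i [p iK]]; have [p' pE] := dual_map p; have [i' iE] := dual_map i.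
by exists p', i' => g; apply: dualP => x; rewrite iE pE iK.
Qed.

Lemma ffun_proj_inj X n (j : 'I_n) : exists (u : {linear X -> {ffun 'I_n -> X}})
  (q : {linear {ffun 'I_n -> X} -> X}),
  [/\ forall x, u x = [ffun j' => if j' == j then x else 0],
      forall x, q x = x j & cancel u q].
Proof.
have [|u uE] := @linear_ext A X {ffun 'I_n -> X} (fun x => [ffun j' => if j' == j then x else 0]).
  move=> a x y; apply/ffunP => j'; rewrite !ffunE; case: eqP => // _.
  by rewrite scaler0 addr0.
have [|q qE] := @linear_ext A {ffun 'I_n -> X} X (fun x => x j).
  by move=> a x y; rewrite !ffunE.
by exists u, q; split=> // x; rewrite qE uE ffunE eqxx.
Qed.

Lemma ffun_sum X n (x : {ffun 'I_n -> X}) :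
  x = \sum_j [ffun j' => if j' == j then x j else 0].
Proof.
apply/ffunP => j; rewrite sum_ffunE (bigD1 j) //= big1 => [|i ij].
  by rewrite ffunE eqxx addr0.
by rewrite ffunE eq_sym (negbTE ij).
Qed.

Lemma dual_power X n : mod_iso (D {ffun 'I_n -> X} : lmodType R) {ffun 'I_n -> D X}.
Proof.
have [u uE] := choice (fun j => ffun_proj_inj X (n:=n) j).
have uE' j x : u j x = [ffun j' => if j' == j then x else 0] by case: (uE j) => q [].
have [|h hE] := @linear_ext R (D {ffun 'I_n -> X}) {ffun 'I_n -> D X}
   (fun g => [ffun j => ((g : {linear _ -> T}) \o u j : D X)]).
  by move=> r g g'; apply/ffunP => j; rewrite !ffunE; apply: dualP.
apply: (@mod_iso_bij _ _ _ h) => [g g'|y].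
  rewrite !hE => /ffunP e; apply: dualP => x; rewrite (ffun_sum x) !linear_sum.
  apply: eq_bigr => j _; rewrite -uE'.
  by have := e j; rewrite !ffunE => /(congr1 (fun f : D X => f (x j))).
have [|g gE] := @linear_ext A {ffun 'I_n -> X} T (fun x => \sum_j (y j : D X) (x j)).
  move=> a x x'; rewrite scaler_sumr -big_split /=; apply: eq_bigr => j _.
  by rewrite !ffunE linearP.
exists (g : D _); apply/ffunP => j; rewrite hE ffunE; apply: dualP => x /=.
rewrite gE (bigD1 j) //= uE' ffunE eqxx big1 ?addr0 // => i ij.
by rewrite ffunE (negbTE ij) linear0.
Qed.

Lemma dual_regular : mod_iso (D A^o : lmodType R) T'.
Proof.
have [h hE] := @evaluation A^o 1.
apply: (@mod_iso_bij _ _ _ h) => [g g'|t].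
  rewrite !hE => /(can_inj (@bthK _ _ b)) e; apply: dualP => x.
  by rewrite -[x]mulr1 -[x * 1]/((x : A) *: (1 : A^o)) !linZ e.
have [|g gE] := @linear_ext A A^o T (fun x => (x : A) *: bht b t).
  by move=> a x y; rewrite scalerDl scalerA.
by exists (g : D _); rewrite hE gE scale1r bhtK.
Qed.

Lemma dual_projective P : finitely_generated P -> projective P ->
  in_add T' (D P : lmodType R).
Proof.
move=> /finitely_generatedP[n [p pS]] Ppr.
have [s sK] := projective_section Ppr pS.
exists n; apply: summand_trans (_ : direct_summand (D (free_mod A n)) _).
  by apply: dual_summand; exists s, p.
apply/mod_iso_summand/(mod_iso_trans (dual_power A^o n))/power_iso.
exact: dual_regular.
Qed.

Lemma reflexive_summand X Y : direct_summand X Y -> reflexive_mod Y -> reflexive_mod X.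
Proof.
move=> [i [p iK]] [tY rY]; have [p' pE] := dual_map p; have [i' iE] := dual_map i.
split=> [x hx|phi].
  rewrite -[x]iK; have -> : i x = 0 by apply: tY => g; rewrite -iE hx.
  exact: linear0.
have [y yE] := rY (phi \o i'); exists (p y) => g.
rewrite -pE -yE /=; congr (phi _).
by apply: dualP => x; rewrite iE pE iK.
Qed.

Lemma reflexive_power X n : reflexive_mod X -> reflexive_mod {ffun 'I_n -> X}.
Proof.
move=> [tX rX].
have [u uE] := choice (fun j => ffun_proj_inj X (n:=n) j).
have [q qE] := choice uE.
have [u' uE'] := choice (fun j => dual_map (u j)).
have [q' qE'] := choice (fun j => dual_map (q j)).
have xE x : x = \sum_j u j (q j x).
  rewrite {1}(ffun_sum x); apply: eq_bigr => j _.
  by have [-> -> _] := qE j.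
split=> [x hx|phi].
  rewrite (xE x) big1 // => j _.
  by rewrite (tX (q j x)) ?linear0 // => g; rewrite -qE' hx.
have [x hx] := choice (fun j => rX (phi \o q' j)).
exists (\sum_j u j (x j)) => g.
have -> : g = \sum_j q' j (u' j g).
  apply: dualP => z; rewrite {1}(xE z) linear_sum.
  by rewrite dual_sumE; apply: eq_bigr => j _; rewrite qE' uE'.
rewrite !linear_sum.
have -> : forall F : 'I_n -> D {ffun 'I_n -> X}, bth (\sum_j (\sum_i F i : D _) (u j (x j)))
   = \sum_i bth (\sum_j (F i : D _) (u j (x j))).
  move=> F; rewrite -(big_morph _ (@bthD _ _ b) (bth0 b)); congr bth.
  by rewrite exchange_big /=; apply: eq_bigr => j _; rewrite dual_sumE.
apply: eq_bigr => i _; rewrite (bigD1 i) //= big1 => [|j ji].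
  rewrite addr0 qE'; have [_ _ ->] := qE i.
  by rewrite -hx.
rewrite qE'; have [_ -> _] := qE i; have [-> _ _] := qE j.
by rewrite ffunE eq_sym (negbTE ji) linear0.
Qed.

(* the action of R identifies R with End_A(T) *)
Definition full_endo :=
  (forall r : R, (forall t : T', r *: t = 0) -> r = 0) /\
  forall phi : {linear T -> T}, exists r : R, forall t, bth (phi t) = r *: bth t.

Section Full.
Hypothesis b_full : full_endo.

Lemma dual_self : mod_iso (R^o : lmodType R) (D T).
Proof.
have hlin r : linear (fun t : T => bht b (r *: bth t)).
  by move=> a x y; rewrite bthD scalerDr bhtD -bcomm bthK.
have [f fE] := choice (fun r : R^o => linear_ext (hlin r)).
have [|h hE] := @linear_ext R R^o (D T) (fun r => f r : D T).
  move=> a x y; apply: dualP => t; rewrite dualDE dualZE !fE.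
  by rewrite bhtK scalerA scalerDl bhtD.
apply: (@mod_iso_bij _ _ _ h) => [x y|g].
  rewrite !hE => /(congr1 (fun f : D T => f : T -> T)) e; apply/subr0_eq; apply: b_full.1 => t.
  rewrite scalerBl; apply/eqP; rewrite subr_eq0; apply/eqP.
  have := congr1 (fun f => f (bht b t)) e; rewrite /= !fE bhtK.
  exact: can_inj (@bhtK _ _ b) _ _.
have [r rE] := b_full.2 g; exists r; rewrite hE; apply: dualP => t.
by rewrite fE -rE bthK.
Qed.

Lemma reflexive_self : reflexive_mod T.
Proof.
split=> [x hx|phi]; first exact: (hx (idfun : {linear T -> T})).
have idE : forall g : D T, exists r : R, g = r *: (idfun : D T).
  move=> g; have [r rE] := b_full.2 g; exists r; apply: dualP => t.
  by rewrite dualZE -rE bthK.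
exists (bht b (phi (idfun : D T))) => g; have [r ->] := idE g.
by rewrite linZ dualZE !bhtK.
Qed.

Lemma reflexive_in_add X : in_add T X -> reflexive_mod X.
Proof. by move=> [n h]; apply: reflexive_summand h _; apply/reflexive_power/reflexive_self. Qed.

Lemma dual_in_add X : in_add T X ->
  finitely_generated (D X : lmodType R) /\ projective (D X : lmodType R).
Proof.
move=> [n h].
have hf : mod_iso (free_mod R n) (D {ffun 'I_n -> T}).
  exact: mod_iso_trans (power_iso n dual_self) (mod_iso_sym (dual_power T n)).
have hs := dual_summand h; split.
  exact/(fg_summand hs)/(fg_iso hf)/fg_free.
exact/(projective_summand hs)/(projective_iso hf)/free_projective.
Qed.

End Full.

End DualTheory.

(** * Reflexive modules, double centralizers and strength on the other side *)

Definition hom_detects (R : pzRingType) (U : lmodType R) :=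
  forall H : lmodType R, finitely_generated H ->
  (forall (phi : {linear H -> U}) h, phi h = 0) -> zero_module H.

Section Reflexivity.
Variables (A R : pzRingType) (b : bimodule A R).
Local Notation T := (bL b).
Local Notation T' := (bR b).
Local Notation D := (dual b).
Implicit Types (K M N P Q X Y Z W : lmodType A).

(** A functional on D X, pulled back to D Y, is evaluation at some y. It vanishes on functionals
    coming from Z, so p y = 0 as Z is torsionless, and y comes from X. *)
Lemma reflexive_kernel X Y Z (i : {linear X -> Y}) (p : {linear Y -> Z}) :
  ses i p -> extends_along T i -> reflexive_mod b Y -> torsionless b Z ->
  reflexive_mod b X.
Proof.
move=> ip iT [tY rY] tZ.
have [p' [i' [_ pE iE]]] := dual_ses ip iT; have [iI e pS] := ip.
split=> [x hx|phi].
  by apply: (linear_inj0 iI); apply: tY => g; rewrite -iE hx.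
have [y yE] := rY (phi \o i').
have /e[x ex] : p y = 0.
  apply: tZ => g; rewrite -pE; apply: (can_inj (@bthK _ _ b)).
  rewrite -yE /= bth0 (_ : i' (p' g) = 0) ?linear0 //.
  by apply: dualP => x; rewrite iE pE (ses0 _ ip) linear0.
exists x => f; have [f' fE] := iT f.
have -> : f = i' (f' : D Y) by apply: dualP => z; rewrite iE fE.
by rewrite iE ex; apply: yE.
Qed.

(** A functional on D Z extends to D Y because Ext^1(D X, T') = 0, and is then evaluation at some y.
    If all maps Z -> T kill p y, evaluation at y factors through D X, hence is evaluation at some x
    in X, and y = i x. *)
Lemma reflexive_cokernel X Y Z (i : {linear X -> Y}) (p : {linear Y -> Z}) :
  ses i p -> extends_along T i -> reflexive_mod b X -> reflexive_mod b Y ->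
  ext1_zero T' (D X) -> reflexive_mod b Z.
Proof.
move=> ip iT [tX rX] [tY rY] DX.
have [p' [i' [pi' pE iE]]] := dual_ses ip iT; have [iI e pS] := ip.
have [_ e' iS'] := pi'.
split=> [z hz|phi].
  have [y yz] := pS z; have [h hE] := evaluation b y.
  have [|phi phiE] := factor_surj iS' (f := h).
    by move=> g /e'[f <-]; rewrite hE pE yz hz bth0.
  have [x xE] := rX phi.
  have -> : z = p (i x); last exact: ses0 ip.
  rewrite -yz; congr (p _); apply/subr0_eq; apply: tY => g.
  rewrite linearB; apply/eqP; rewrite subr_eq0; apply/eqP.
  by apply: (can_inj (@bthK _ _ b)); rewrite -iE -xE phiE hE.
have [psi psiE] := DX _ _ _ _ pi' phi.
have [y yE] := rY psi; exists (p y) => g.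
by rewrite -psiE yE pE.
Qed.

Hypotheses (nA : noetherian A) (b_full : full_endo b).

(** The conclusions are proved together since they feed each other: Ext vanishing for X makes the
    dual sequence exact, X torsionless makes Z reflexive, and the other half of the reflexivity of X
    makes maps D X -> T' extend to D Q. *)
Lemma add_cores_dual Z : finitely_generated T -> ext_zero T T -> add_cores T Z ->
  [/\ ext_zero T Z, reflexive_mod b Z, fin_pd (D Z : lmodType R)
    & ext_zero T' (D Z)].
Proof.
move=> Tfg TT; elim=> {}Z.
  move=> hZ; have [DZfg DZpr] := dual_in_add b_full hZ; split.
  - exact: ext_zero_in_add hZ Tfg TT.
  - exact: reflexive_in_add.
  - by split=> //; exists 0%N.
  - exact: ext_zero_projective.
move=> Q X i p ip hQ _ [TX [tX rX] [_ [n DX]] DXT].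
have TQ := ext_zero_in_add nA hQ Tfg TT.
have [DQfg DQpr] := dual_in_add b_full hQ.
have iT : extends_along T i by apply: ext_zero_ext1 TX _ _ _ _ ip.
have [p' [i' [pi' pE iE]]] := dual_ses ip iT.
split.
- exact: ext_zero_kernel ip TQ TX.
- exact: reflexive_kernel ip iT (reflexive_in_add b_full hQ) tX.
- split; first by case: pi' => _ _ iS; apply: fg_surj iS DQfg.
  by exists n.+1; exists (D X), (D Q), p', i'.
(* phi is evaluation at some x = p q, and evaluation at q extends it. *)
- apply: ext_zero_of_syzygy pi' DQpr _ DXT => phi.
  have [x xE] := rX phi; have [_ _ pS] := ip; have [q qx] := pS x.
  have [h hE] := evaluation b q; exists h => g.
  by rewrite hE pE qx xE.
Qed.

(** The dual of a finite projective resolution of M, which stays exact because Ext(M, T)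
    vanishes. *)
Lemma dual_add_cores M : fin_pd M -> ext_zero T M -> add_cores T' (D M).
Proof.
move: M; apply: fin_pd_ind => // [P Pfg Ppr _|n K M i p ip _ _ IH TM].
  exact/AddCores0/dual_projective.
have Fpr := @free_projective A n.
have iT : extends_along T i by apply: ext_zero_ext1 TM _ _ _ _ ip.
have [p' [i' [pi' _ _]]] := dual_ses ip iT.
apply: (AddCoresS pi'); first exact: dual_projective (fg_free A n) Fpr.
exact/IH/(ext_zero_syzygy ip).
Qed.

(** T' is the dual of A, and R is the dual of T. Dualizing the add(T) coresolution of A resolves T'
    by projectives, dualizing a resolution of T gives the add(T') coresolution of R, and reflexivity
    of A is the double centralizer property. *)
Lemma tilting_flip : tilting T -> tilting T' /\ full_endo (flip b).
Proof.
move=> /tiltingP[Tfin TT TA]; have [Tfg _] := Tfin.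
have [_ [tA rA] DA DAT] := add_cores_dual Tfg TT TA.
have DA' := dual_regular b.
split.
  apply/tiltingP; split; first exact: fin_pd_iso DA' DA.
    exact: ext_zero_iso DA' DAT.
  exact: add_cores_iso (mod_iso_sym (dual_self b_full)) (dual_add_cores Tfin TT).
have mulE t : exists g : {linear A^o -> T}, forall a, g a = (a : A) *: t.
  by apply: linear_ext => a x y; rewrite scalerDl scalerA.
split=> [a ha|phi].
  apply: tA => g; rewrite -[a]mulr1 -[a * 1]/(a *: (1 : A^o)) linZ.
  exact: ha.
have [h hE] := @evaluation _ _ b A^o 1.
have [a aE] := rA (phi \o h); exists a => t.
have [g gE] := mulE (bht b t).
have := aE (g : D A^o); rewrite /= hE !gE scale1r bhtK => ->.
by rewrite bthK.
Qed.

End Reflexivity.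

Section StrongTiltingTheory.
Variables (A R : pzRingType) (b : bimodule A R).
Local Notation T := (bL b).
Local Notation T' := (bR b).
Local Notation D := (dual b).
Hypotheses (nA : noetherian A) (nR : noetherian R) (b_full : full_endo b).

(** Induction along a free resolution with [reflexive_cokernel]. The Ext vanishing it needs for D K
    comes from the add(T') coresolution of D K, treated on the flipped side. *)
Lemma fin_pd_reflexive M : tilting T -> fin_pd M -> ext_zero T M -> reflexive_mod b M.
Proof.
move=> Ttilt; have [/tiltingP[[Tfg' _] TT' _] b_full'] := tilting_flip nA b_full Ttilt.
have /tiltingP[[Tfg _] TT TA] := Ttilt.
have [_ rA _ _] := add_cores_dual nA b_full Tfg TT TA.
move: M; apply: fin_pd_ind => // [P|n K M i p ip Kfin Mfin IH TM].
  move=> /finitely_generatedP[n [p pS]] Ppr _.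
  have [s sK] := projective_section Ppr pS.
  by apply: reflexive_summand (reflexive_power n rA); exists s, p.
have TK := ext_zero_syzygy ip (@free_projective A n) TM.
have iT : extends_along T i by apply: ext_zero_ext1 TM _ _ _ _ ip.
apply: reflexive_cokernel ip iT (IH TK) (reflexive_power n rA) _.
apply: ext_zero_ext1.
have hK := dual_add_cores nA Kfin TK.
by have [] := @add_cores_dual _ _ (flip b) nR b_full' _ Tfg' TT' hK.
Qed.

(* A presentation of H by a matrix over R = End_A(T) gives an A-linear map
   T^n -> T^m, injective because Hom_R(H, T) = 0. Its cokernel has finite
   projective dimension, so the n coordinate maps extend along it, which
   expresses the generators of H through the relations. *)
Lemma strong_hom_detects : strong_tilting T -> hom_detects T'.
Proof.
move=> /strong_tiltingP[Tfin _ Tstr] H Hfg H0.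
have [n [K [i [p [ip [m [v vE]]]]]]] := fg_cover_noetherian nR Hfg.
pose r j a : R := (i (v j) : free_mod R n) a.
have actL c : exists f : {linear T -> T}, forall t, f t = bht b (c *: bth t).
  by apply: linear_ext => a x y; rewrite bthD scalerDr bhtD -bcomm bthK.
have [act actE] := choice actL.
have [g gE] : exists g : {linear {ffun 'I_n -> T} -> {ffun 'I_m -> T}},
    forall t, g t = [ffun j => \sum_a act (r j a) (t a)].
  apply: linear_ext => c x y; apply/ffunP => j; rewrite !ffunE scaler_sumr -big_split.
  by apply: eq_bigr => a _; rewrite !ffunE linearP.
(* An element t of the kernel sends the basis vectors of the free module to its entries and kills
   the relations, so it defines a map H -> T'. *)
have gI : injective g.
  apply: linear_inj => t gt.
  have [theta [thE thd]] := free_linear (fun a => bth (t a)).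
  have th0 k : theta (i k) = 0.
    have [c ->] := vE k; rewrite !linear_sum big1 // => j _; rewrite !linZ.
    rewrite (_ : theta _ = 0) ?scaler0 // thE.
    have /ffunP/(_ j) := gt; rewrite gE !ffunE => /(congr1 (@bth _ _ b)).
    rewrite bth0 (big_morph _ (@bthD _ _ b) (bth0 b)) => h; rewrite -[RHS]h.
    by apply: eq_bigr => a _; rewrite actE bhtK.
  have [||phi phiE] := @factor_surj _ _ _ T' p theta.
  - by case: ip.
  - by move=> x; case: ip => _ e _ /e[k <-].
  apply/ffunP => a; rewrite ffunE; apply: (can_inj (@bthK _ _ b)).
  by rewrite bth0 -thd -phiE H0.
have [Z [q gq]] := ses_cokernel gI.
have Zfin : fin_pd Z by apply: fin_pd_cokernel gq _ _; apply: fin_pd_power.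
have [sig sigE] : exists sig : 'I_n -> {linear {ffun 'I_m -> T} -> T},
    forall a t, sig a (g t) = t a.
  have /choice[s sE] : forall a, exists s : {linear {ffun 'I_m -> T} -> T},
      forall t, s (g t) = t a.
    move=> a; have [_ [q' [_ qE _]]] := ffun_proj_inj T a.
    have [s sE] := ext_zero_ext1 (Tstr Z Zfin) gq q'.
    by exists s => t; rewrite sE qE.
  by exists s.
(* On the j-th copy of T, the extended a-th coordinate is an endomorphism of T, that is, a scalar c
   (a, j) of R. *)
have /choice[c cE] : forall aj : 'I_n * 'I_m, exists c : R, forall t,
    bth (sig aj.1 [ffun j' => if j' == aj.2 then t else 0]) = c *: bth t.
  move=> [a j]; have [u [_ [uE _ _]]] := ffun_proj_inj T j.
  have [c cE] := b_full.2 (sig a \o u); exists c => t.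
  by rewrite -cE /= uE.
(* Both sides are compared through their action on T, on which R acts faithfully. *)
have rel a : free_delta R a = i (\sum_j c (a, j) *: v j).
  apply/ffunP => a'; rewrite linear_sum sum_ffunE ffunE; apply/subr0_eq.
  apply: b_full.1 => t'; rewrite scalerBl scaler_suml.
  apply/eqP; rewrite subr_eq0; apply/eqP.
  rewrite -[t'](@bhtK _ _ b t'); set t := bht b t'.
  have := congr1 (@bth _ _ b) (sigE a [ffun a'' => if a'' == a' then t else 0]).
  rewrite (ffun_sum (g _)) linear_sum (big_morph _ (@bthD _ _ b) (bth0 b)).
  rewrite ffunE => h.
  transitivity (bth (if a == a' then t else 0)).
    by case: eqP; rewrite ?scale1r ?scale0r ?bth0.
  rewrite -h; apply: eq_bigr => j _; rewrite (cE (a, j)) gE ffunE.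
  rewrite (bigD1 a') //= big1 => [|a'' na]; last by rewrite ffunE (negbTE na) linear0.
  rewrite addr0 actE ffunE eqxx bhtK scalerA linZ ffunE.
  by [].
have p0 : forall x, p x = (\0 : {linear _ -> H}) x.
  apply: free_ext => a; rewrite rel; exact: ses0 ip.
by move=> h; case: ip => _ _ pS; have [x <-] := pS h; rewrite p0.
Qed.

Lemma torsionless_hom_detects M : hom_detects M -> torsionless b M -> hom_detects T.
Proof.
move=> hM tM H Hfg H0; apply: hM => // phi h.
by apply: tM => g; apply: (H0 ((g : {linear M -> T}) \o phi)).
Qed.

(* For N with a presentation K -> F -> N, the cokernel H of the restriction
   map Hom(F, T) -> Hom(K, T) satisfies Hom(H, T) = 0 because K is reflexive
   and embeds in F; hence H = 0, that is, Ext^1(N, T) = 0. *)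
Lemma strong_flip : strong_tilting T -> hom_detects T -> strong_tilting T'.
Proof.
move=> Tstrong Tdet.
have /strong_tiltingP[Tfin _ Tstr] := Tstrong.
have [Ttilt' b_full'] := tilting_flip nA b_full Tstrong.1.
have /tiltingP[Tfin' TT' TR'] := Ttilt'; have [Tfg' _] := Tfin'.
have [_ rR _ _] := add_cores_dual nR b_full' Tfg' TT' TR'.
(* Reflexivity of K and [fin_pd] of its dual are what the inductive step consumes, so both are
   carried along. *)
suff h N : fin_pd N -> [/\ ext_zero T' N, reflexive_mod (flip b) N
    & fin_pd (dual (flip b) N : lmodType A)].
  by apply/strong_tiltingP; split=> // N /h[].
move: N; apply: fin_pd_ind => // [P Pfg Ppr|n K N i p ip Kfin Nfin [TK rK DK]].
  split; first exact: ext_zero_projective.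
    have /finitely_generatedP[n [p pS]] := Pfg.
    have [s sK] := projective_section Ppr pS.
    by apply: reflexive_summand (reflexive_power n rR); exists s, p.
  exact: fin_pd_in_add nA (dual_projective (flip b) Pfg Ppr) Tfin.
have rF := reflexive_power n rR.
have [i' iE] := dual_map (flip b) i.
have [H [q [qS qe]]] := cokernel_type i'.
have iS' : surjective_map i'.
  suff H0 : zero_module H by move=> f; apply/qe; apply: H0.
  apply: Tdet; first by case: DK => DKfg _; apply: fg_surj qS DKfg.
  (* Composed with q, phi becomes evaluation at some k in K. It vanishes on restrictions from F, so
     every map F -> T' kills i k, and k = 0. *)
  move=> phi h; have [f <-] := qS h.
  have [k kE] := rK.2 (phi \o q).
  suff k0 : k = 0.
    by move: (kE f); rewrite k0 linear0 => e; rewrite [LHS]e; exact: (bth0 (flip b)).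
  have [iI _ _] := ip; apply: (linear_inj0 iI); apply: rF.1 => g.
  have := kE (i' g); rewrite /= (_ : q (i' g) = 0); last by apply/qe; exists g.
  rewrite linear0 iE => e; apply: (can_inj (@bthK _ _ (flip b))).
  exact: etrans (esym e) (esym (bth0 (flip b))).
have iT : extends_along T' i.
  by move=> f; have [g gf] := iS' (f : dual (flip b) K); exists g => x; rewrite -gf iE.
have [p' [i'' [pi' _ _]]] := @dual_ses _ _ (flip b) _ _ _ _ _ ip iT.
have Fpr := @free_projective R n.
split.
- exact: ext_zero_of_syzygy ip Fpr iT TK.
- apply: (@reflexive_cokernel _ _ (flip b) _ _ _ _ _ ip iT rK rF).
  exact/ext_zero_ext1/Tstr.
- apply: fin_pd_kernel nA pi' _ DK.
  exact: fin_pd_in_add nA (dual_projective (flip b) (fg_free R n) Fpr) Tfin.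
Qed.

(** T1 is reflexive with respect to T, so finitely many generators of its dual embed it in a power
    of T. The cokernel has finite projective dimension, and the strength of T1 splits the
    embedding. *)
Lemma strong_in_add T1 : strong_tilting T -> strong_tilting T1 -> in_add T T1.
Proof.
move=> Tstrong /strong_tiltingP[T1fin _ T1str].
have /strong_tiltingP[Tfin _ Tstr] := Tstrong.
have [tT1 _] := fin_pd_reflexive Tstrong.1 T1fin (Tstr T1 T1fin).
have [/tiltingP[[Tfg' _] _ _] _] := tilting_flip nA b_full Tstrong.1.
have [m [f fE]] : finitely_generated (D T1 : lmodType R).
  have [/finitely_generatedP[n [p pS]] _] := T1fin.
  have [p' pE] := dual_map b p.
  have Ffg : finitely_generated (D (free_mod A n) : lmodType R).
    have [l] := dual_projective b (fg_free A n) (@free_projective A n).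
    by move/fg_summand; apply; apply: fg_power.
  apply: (nR Ffg (i := p')) => g g' e; apply: dualP => x.
  by have [y <-] := pS x; rewrite -!pE e.
have [g gE] : exists g : {linear T1 -> {ffun 'I_m -> T}},
    forall x, g x = [ffun j => (f j : D T1) x].
  by apply: linear_ext => a x y; apply/ffunP => j; rewrite !ffunE linearP.
have gI : injective g.
  apply: linear_inj => x; rewrite gE => /ffunP gx; apply: tT1 => h.
  have [c ->] := fE h; rewrite dual_sumE big1 // => j _.
  by have := gx j; rewrite !ffunE dualZE => ->; rewrite bth0 scaler0 bht0.
have [Z [q gq]] := ses_cokernel gI.
have Zfin : fin_pd Z by apply: fin_pd_cokernel gq T1fin _; apply: fin_pd_power.
have [s sE] := ext_zero_ext1 (T1str Z Zfin) gq idfun.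
by exists m, g, s.
Qed.

End StrongTiltingTheory.

(** * Transport along ring isomorphisms *)

Section IsoInvariance.
Variable R : pzRingType.
Implicit Types (M N T X Y : lmodType R).

Lemma in_add_change T T' X : mod_iso T T' -> in_add T X -> in_add T' X.
Proof.
move=> TT' [n Xn]; exists n; apply: summand_trans Xn _.
exact/mod_iso_summand/power_iso.
Qed.

Lemma ext1_zero_change N N' M : mod_iso N N' -> ext1_zero N M -> ext1_zero N' M.
Proof.
move=> /mod_isoP[u [v [uK vK]]] h K X i p ip f.
have [g gE] := h _ _ _ _ ip (v \o f); exists (u \o g) => x /=.
by rewrite gE /= vK.
Qed.

Lemma strong_tilting_iso T T' : mod_iso T T' -> strong_tilting T -> strong_tilting T'.
Proof.
move=> TT' /strong_tiltingP[Tfin TR Tstr]; apply/strong_tiltingP; split.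
- exact: fin_pd_iso TT' Tfin.
- elim: TR => M; first by move=> h; apply/AddCores0/(in_add_change TT').
  by move=> Q X i p ip /(in_add_change TT') hQ _; apply: AddCoresS ip hQ.
- move=> M /Tstr h n; apply: syz_impl (h n) => X; exact: ext1_zero_change.
Qed.

End IsoInvariance.

Section TwistLinear.
Variables (S R : pzRingType) (f : {rmorphism S -> R}) (g : {rmorphism R -> S}).
Hypotheses (fK : cancel f g) (gK : cancel g f).
Implicit Types (M : lmodType R) (N : lmodType S).

(** Together with [twist_coadj], this moves lifting problems back and forth across the isomorphism
    without composing twists. *)
Lemma twist_adj M N (h : {linear twist f M -> N}) :
  exists h' : {linear M -> twist g N}, forall x, h' x = h x.
Proof.
apply: (@linear_ext R M (twist g N) h) => r x y.
by have := linearP h (g r) x y; rewrite {1}twistE gK.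
Qed.

Lemma twist_coadj M N (h : {linear N -> twist f M}) :
  exists h' : {linear twist g N -> M}, forall x, h' x = h x.
Proof.
apply: (@linear_ext R (twist g N) M h) => r x y.
by rewrite [LHS](linearP h (g r) x y) twistE gK.
Qed.

Lemma twist_ses (X Y Z : lmodType R) (i : {linear X -> Y}) (p : {linear Y -> Z}) :
  ses i p -> exists (i' : {linear twist f X -> twist f Y})
    (p' : {linear twist f Y -> twist f Z}), [/\ ses i' p', i' =1 i & p' =1 p].
Proof.
move=> [iI e pS].
have [i' iE] := twist_linear f i; have [p' pE] := twist_linear f p.
exists i', p'; split=> //; split.
- by move=> x y; rewrite !iE => /iI.
- move=> y; rewrite pE [X in X <-> _]e.
  by split=> -[x ex]; exists x; rewrite -?ex ?iE // -ex iE.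
- by move=> z; have [y <-] := pS z; exists y; rewrite pE.
Qed.

Lemma twist_iso M M' : mod_iso M M' -> mod_iso (twist f M) (twist f M').
Proof.
move=> [u [v uK vK]]; have [u' uE] := twist_linear f u.
by exists u', v => x; rewrite uE ?uK ?vK.
Qed.

Lemma twist_summand M M' : direct_summand M M' ->
  direct_summand (twist f M) (twist f M').
Proof.
move=> [i [p iK]]; have [i' iE] := twist_linear f i; have [p' pE] := twist_linear f p.
by exists i', p' => x; rewrite iE pE iK.
Qed.

Lemma twist_power n M : mod_iso (twist f {ffun 'I_n -> M}) {ffun 'I_n -> twist f M}.
Proof.
have [|h hE] := @linear_ext S (twist f {ffun 'I_n -> M}) {ffun 'I_n -> twist f M} id.
  by move=> a x y; apply/ffunP => j; rewrite !ffunE.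
by exists h, id => x; rewrite hE.
Qed.

Lemma twist_pair M M' : mod_iso (twist f (M * M')%type) (twist f M * twist f M')%type.
Proof.
have [|h hE] := @linear_ext S (twist f (M * M')%type) (twist f M * twist f M')%type id.
  by [].
by exists h, id => x; rewrite hE.
Qed.

Lemma twist_fg M : finitely_generated M -> finitely_generated (twist f M).
Proof.
move=> [n [v vE]]; exists n, v => x; have [c {1}->] := vE x.
by exists (g \o c); apply: eq_bigr => i _; rewrite twistE /= gK.
Qed.

Lemma twist_in_add T M : in_add T M -> in_add (twist f T) (twist f M).
Proof.
move=> [n h]; exists n; apply: summand_trans (twist_summand h) _.
exact/mod_iso_summand/twist_power.
Qed.

Lemma twist_add_cores T M : add_cores T M -> add_cores (twist f T) (twist f M).
Proof.
elim=> {}M; first by move=> h; apply/AddCores0/twist_in_add.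
move=> Q X i p /twist_ses[i' [p' [ip _ _]]] hQ _ hX.
exact: AddCoresS ip (twist_in_add hQ) hX.
Qed.

Lemma twist_regular : mod_iso (twist f R^o) S^o.
Proof.
have [|h hE] := @linear_ext S (twist f R^o) S^o g.
  by move=> a x y; rewrite rmorphD rmorphM fK.
by exists h, f => x; rewrite hE ?fK ?gK.
Qed.

End TwistLinear.

Section TwistHomology.
Variables (S R : pzRingType) (f : {rmorphism S -> R}) (g : {rmorphism R -> S}).
Hypotheses (fK : cancel f g) (gK : cancel g f).
Implicit Types (M : lmodType R) (N : lmodType S).

Lemma twist_untwist N : mod_iso (twist f (twist g N)) N.
Proof.
have [|h hE] := @linear_ext S (twist f (twist g N)) N id.
  by move=> a x y; rewrite twistE twistE fK.
by exists h, id => x; rewrite hE.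
Qed.

Lemma twist_projective P : projective P -> projective (twist f P).
Proof.
move=> Ppr X Y u h uS.
have [h' hE] := twist_adj gK h; have [u' uE] := twist_linear g u.
have [|w wE] := Ppr _ _ u' h'.
  by move=> y; have [x <-] := uS y; exists x; rewrite uE.
have [w' wE'] := twist_coadj fK w.
have [h'' hE''] := twist_coadj fK h'.
have [|v vE] := @linear_ext S (twist f P) X w.
  by move=> a x y; rewrite [LHS](linearP w (f a) x y) twistE fK.
by exists v => x; rewrite vE -uE wE hE.
Qed.

Lemma twist_ext1 (N M : lmodType R) : ext1_zero N M -> ext1_zero (twist f N) (twist f M).
Proof.
move=> h K X i p ip u.
have [i' [p' [ip' iE pE]]] := twist_ses g ip.
have [u' uE] := twist_coadj gK u.
have MM : mod_iso (twist g (twist f M)) M.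
  have [|w wE] := @linear_ext R (twist g (twist f M)) M id.
    by move=> a x y; rewrite twistE twistE gK.
  by exists w, id => x; rewrite wE.
have [p'' ip''] := ses_iso_r ip' MM.
have [v vE] := h _ _ _ _ ip'' u'.
have [|w wE] := @linear_ext S X (twist f N) v.
  by move=> a x y; have := linearP v (f a) x y; rewrite twistE fK.
by exists w => x; rewrite wE -iE vE uE.
Qed.

Lemma twist_syz (Phi : lmodType R -> Prop) (Psi : lmodType S -> Prop) n M :
  (forall M, Phi M -> Psi (twist f M)) -> syz Phi n M -> syz Psi n (twist f M).
Proof.
move=> h; elim: n M => [|n IHn] M /=; first exact: h.
move=> [K [P [i [p [ip Ppr hK]]]]].
have [i' [p' [ip' _ _]]] := twist_ses f ip.
exists (twist f K), (twist f P), i', p'; split=> //; last exact: IHn.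
exact: twist_projective.
Qed.

Lemma twist_fin_pd M : fin_pd M -> fin_pd (twist f M).
Proof.
move=> [Mfg [n hM]]; split; first exact: twist_fg gK _ Mfg.
by exists n; apply: twist_syz hM => P; apply: twist_projective.
Qed.

Lemma twist_ext_zero (N M : lmodType R) : ext_zero N M -> ext_zero (twist f N) (twist f M).
Proof. by move=> h n; apply: twist_syz (h n) => X; apply: twist_ext1. Qed.

End TwistHomology.

Section TwistStrong.
Variables (S R : pzRingType) (f : {rmorphism S -> R}) (g : {rmorphism R -> S}).
Hypotheses (fK : cancel f g) (gK : cancel g f).

Lemma twist_strong_tilting (T : lmodType R) :
  strong_tilting T -> strong_tilting (twist f T).
Proof.
move=> /strong_tiltingP[Tfin TR Tstr]; apply/strong_tiltingP; split.
- exact: (twist_fin_pd fK gK).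
- exact: add_cores_iso (twist_regular fK gK) (twist_add_cores f TR).
- move=> M Mfin; apply: ext_zero_iso (twist_untwist fK M) _.
  by apply: (twist_ext_zero fK gK); apply/Tstr/(twist_fin_pd gK fK).
Qed.

Lemma twist_basic (T : lmodType R) : basic_module T -> basic_module (twist f T).
Proof.
move=> hT X [Xn0 Xind] XX; apply: (hT (twist g X)).
  split=> [h|U V UV]; first exact: Xn0 h.
  have h : mod_iso X (twist f U * twist f V)%type.
    apply: mod_iso_trans (mod_iso_sym (twist_untwist fK X)) _.
    exact: mod_iso_trans (twist_iso f UV) (twist_pair _ _ _).
  by case: (Xind _ _ h); [left|right].
apply: summand_trans (mod_iso_summand (twist_untwist gK T)).
apply: summand_trans (twist_summand g XX).
exact/mod_iso_summand/mod_iso_sym/twist_pair.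
Qed.

End TwistStrong.

(** * Primitive idempotents and basic rings *)

Section Idempotents.
Variable R : pzRingType.
Implicit Types (e f x y w : R).

Definition is_idempotent e := e * e = e.

Definition primitive e := [/\ is_idempotent e, e <> 0
  & forall f, is_idempotent f -> e * f = f -> f * e = f -> f = 0 \/ f = e].

Definition in_corner e x := e * x = x /\ x * e = x.

(** Units of the corner ring e R e, whose identity is e; the ring itself is never formed as a
    type. *)
Definition corner_unit e x := exists y, [/\ in_corner e y, x * y = e & y * x = e].

Definition orthogonal_family n (e : 'I_n -> R) := forall i j, i != j -> e i * e j = 0.

Lemma corner_exp e x n : in_corner e x -> in_corner e (x ^+ n.+1).
Proof. by move=> [h1 h2]; split; [rewrite exprS mulrA h1|rewrite exprSr -mulrA h2]. Qed.

Lemma in_cornerM e x y : in_corner e x -> in_corner e y -> in_corner e (x * y).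
Proof. by move=> [h1 _] [_ h2]; split; [rewrite mulrA h1|rewrite -mulrA h2]. Qed.

Lemma in_cornerB e x y : in_corner e x -> in_corner e y -> in_corner e (x - y).
Proof.
by move=> [h1 h2] [h3 h4]; split; [rewrite mulrBr h1 h3|rewrite mulrBl h2 h4].
Qed.

Lemma in_corner_sandwich e x : is_idempotent e -> in_corner e (e * x * e).
Proof. by move=> ee; split; [rewrite !mulrA ee|rewrite -!mulrA ee]. Qed.

Hypothesis dccR : dcc R^o.

Lemma left_power_stabilises x : exists n, forall m, (n <= m)%N ->
  exists g, x ^+ n = g * x ^+ m.
Proof.
pose S n : set R^o := fun y => exists g, y = g * x ^+ n.
have [|n y [g ->]|N hN] := dccR (S := S).
- move=> n; split; first by exists 0; rewrite mul0r.
    by move=> _ _ [y ->] [z ->]; exists (y + z); rewrite mulrDl.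
  by move=> a _ [y ->]; exists ((a : R) * y); rewrite -mulrA.
- by exists (g * x); rewrite exprS mulrA.
exists N => m Nm; have : S N (x ^+ N) by exists 1; rewrite mul1r.
by rewrite -(hN m Nm).
Qed.

(** Among the idempotents without a decomposition, take e1 with R e1 minimal. It is not primitive,
    so it splits as f + (e1 - f), and the decompositions of both parts combine to one of e1. *)
Lemma primitive_decomposition e : is_idempotent e -> exists n (p : 'I_n -> R),
  [/\ forall i, primitive (p i), orthogonal_family p, forall i, in_corner e (p i)
    & \sum_i p i = e].
Proof.
move=> ee; apply: contrapT => ne.
pose bad f := is_idempotent f /\ ~ exists n (p : 'I_n -> R),
  [/\ forall i, primitive (p i), orthogonal_family p, forall i, in_corner f (p i)
    & \sum_i p i = f].
pose ideal f : set R^o := fun y => exists g, y = g * f.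
have idealS f : submodule (ideal f).
  split; first by exists 0; rewrite mul0r.
    by move=> _ _ [y ->] [z ->]; exists (y + z); rewrite mulrDl.
  by move=> a _ [y ->]; exists ((a : R) * y); rewrite -mulrA.
have [|S [SS [e1 [e1e1 e1n] SE] Smin]] :=
    dcc_min (P := fun S => exists2 f, bad f & S = ideal f) dccR.
  by exists (ideal e); split=> //; exists e.
(* Minimality makes e1 a multiple g f of f, and then f = e1 f = g f f = e1. *)
have sub f : bad f -> in_corner e1 f -> f = e1.
  move=> fbad [h1 h2]; have [ff _] := fbad.
  have /Smin h : exists2 f', bad f' & ideal f = ideal f' by exists f.
  have : ideal f e1.
    rewrite h // SE; first by exists 1; rewrite mul1r.
    by move=> x [g ->]; exists (g * f); rewrite -mulrA h2.
  by move=> [g e1f]; rewrite -h1 {1}e1f -mulrA ff.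
have good f : is_idempotent f -> in_corner e1 f -> f <> e1 -> exists n (p : 'I_n -> R),
  [/\ forall i, primitive (p i), orthogonal_family p, forall i, in_corner f (p i)
    & \sum_i p i = f].
  by move=> ff fe ne1; apply: contrapT => h; apply: ne1; apply: sub.
have e1nz : e1 <> 0.
  move=> e0; apply: e1n; exists 0%N, (fun=> 0).
  by split; [case|case|case|rewrite big_ord0].
have [e1prim|] := pselect (primitive e1).
  apply: e1n; exists 1%N, (fun=> e1); split=> //; last by rewrite big_ord1.
  by move=> i j; rewrite !ord1 eqxx.
apply=> //; split=> // f ff ef fe.
apply: contrapT => /not_orP[f0 fe1].
have [|n [p [pp po pc ps]]] := good f ff _ fe1; first by [].
have gg : is_idempotent (e1 - f).
  by rewrite /is_idempotent mulrBl !mulrBr e1e1 ef fe ff subrr subr0.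
have eg : e1 * (e1 - f) = e1 - f by rewrite mulrBr e1e1 ef.
have ge : (e1 - f) * e1 = e1 - f by rewrite mulrBl e1e1 fe.
have [||m [q [qp qo qc qs]]] := good (e1 - f) gg.
- by split.
- by move=> h; apply: f0; rewrite -[f]opprK -[- f](addKr e1) h addNr oppr0.
have fg : f * (e1 - f) = 0 by rewrite mulrBr fe ff subrr.
have gf : (e1 - f) * f = 0 by rewrite mulrBl ef ff subrr.
apply: e1n; exists (n + m)%N,
  (fun k => match split k with inl a => p a | inr c => q c end); split.
- by move=> k; case: (split k).
- move=> k l; rewrite -[k]splitK -[l]splitK.
  case: (split k) (split l) => [a|a] [c|c]; rewrite ?unsplitK => ne1.
  + by apply: po; apply: contraNneq ne1 => ->.
  + have [_ <-] := pc a; have [<- _] := qc c.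
    by rewrite -mulrA [f * _]mulrA fg mul0r mulr0.
  + have [_ <-] := qc a; have [<- _] := pc c.
    by rewrite -mulrA [(e1 - f) * (f * _)]mulrA gf mul0r mulr0.
  + by apply: qo; apply: contraNneq ne1 => ->.
- move=> k; case: (split k) => a.
    by have [h1 h2] := pc a; split; [rewrite -h1 mulrA ef|rewrite -h2 -mulrA fe].
  by have [h1 h2] := qc a; split; [rewrite -h1 mulrA eg|rewrite -h2 -mulrA ge].
- rewrite big_split_ord /=.
  under eq_bigr => i _ do rewrite (unsplitK (inl _ i)).
  under [X in _ + X]eq_bigr => i _ do rewrite (unsplitK (inr _ i)).
  by rewrite ps qs addrC subrK.
Qed.

Hypothesis dccRc : dcc (R^c)^o.

Lemma right_power_stabilises x : exists n, forall m, (n <= m)%N ->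
  exists g, x ^+ n = x ^+ m * g.
Proof.
pose S n : set (R^c)^o := fun y => exists g : R, y = (x ^+ n * g)%R.
have [|n y [g ->]|N hN] := dccRc (S := S).
- move=> n; split; first by exists 0; rewrite mulr0.
    by move=> _ _ [y ->] [z ->]; exists (y + z); rewrite mulrDr.
  by move=> a _ [y ->]; exists (y * (a : R)); rewrite mulrA.
- by exists (x * g); rewrite exprSr mulrA.
exists N => m Nm; have : S N (x ^+ N) by exists 1; rewrite mulr1.
by rewrite -(hN m Nm).
Qed.

Section Local.
Variable e : R.
Hypothesis e_prim : primitive e.

(* Fitting: e' = g x^n = x^n h is an idempotent of e R e. *)
Lemma nilpotent_or_unit x : in_corner e x ->
  (exists n, x ^+ n = 0) \/ corner_unit e x.
Proof.
move=> xe; have [ee e0 eP] := e_prim.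
have [n1 h1] := left_power_stabilises x; have [n2 h2] := right_power_stabilises x.
pose n := maxn n1 n2; pose N := n.+1.
have n1N : (n1 <= N)%N by apply/leqW/leq_maxl.
have n2N : (n2 <= N)%N by apply/leqW/leq_maxr.
have [g gE] : exists g, x ^+ N = g * x ^+ (N + N).
  have [g gE] := h1 (N + N)%N (leq_trans n1N (leq_addr _ _)).
  by exists (x ^+ (N - n1) * g); rewrite -mulrA -gE -exprD subnK.
have [h hE] : exists h, x ^+ N = x ^+ (N + N) * h.
  have [h hE] := h2 (N + N)%N (leq_trans n2N (leq_addr _ _)).
  by exists (h * x ^+ (N - n2)); rewrite mulrA -hE -exprD subnKC.
have [xe1 xe2] := corner_exp n xe.
have ghE : g * x ^+ N = x ^+ N * h by rewrite {1}hE mulrA -gE.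
have Eidem : is_idempotent (g * x ^+ N).
  by rewrite /is_idempotent {2}ghE mulrA -[g * _ * _]mulrA -exprD -gE.
have [|||E'0|E'e] := eP (g * x ^+ N) => //.
- by rewrite ghE mulrA xe1.
- by rewrite -mulrA xe2.
- by left; exists N; rewrite hE exprD -mulrA -ghE E'0 mulr0.
right; pose y := e * g * x ^+ n; pose z := x ^+ n * h * e.
have yx : y * x = e by rewrite /y -mulrA -exprSr -mulrA E'e ee.
have xz : x * z = e by rewrite /z !mulrA -exprS -ghE E'e ee.
have yz : y * e = e * z by rewrite -{1}xz mulrA yx.
have [ex xe'] := xe.
exists (y * e); split.
- by split; [rewrite /y !mulrA ee|rewrite -mulrA ee].
- by rewrite yz mulrA xe' xz.
- by rewrite -mulrA ex yx.
Qed.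

(** A left inverse rules out nilpotency: w^m x^(m+1) = x for all m, so x, and with it e, would
    vanish. *)
Lemma left_inverse_unit x w : in_corner e x -> w * x = e -> corner_unit e x.
Proof.
move=> xe wx; have [ee e0 _] := e_prim; have [ex xe'] := xe.
case: (nilpotent_or_unit xe) => // -[n xn]; case: e0.
have h m : w ^+ m * x ^+ m.+1 = x.
  elim: m => [|m IHm]; first by rewrite mul1r.
  by rewrite exprSr exprS -mulrA [w * _]mulrA wx exprS [e * _]mulrA ex -exprS.
by rewrite -wx -(h n) exprSr xn mul0r !mulr0.
Qed.

Lemma right_inverse_unit x w : in_corner e x -> x * w = e -> corner_unit e x.
Proof.
move=> xe wx; have [ee e0 _] := e_prim; have [ex xe'] := xe.
case: (nilpotent_or_unit xe) => // -[n xn]; case: e0.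
have h m : x ^+ m.+1 * w ^+ m = x.
  elim: m => [|m IHm]; first by rewrite mulr1.
  have [_ xme] := corner_exp m xe.
  by rewrite exprSr [w ^+ _]exprS -mulrA [x * _]mulrA wx mulrA xme.
by rewrite -wx -(h n) exprS xn mulr0 !mul0r.
Qed.

(** The corner ring of a primitive idempotent is local: if x is nilpotent, the geometric series
    inverts y = e - x. *)
Lemma unit_add x y : in_corner e x -> in_corner e y -> x + y = e ->
  corner_unit e x \/ corner_unit e y.
Proof.
move=> xe ye xye; have [ee _ _] := e_prim; have [ex xe'] := xe.
case: (nilpotent_or_unit xe) => [[n xn]|]; last by left.
right; pose s := \sum_(i < n) x ^+ i.
have cs : s * x = x * s.
  by rewrite mulr_suml mulr_sumr; apply: eq_bigr => i _; rewrite -exprS -exprSr.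
have s1 : s * (1 - x) = 1.
  rewrite mulrBr mulr1 cs -[s in X in X - _]mul1r -mulrBl.
  by rewrite -[1 - x]opprB mulNr -subrX1 xn sub0r opprK.
apply: (@left_inverse_unit _ s ye).
have -> : y = (1 - x) * e by rewrite mulrBl mul1r xe' -xye addrC addKr.
by rewrite mulrA s1 mul1r.
Qed.

Lemma unit_sum (I : Type) (r : seq I) (F : I -> R) x : (forall i, in_corner e (F i)) ->
  in_corner e x -> corner_unit e x -> \sum_(i <- r) F i = x ->
  exists i, corner_unit e (F i).
Proof.
move=> Fe; elim: r x => [|i r IHr] x xe [w [we xw wx]].
  rewrite big_nil => x0; have [_ e0 _] := e_prim.
  by case: e0; rewrite -wx -x0 mulr0.
rewrite big_cons; set y := \sum_(_ <- _) _ => xE.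
have ye : in_corner e y by rewrite -[y](addKr (F i)) xE addrC; apply: in_cornerB.
have [||||h] := @unit_add (w * F i) (w * y); try exact: in_cornerM.
- by rewrite -mulrDr xE.
- move=> [v [ve _ vx]]; exists i; apply: (@left_inverse_unit _ (v * w)) => //.
  by rewrite -mulrA.
have [v [ve _ vx]] := h.
apply: (IHr y) => //; apply: (@left_inverse_unit _ (v * w)) => //.
by rewrite -mulrA.
Qed.

End Local.
End Idempotents.

(** For primitive idempotents this says that R e i and R e j are not isomorphic when i and j
    differ. *)
Definition isolated (R : pzRingType) (n : nat) (e : 'I_n -> R) :=
  forall i j, i != j -> forall a b, e i * a * e j * b * e i <> e i.

(** The module quotient is kept and multiplied through a section s; as K is two-sided, the product
    does not depend on s. *)
Lemma quotient_ring (R : pzRingType) (K : set R^o) : submodule K ->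
  (forall x r : R, K x -> K (x * r)) -> ~ K (1 : R) ->
  exists (D : nzRingType) (pr : {rmorphism R -> D}),
    surjective_map pr /\ forall x, pr x = 0 <-> K x.
Proof.
move=> KS Kr K1; have [Q [p [pS pK]]] := quotient_type KS.
have [s sE] := choice pS.
pose mul (x y : Q) : Q := p ((s x : R) * (s y : R)).
have pE (x y : R^o) : K (x - y) -> p x = p y.
  by move=> h; apply/subr0_eq; rewrite -linearB; apply/pK.
have pM (x y : R) : mul (p x) (p y) = p (x * y).
  have sK z : K (s (p z) - z) by apply/pK; rewrite linearB sE subrr.
  apply: pE.
  have -> : (s (p x) : R) * s (p y) - x * y
          = (s (p x) : R) * (s (p y) - y) + (s (p x) - x) * y.
    by rewrite mulrBr mulrBl addrA subrK.
  by case: KS => _ KD KZ; apply: KD; [apply: KZ|apply: Kr].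
have surj2 (P : Q -> Prop) : (forall x, P (p x)) -> forall x, P x.
  by move=> h x; rewrite -(sE x).
have mA : associative mul.
  by apply: (surj2 _) => x; apply: (surj2 _) => y; apply: (surj2 _) => z; rewrite !pM mulrA.
have m1 : left_id (p 1) mul by apply: (surj2 _) => x; rewrite pM mul1r.
have m1' : right_id (p 1) mul by apply: (surj2 _) => x; rewrite pM mulr1.
have mDl : left_distributive mul +%R.
  apply: (surj2 _) => x; apply: (surj2 _) => y; apply: (surj2 _) => z.
  by rewrite -linearD !pM mulrDl linearD.
have mDr : right_distributive mul +%R.
  apply: (surj2 _) => x; apply: (surj2 _) => y; apply: (surj2 _) => z.
  by rewrite -linearD !pM mulrDr linearD.
have m10 : p 1 != 0 by apply/eqP => /pK.
pose D : nzRingType := HB.pack_for nzRingType (GRing.Lmodule.sort Q)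
  (GRing.Zmodule_isNzRing.Build (GRing.Lmodule.sort Q) mA m1 m1' mDl mDr m10).
have paM : monoid_morphism (p : R -> D) by split=> // x y; rewrite -pM.
have paB : zmod_morphism (p : R -> D) by exact: (linearB p).
pose pr : {rmorphism R -> D} := HB.pack_for {rmorphism R -> D} (p : R -> D)
  (GRing.isZmodMorphism.Build R D (p : R -> D) paB)
  (GRing.isMonoidMorphism.Build R D (p : R -> D) paM).
by exists D, pr.
Qed.

Section BasicRings.
Variable R : pzRingType.

(* A ring-theoretic form of basicness that is visibly invariant under ring
   isomorphisms and under passing to the opposite ring. *)
Definition no_iso_idempotents := forall e f a b : R,
  e * e = e -> f * f = f -> e * f = 0 -> f * e = 0 ->
  a * b = e -> b * a = f -> e = 0.

(** If e were nonzero, R (1 - e) would lie in a maximal left ideal, which would contain e as well,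
    hence 1. *)
Lemma jacobson_idempotent (e : R) : jacobson_radical e -> e * e = e -> e = 0.
Proof.
move=> eJ ee; apply: contrapT => e0.
pose I : set R^o := fun x => exists y : R, x = (y * (1 - e))%R.
have IS : submodule I.
  split; first by exists 0; rewrite mul0r.
    by move=> _ _ [x ->] [y ->]; exists (x + y); rewrite mulrDl.
  by move=> a _ [x ->]; exists ((a : R) * x); rewrite -mulrA.
have [|W [WS IW W1 Wmax]] := @maximal_avoiding _ _ I (1 : R) IS.
  move=> [y y1]; apply: e0.
  by rewrite -[e]mul1r y1 -mulrA mulrBl mul1r ee subrr mulr0.
have [W0 WD WZ] := WS.
apply: (W1); rewrite -[1](subrK e); apply: (WD).
  by apply: IW; exists 1; rewrite mul1r.
have WL : left_ideal (W : set R).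
  by split=> [|x y|a x]; [exact: W0|exact: WD|exact: WZ].
apply: eJ; split; first exact: WL.
  exact: W1.
move=> J [J0 JD JZ] J1 WJ.
exact: (Wmax J).
Qed.

(** In a division ring component where e does not vanish, e maps to 1 and so does f, against e f =
    0. *)
Lemma basic_ring_idempotents : basic_ring R -> no_iso_idempotents.
Proof.
move=> [n [D [pr [Ddiv _ prJ]]]] e f a b ee ff ef fe ab ba.
apply: jacobson_idempotent => //; apply/prJ => i.
apply/eqP; apply: contraT => pe0.
have [y [yl yr]] := Ddiv i _ pe0.
have pe1 : pr i e = 1 by rewrite -[LHS]mul1r -yl -mulrA -rmorphM ee.
have pa0 : pr i a != 0.
  by apply: contraNneq (oner_neq0 (D i)) => pa0; rewrite -pe1 -ab rmorphM pa0 mul0r.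
have [z [zl zr]] := Ddiv i _ pa0.
have pb : pr i b = z by rewrite -[LHS]mul1r -zl -mulrA -rmorphM ab pe1 mulr1.
have pf1 : pr i f = 1 by rewrite -ba rmorphM pb zl.
have : pr i (e * f) = 1 by rewrite rmorphM pe1 pf1 mul1r.
by rewrite ef rmorph0 => /eqP; rewrite eq_sym oner_eq0.
Qed.

Hypotheses (dccR : dcc R^o) (dccRc : dcc (R^c)^o).
Variables (n : nat) (e : 'I_n -> R).
Hypotheses (e_prim : forall i, primitive (e i)) (e_orth : orthogonal_family e).
Hypotheses (e_sum : \sum_i e i = 1) (e_iso : isolated e).

Let ee i : e i * e i = e i. Proof. by case: (e_prim i). Qed.

(* The maximal ideal K_i such that R / K_i is e_i R e_i modulo its radical. *)
Let K i : set R^o := fun x => forall g : R, e i * g * e i * (x : R) * e i <> e i.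

(** K i consists of the x whose corner e i x e i is a non-unit, which links it to locality. *)
Let unitE i (x : R) : corner_unit (e i) (e i * x * e i) <-> ~ K i x.
Proof.
split=> [[y [[ye ye'] xy yx]] /(_ y)|h].
  by rewrite ye => /(_ _); apply; rewrite -{3}yx -ye' !mulrA.
have [g gE] : exists g, e i * g * e i * x * e i = e i.
  by apply: contrapT => h'; apply: h => g gE; apply: h'; exists g.
apply: (left_inverse_unit dccR dccRc (e_prim i) (w := e i * g)).
  exact: in_corner_sandwich.
by rewrite !mulrA.
Qed.

Let cross i j a b : corner_unit (e i) (e i * a * e j * b * e i) -> i = j.
Proof.
move=> [y [[ye ye'] xy yx]]; apply/eqP; apply: contraT => ij.
case: (e_iso ij (a := a) (b := b * e i * y)).
by rewrite -[RHS]xy -{2}ye' !mulrA.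
Qed.

(** Insert 1 as the sum of the e j between a and b: by locality one term is a unit, and by isolation
    it is the one with j = i. *)
Let split_sum i (a b : R) : corner_unit (e i) (e i * a * b * e i) ->
  corner_unit (e i) (e i * a * e i * b * e i).
Proof.
move=> h.
have := unit_sum dccR dccRc (e_prim i) (r := index_enum _)
  (F := fun j => e i * a * e j * b * e i) _ _ h.
case.
- move=> j; have -> : e i * a * e j * b * e i = e i * (a * e j * b) * e i.
    by rewrite !mulrA.
  exact/in_corner_sandwich/ee.
- have -> : e i * a * b * e i = e i * (a * b) * e i by rewrite !mulrA.
  exact/in_corner_sandwich/ee.
- by rewrite -!mulr_suml -!mulr_sumr e_sum mulr1.
by move=> j hj; move: (hj); rewrite -(cross hj).
Qed.

Lemma basic_ring_of_isolated : basic_ring R.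
Proof.
have KS i : submodule (K i).
  split.
  - by move=> g; rewrite mulr0 mul0r; case: (e_prim i) => _ e0 _ /esym.
  - move=> x y Kx Ky; apply: contrapT => /unitE h.
    have := unit_sum dccR dccRc (e_prim i) (r := [:: true; false])
      (F := fun c : bool => e i * (if c then x else y : R) * e i) _ _ h.
    case.
    + by move=> c; apply: in_corner_sandwich; exact: ee.
    + by apply: in_corner_sandwich; exact: ee.
    + by rewrite !big_cons big_nil addr0 -mulrDl -mulrDr.
    + by case=> /unitE.
  - move=> r x Kx; apply: contrapT => /unitE; rewrite -[e i * _]/(e i * ((r : R) * x)) mulrA.
    move=> /split_sum [y [[ye _] _ yx]]; apply: (Kx (y * e i * r)).
    by rewrite -[RHS]yx !mulrA ye.
have Kr i x r : K i x -> K i (x * r).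
  move=> Kx; apply: contrapT => /unitE; rewrite mulrA => /split_sum[y [[ye ye'] xy _]].
  have : corner_unit (e i) (e i * x * e i).
    apply: (right_inverse_unit dccR dccRc (e_prim i) (w := r * e i * y)).
      by apply: in_corner_sandwich; exact: ee.
    by rewrite -[RHS]xy !mulrA.
  by move/unitE.
have Ke i : ~ K i (e i) by move/(_ 1); apply; rewrite mulr1 !ee.
have K1 i : ~ K i 1.
  by move=> h; apply: (Ke i); rewrite -[e i]mul1r; apply: Kr.
have Kij i j : j != i -> K i (e j).
  move=> ji g; rewrite -mulrA e_orth // mulr0.
  by case: (e_prim i) => _ e0 _ /esym.
have [D DE] := choice (fun i => quotient_ring (KS i) (@Kr i) (K1 i)).
have [pr prE] : exists pr : forall i, {rmorphism R -> D i},
    forall i, surjective_map (pr i) /\ forall x, pr i x = 0 <-> K i x.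
  exists (fun i => projT1 (cid (DE i))) => i; exact: (projT2 (cid (DE i))).
have pr_e i : pr i (e i) = 1.
  rewrite -(rmorph1 (pr i)) -e_sum !rmorph_sum (bigD1 i) //= big1 ?addr0 // => j ji.
  exact/(prE i).2/Kij.
exists n, D, pr; split.
- move=> i x x0; have [r rx] := (prE i).1 x.
  have /unitE[y [_ xy yx]] : ~ K i r.
    by move/(prE i).2 => r0; move: x0; rewrite -rx r0 eqxx.
  exists (pr i y).
  have := congr1 (pr i) xy; have := congr1 (pr i) yx.
  by rewrite !rmorphM pr_e mul1r mulr1 rx.
- move=> y; have /choice[x xE] : forall i, exists x : R, pr i x = y i.
    by move=> i; apply: (prE i).1.
  exists (\sum_i x i * e i) => i.
  rewrite rmorph_sum (bigD1 i) //= big1 => [|j ji].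
    by rewrite rmorphM pr_e mulr1 addr0 xE.
  by rewrite rmorphM; have /(prE i).2 -> := Kij i j ji; rewrite mulr0.
move=> x; split=> [xJ i|xK].
  apply/(prE i).2; apply: xJ; have [h0 hD hZ] := KS i; split.
  - by split=> // a y; apply: hZ.
  - exact: K1.
  - move=> J [J0 JD JZ] J1 KJ; apply/funext => y; apply/propext; split=> [Jy|/KJ//].
    (* An element y of J outside K i has an invertible corner with inverse z. Then 1 - z e i y lies
       in K i, so J contains 1. *)
    apply: contrapT => /unitE[z [_ _ zy]]; apply: J1.
    have -> : 1 = z * (e i * y) + (1 - z * (e i * y)) by rewrite addrC subrK.
    apply: JD; first by apply/JZ/JZ.
    apply/KJ/(prE i).2; rewrite rmorphB rmorph1 -[X in _ - X]mulr1 -{2}(pr_e i).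
    by rewrite -rmorphM -!mulrA mulrA in zy *; rewrite zy pr_e subrr.
move=> I [[I0 ID IZ] I1 Imax]; apply: contrapT => xI.
have IB y z : I y -> I z -> I (y - z).
  by move=> Iy Iz; apply: ID => //; rewrite -mulN1r; apply: IZ.
have [j xj] : exists j, ~ I (x * e j).
  apply: contrapT => h; apply: xI; rewrite -[x]mulr1 -e_sum mulr_sumr.
  by apply: big_ind => // j _; apply: contrapT => hj; apply: h; exists j.
have [i xij] : exists i, ~ I (e i * x * e j).
  apply: contrapT => h; apply: xj; rewrite -[x]mul1r -e_sum !mulr_suml.
  by apply: big_ind => // i _; apply: contrapT => hi; apply: h; exists i.
(* By maximality of I, e j is congruent to a multiple of e i x e j modulo I. Locality then makes one
   part of e j a unit: the multiple, which forces i = j and contradicts x in K j, or the part in I,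
   which puts e i x e j in I. *)
have [r rI] : exists r, I (e j - r * (e i * x * e j)).
  pose J : set R := fun y => exists r z, I z /\ y = z + r * (e i * x * e j).
  have JL : left_ideal J.
    split; first by exists 0, 0; rewrite mul0r addr0.
      move=> _ _ [r [z [Iz ->]]] [s [w [Iw ->]]]; exists (r + s), (z + w).
      by rewrite mulrDl addrACA; split=> //; apply: ID.
    move=> c _ [r [z [Iz ->]]]; exists (c * r), (c * z).
    by rewrite mulrDr mulrA; split=> //; apply: IZ.
  have IJ z : I z -> J z by move=> Iz; exists 0, z; rewrite mul0r addr0.
  have [|nJ1] := pselect (J 1).
    move=> [r [z [Iz e1]]]; exists (e j * r).
    have -> : e j - e j * r * (e i * x * e j) = e j * z; last exact: IZ.
    by rewrite -[e j in X in X - _]mulr1 {1}e1 mulrDr mulrA addrK.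
  have JI := Imax J JL nJ1 IJ; case: xij.
  by rewrite -JI; exists 1, 0; rewrite add0r mul1r.
have hj : I (e j - e j * r * e i * x * e j).
  have := IZ (e j) _ rI.
  by rewrite mulrBr ee !mulrA.
have := unit_sum dccR dccRc (e_prim j) (r := [:: true; false])
  (F := fun c : bool => if c then e j * r * e i * x * e j
        else e j - e j * r * e i * x * e j) (x := e j).
have cj : in_corner (e j) (e j) by split; apply: ee.
have cx : in_corner (e j) (e j * r * e i * x * e j).
  have -> : e j * r * e i * x * e j = e j * (r * e i * x) * e j by rewrite !mulrA.
  by apply: in_corner_sandwich; apply: ee.
case.
- by case=> //; apply: in_cornerB.
- by [].
- by exists (e j); rewrite ee.
- by rewrite !big_cons big_nil addr0 addrC subrK.
case=> h.
  have ij := cross h; move: h; rewrite -ij => h.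
  have : K j x by apply/(prE j).2.
  case: h => y [[ye _] _ yx] /(_ (y * e j * r)); apply.
  by rewrite -[RHS]yx !mulrA ye.
case: h => y [_ _ yx]; case: xij.
have -> : e i * x * e j = e i * x * y * (e j - e j * r * e i * x * e j).
  by move: yx => /= yx; rewrite -[RHS]mulrA yx.
exact: IZ.
Qed.

End BasicRings.

(** * Krull-Schmidt uniqueness *)

Lemma no_iso_idempotents_op (R : pzRingType) :
  no_iso_idempotents R -> no_iso_idempotents R^c.
Proof.
move=> h e f a b ee ff ef fe ab ba.
exact: (h e f b a ee ff fe ef ab ba).
Qed.

Lemma no_iso_idempotents_iso (R S : pzRingType) (g : {rmorphism R -> S}) :
  bijective g -> no_iso_idempotents S -> no_iso_idempotents R.
Proof.
move=> gB h e f a b ee ff ef fe ab ba; apply: (bij_inj gB); rewrite rmorph0.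
apply: (h (g e) (g f) (g a) (g b)); rewrite -rmorphM ?ee ?ff ?ef ?fe ?ab ?ba //;
  exact: rmorph0.
Qed.

Section ModuleIdempotents.
Variable R : pzRingType.
Implicit Types M N P X : lmodType R.

(** A summand X * X of M yields orthogonal idempotents of End(M), interchanged by the swap of the
    two copies. *)
Lemma basic_module_of_idempotents M : no_iso_idempotents (endo M) -> basic_module M.
Proof.
move=> hM X [X0 _] [i [p iK]]; apply: X0 => x.
have [j1 [_ [_ j1E _]]] := ses_inl X X.
have [j2 j2E] := @pair_linear R X X X \0 idfun.
pose q1 : {linear (X * X)%type -> X} := fst.
pose q2 : {linear (X * X)%type -> X} := snd.
pose e : endo M := i \o (j1 \o (q1 \o p)).
pose f : endo M := i \o (j2 \o (q2 \o p)).
pose a : endo M := i \o (j1 \o (q2 \o p)).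
pose b : endo M := i \o (j2 \o (q1 \o p)).
have e0 : e = 0.
  by apply: (hM e f a b); apply: endoP => m; rewrite /= !iK ?j1E ?j2E //= !linear0.
have : p (e (i (j1 x))) = 0 by rewrite e0 linear0.
by rewrite /= !iK !j1E /= => -[].
Qed.

Lemma primitive_image P (e : endo P) : primitive e -> exists (X : lmodType R)
  (i : {linear X -> P}) (p : {linear P -> X}),
  [/\ cancel i p, forall x, i (p x) = e x & indecomposable X].
Proof.
move=> [ee e0 eP]; have eE x : e (e x) = e x by rewrite -[LHS]/((e * e) x) ee.
have [X [i [iI iE]]] := submodule_type (image_submodule e).
have [p pE] : exists p : {linear P -> X}, forall x, i (p x) = e x.
  by apply: (@factor_inj _ _ _ _ i e iI) => x; apply/iE; exists x.
have iK : cancel i p.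
  move=> x; apply: iI; rewrite pE.
  by have /iE[y <-] : exists k, i k = i x by exists x.
exists X, i, p; split=> //; split=> [X0|U V /mod_isoP[u [v [uK vK]]]].
  by apply: e0; apply: endoP => x; rewrite -pE [p x]X0 linear0.
have [j [_ [_ jE _]]] := ses_inl U V.
pose q : {linear (U * V)%type -> U} := fst.
pose h : endo P := i \o (v \o (j \o (q \o (u \o p)))).
have hE x : h x = i (v ((u (p x)).1, 0)) by rewrite /= jE.
have [|||h0|he] := eP h.
- by apply: endoP => x; rewrite -[LHS]/(h (h x)) !hE iK vK.
- by apply: endoP => x; rewrite -[LHS]/(e (h x)) hE -pE iK.
- by apply: endoP => x; rewrite -[LHS]/(h (e x)) !hE -pE iK.
- left=> w; have := hE (i (v (w, 0))); rewrite h0 iK vK /= => /esym h1.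
  have : u (p (i (v (w, 0)))) = 0 by rewrite h1 !linear0.
  by rewrite iK vK => -[].
- right=> w; have := hE (i (v (0, w))); rewrite he -pE !iK vK /=.
  by move=> /iI/(can_inj vK) -[].
Qed.

(** If e factored through f, its image X would embed in P twice, by i and by f b i, with retraction
    (p, p a f). P may be larger than M so that the lemma also applies inside M * N. *)
Lemma isolated_of_basic M P (r : {linear M -> P}) (s : {linear P -> M}) (e f : endo P) :
  basic_module M -> cancel r s -> primitive e -> e * f = 0 -> f * e = 0 -> f * f = f ->
  (forall x, r (s (e x)) = e x) -> (forall x, r (s (f x)) = f x) ->
  forall a b, e * a * f * b * e <> e.
Proof.
move=> hM rK eprim ef fe ff re rf a b abE.
have [X [i [p [iK pE Xind]]]] := primitive_image eprim.
have eM (x y z : endo P) t : (x * y) t = x (y t) by [].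
have ei x : e (i x) = i x by rewrite -pE iK.
have [u uE] := sum_linear i (f \o (b \o i)).
have [v vE] := pair_linear p (p \o (a \o f)).
have ii : injective i := can_inj iK.
have uK : cancel u v.
  move=> [x y]; rewrite vE uE /=; congr (_, _); apply: ii; rewrite pE linearD.
    rewrite -[e (f _)]/((e * f) _) ef addr0; exact: ei.
  rewrite -[f (f _)]/((f * f) _) ff -(ei x) -[f (e _)]/((f * e) _) fe add0r.
  by rewrite -{2}(ei y) -[in RHS]abE /= !ei.
apply: (hM X Xind); exists (s \o u), (v \o r) => z /=.
have -> : r (s (u z)) = u z; last exact: uK.
rewrite uE /= -[i z.1]ei; set y := f _.
have <- : f y = y by rewrite -[f y]/((f * f) _) ff.
by rewrite !linearD re rf.
Qed.

End ModuleIdempotents.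

Section KrullSchmidt.
Variables (k : comPzRingType) (A : kalg k).
Hypothesis A_artin : artin_algebra A.
Implicit Types M N P : lmodType A.

Lemma endo_dcc M : finitely_generated M -> dcc (endo M)^o.
Proof. by move=> Mfg; apply: (artin_dcc (artin_endo A_artin Mfg)). Qed.

Lemma endo_dcc_op M : finitely_generated M -> dcc ((endo M)^c)^o.
Proof. by move=> Mfg; apply: (artin_dcc (artin_op (artin_endo A_artin Mfg))). Qed.

(** Isolation and orthogonality are symmetric under reversing products, so one family of idempotents
    serves both the ring and its opposite. *)
Lemma basic_endo M : finitely_generated M -> basic_module M ->
  basic_ring (endo M) /\ basic_ring (endo M)^c.
Proof.
move=> Mfg Mbasic; have d := endo_dcc Mfg; have d' := endo_dcc_op Mfg.
have d'' : dcc (((endo M)^c)^c)^o.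
  move=> S SS dec; apply: d => // n; have [h0 hD hZ] := SS n; split.
have [|n [e [ep eo _ es]]] := @primitive_decomposition (endo M) d 1; first exact: mulr1.
have iso : isolated e.
  move=> i j ij a b.
  have ji : j != i by rewrite eq_sym.
  have [ff _ _] := ep j.
  by apply: (@isolated_of_basic _ M M idfun idfun (e i) (e j)) => //; apply: eo.
split; first exact: basic_ring_of_isolated d d' _ e ep eo es iso.
apply: (@basic_ring_of_isolated (endo M)^c d' d'' n e).
- move=> i; have [h1 h2 h3] := ep i; split=> // f h4 h5 h6; exact: h3.
- by move=> i j; rewrite eq_sym => /eo.
- exact: es.
- move=> i j ij a b h; apply: (iso i j ij b a).
  by rewrite -!mulrA; exact: h.
Qed.

(* The comparison takes place in the endomorphism ring of M (+) N. *)
Lemma basic_add_unique M N : finitely_generated M -> finitely_generated N ->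
  basic_module M -> basic_module N -> in_add M N -> in_add N M -> mod_iso M N.
Proof.
move=> Mfg Nfg Mb Nb NM MN.
pose P : lmodType A := (M * N)%type.
have [r1 [q1 [rs1 r1E _]]] := ses_inl M N.
have Pfg : finitely_generated P by apply: fg_ext rs1 Mfg Nfg.
have [r2 r2E] := @pair_linear A M N N \0 idfun.
pose s1 : {linear P -> M} := fst; pose s2 : {linear P -> N} := snd.
have d := endo_dcc Pfg; have d' := endo_dcc_op Pfg.
pose E1 : endo P := r1 \o s1; pose E2 : endo P := r2 \o s2.
have r1K : cancel r1 s1 by move=> x; rewrite r1E.
have r2K : cancel r2 s2 by move=> x; rewrite r2E.
have E1E1 : is_idempotent E1 by apply: endoP => x; rewrite /= r1K.
have E2E2 : is_idempotent E2 by apply: endoP => x; rewrite /= r2K.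
have [n [e [ep eo ec es]]] := primitive_decomposition d E1E1.
have [m [f [fp fo fc fs]]] := primitive_decomposition d E2E2.
have e_iso : isolated e.
  move=> i j ij; have ji : j != i by rewrite eq_sym.
  have [ff _ _] := ep j; have [e1 _] := ec i; have [e2 _] := ec j.
  apply: (@isolated_of_basic _ M P r1 s1 (e i) (e j)) => //; try exact: eo.
    by move=> x; rewrite -{2}e1.
  by move=> x; rewrite -{2}e2.
have f_iso : isolated f.
  move=> i j ij; have ji : j != i by rewrite eq_sym.
  have [ff _ _] := fp j; have [e1 _] := fc i; have [e2 _] := fc j.
  apply: (@isolated_of_basic _ N P r2 s2 (f i) (f j)) => //; try exact: fo.
    by move=> x; rewrite -{2}e1.
  by move=> x; rewrite -{2}e2.
(* X in add(Y) means that the idempotent of X is a finite sum of maps factoring through the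
   idempotent of Y. *)
have expand (X Y : lmodType A) (r : {linear X -> P}) (s : {linear P -> X})
    (r' : {linear Y -> P}) (s' : {linear P -> Y}) : cancel r' s' -> in_add Y X ->
    exists l (a b : 'I_l -> endo P), forall x, r (s x) = \sum_t (a t * (r' \o s' : endo P) * b t) x.
  move=> rK [l [u [v uK]]].
  have pj := fun t : 'I_l => ffun_proj_inj Y t.
  have [j jE] := choice pj; have [q qE] := choice jE.
  exists l, (fun t => r \o (v \o (j t \o s')) : endo P), (fun t => r' \o (q t \o (u \o s)) : endo P).
  move=> x; rewrite /= -{1}[s x]uK {1}(ffun_sum (u (s x))) !linear_sum.
  apply: eq_bigr => t _ /=; rewrite !rK.
  by have [h1 h2 _] := qE t; rewrite h2 h1.
have endo_sum (I : Type) (z : seq I) (F : I -> endo P) x :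
    (\sum_(i <- z) F i) x = \sum_(i <- z) F i x.
  by elim/big_rec2: _ => // i y g _ <-.
(* Locality at g1 i selects a unit among the terms of its expansion through the g2 j. That term
   factors through one g2 j, and primitivity of g2 j turns the factorization into an isomorphism. *)
have match_ l1 l2 (g1 : 'I_l1 -> endo P) (g2 : 'I_l2 -> endo P) (G1 G2 : endo P) :
    (forall i, primitive (g1 i)) -> (forall i, primitive (g2 i)) ->
    (forall i, in_corner G1 (g1 i)) -> \sum_i g2 i = G2 ->
    (exists l (a b : 'I_l -> endo P), forall x, G1 x = \sum_t (a t * G2 * b t) x) ->
    forall i, exists j, exists ab : endo P * endo P,
      [/\ ab.2 * ab.1 = g1 i, ab.1 * ab.2 = g2 j, g2 j * ab.1 * g1 i = ab.1
        & g1 i * ab.2 * g2 j = ab.2].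
  move=> p1 p2 c1 s2E [l [a [b abE]]] i.
  have [gg _ _] := p1 i; have [c1i c1i'] := c1 i.
  have := @unit_sum _ d d' _ (p1 i) _ (index_enum ('I_l * 'I_l2)%type)
    (fun tj => g1 i * (a tj.1 * g2 tj.2 * b tj.1) * g1 i) (g1 i).
  case.
  - by move=> tj; apply: in_corner_sandwich.
  - by split.
  - by exists (g1 i); split.
  - rewrite -(pair_bigA _ (fun t j => g1 i * (a t * g2 j * b t) * g1 i)) /=.
    transitivity (\sum_t g1 i * (a t * G2 * b t) * g1 i).
      apply: eq_bigr => t _.
      by rewrite -s2E mulr_sumr mulr_suml mulr_sumr mulr_suml.
    rewrite -mulr_suml -mulr_sumr.
    have -> : \sum_t a t * G2 * b t = G1 by apply: endoP => x; rewrite abE endo_sum.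
    by rewrite c1i' gg.
  move=> [t j] /= [w [[w1 w2] _ wx]].
  have [hh _ hP] := p2 j.
  pose u := g2 j * b t * g1 i; pose v := w * g1 i * a t * g2 j.
  have vu : v * u = g1 i.
    by rewrite -[RHS]wx /u /v !mulrA -[_ * g2 j * g2 j]mulrA hh.
  have u1 : g2 j * u = u by rewrite /u !mulrA hh.
  have u2 : u * g1 i = u by rewrite /u -!mulrA gg.
  have v1 : g1 i * v = v by rewrite /v !mulrA w1.
  have v2 : v * g2 j = v by rewrite /v -!mulrA hh.
  exists j, (u, v) => /=; split=> //; last 2 first.
  - by rewrite u1 u2.
  - by rewrite v1 v2.
  case: (hP (u * v)) => //.
  - by rewrite /is_idempotent mulrA -[u * v * u]mulrA vu u2.
  - by rewrite mulrA u1.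
  - by rewrite -mulrA v2.
  - move=> z0; have [_ g0 _] := p1 i; case: g0.
    by rewrite -gg -{1}vu -vu mulrA -[v * u * v]mulrA z0 mulr0 mul0r.
have h12 := match_ n m e f E1 E2 ep fp ec fs (expand M N r1 s1 r2 s2 r2K MN).
have h21 := match_ m n f e E2 E1 fp ep fc es (expand N M r2 s2 r1 s1 r1K NM).
have [sig /choice[ab abE]] := choice h12.
have [tau /choice[cd cdE]] := choice h21.
have [ee_ ff_] : (forall i, e i * e i = e i) /\ (forall j, f j * f j = f j).
  by split=> i; [case: (ep i)|case: (fp i)].
(* If p and q are both isomorphic to the same idempotent, p factors through q. Isolation then shows
   that the matching [sig] is a bijection. *)
have link (p q u v u' v' : endo P) : p * p = p -> p * v = v -> u * p = u ->
    v * u = p -> u' * q = u' -> u' * v' = u * v -> p * (v * u') * q * (v' * u) * p = p.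
  move=> pp pv up vu u'q uv; rewrite !mulrA pv -[v * u' * q]mulrA u'q.
  by rewrite -[_ * u * p]mulrA up -[v * u' * v']mulrA uv mulrA vu -mulrA vu.
have sig_inj : injective sig.
  move=> i i' ii'; apply/eqP; apply: contraT => ne.
  have [h1 h2 h3 h4] := abE i; have [h5 h6 h7 h8] := abE i'.
  case: (e_iso i i' ne ((ab i).2 * (ab i').1) ((ab i').2 * (ab i).1)).
  apply: link => //.
  - by rewrite -h4 !mulrA ee_.
  - by rewrite -h3 -!mulrA ee_.
  - by rewrite -h7 -!mulrA ee_.
  - by rewrite h2 ii' h6.
have sig_tau j : sig (tau j) = j.
  apply/eqP; apply: contraT => ne.
  have [h1 h2 h3 h4] := cdE j; have [h5 h6 h7 h8] := abE (tau j).
  have ne' : j != sig (tau j) by rewrite eq_sym.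
  case: (f_iso _ _ ne' ((cd j).2 * (ab (tau j)).2) ((ab (tau j)).1 * (cd j).1)).
  apply: link => //.
  - by rewrite -h4 !mulrA ff_.
  - by rewrite -h3 -!mulrA ff_.
  - by rewrite -h8 -!mulrA ff_.
  - by rewrite h2 h5.
(* The matched isomorphisms are summed; orthogonality kills the mixed products, so F and G are
   inverse between the images of E1 and E2. *)
pose F : endo P := \sum_i (ab i).1; pose G : endo P := \sum_i (ab i).2.
have GF : G * F = E1.
  rewrite -es mulr_suml; apply: eq_bigr => i _.
  have [h1 h2 h3 h4] := abE i.
  rewrite mulr_sumr (bigD1 i) //= big1 => [|i' ne]; first by rewrite h1 addr0.
  have [h5 h6 h7 h8] := abE i'.
  rewrite -h4 -h7 !mulrA -[_ * f (sig i) * f (sig i')]mulrA fo; first by rewrite mulr0 !mul0r.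
  by apply: contraNneq ne => /sig_inj ->.
have FG : F * G = E2.
  rewrite -fs (reindex sig) /=; last first.
    by exists tau => i _; [apply: sig_inj; rewrite sig_tau|apply: sig_tau].
  rewrite mulr_suml; apply: eq_bigr => i _.
  have [h1 h2 h3 h4] := abE i.
  rewrite mulr_sumr (bigD1 i) //= big1 => [|i' ne]; first by rewrite h2 addr0.
  have [h5 h6 h7 h8] := abE i'.
  rewrite -h3 -h8 !mulrA -[_ * e i * e i']mulrA eo; first by rewrite mulr0 !mul0r.
  by rewrite eq_sym.
have FE1 : F * E1 = F.
  rewrite mulr_suml; apply: eq_bigr => i _; have [_ _ h3 _] := abE i.
  by have [_ h] := ec i; rewrite -h3 -mulrA h.
have GE2 : G * E2 = G.
  rewrite mulr_suml; apply: eq_bigr => i _; have [_ _ _ h4] := abE i.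
  by have [_ h] := fc (sig i); rewrite -h4 -mulrA h.
exists (s2 \o (F \o r1)), (s1 \o (G \o r2)) => x /=.
  rewrite -[r2 _]/(E2 _) -[G (E2 _)]/((G * E2) _) GE2 -[G (F _)]/((G * F) _) GF.
  by rewrite /= !r1K.
rewrite -[r1 _]/(E1 _) -[F (E1 _)]/((F * E1) _) FE1 -[F (G _)]/((F * G) _) FG.
by rewrite /= !r2K.
Qed.

End KrullSchmidt.

(** * Endomorphism algebras of strong tilting modules *)

Lemma make_rmorphism (R S : pzRingType) (f : R -> S) :
  (forall x y, f (x - y) = f x - f y) -> f 1 = 1 ->
  (forall x y, f (x * y) = f x * f y) -> exists g : {rmorphism R -> S}, g =1 f.
Proof.
move=> fB f1 fM.
have fm : monoid_morphism f by split.
by exists (HB.pack_for {rmorphism R -> S} f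
  (GRing.isZmodMorphism.Build R S f fB) (GRing.isMonoidMorphism.Build R S f fm)).
Qed.

Lemma rmorphism_inverse (R S : pzRingType) (f : {rmorphism R -> S}) : bijective f ->
  exists g : {rmorphism S -> R}, cancel f g /\ cancel g f.
Proof.
move=> [g fK gK]; have gI := can_inj fK.
have [|||h hE] := @make_rmorphism S R g.
- by move=> x y; apply: gI; rewrite rmorphB !gK.
- by apply: gI; rewrite gK rmorph1.
- by move=> x y; apply: gI; rewrite rmorphM !gK.
by exists h; split=> x; rewrite hE.
Qed.

Lemma full_endo_iso (A R : pzRingType) (b : bimodule A R) : full_endo b ->
  exists f : {rmorphism R -> endo (bL b)}, bijective f /\
    forall r t, f r t = bht b (r *: bth t).
Proof.
move=> [ann full].
have hlin r : exists f : {linear bL b -> bL b}, forall t, f t = bht b (r *: bth t).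
  by apply: linear_ext => a x y; rewrite bthD scalerDr bhtD -bcomm bthK.
have [f fE] := choice hlin.
have bhtB x y : bht b (x - y) = bht b x - bht b y.
  by apply: (can_inj (@bthK _ _ b)); rewrite bthD bthN !bhtK.
have [|||g gE] := @make_rmorphism R (endo (bL b)) f.
- by move=> x y; apply: endoP => t; rewrite /= !fE scalerBl bhtB.
- by apply: endoP => t; rewrite fE scale1r bthK.
- by move=> x y; apply: endoP => t; rewrite /= !fE bhtK scalerA.
exists g; split=> [|r t]; last by rewrite gE fE.
have gI : injective g.
  move=> x y e; apply/subr0_eq/ann => t.
  have := congr1 (fun h : endo (bL b) => h (bht b t)) e; rewrite !gE !fE bhtK.
  by move=> /(can_inj (@bhtK _ _ b)) h; rewrite scalerBl h subrr.
have [h hE] := choice full; exists h => x.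
  apply/subr0_eq/ann => t.
  have := hE (g x) (bht b t); rewrite gE fE !bhtK => h1.
  by rewrite scalerBl h1 subrr.
by apply: endoP => t; rewrite gE fE -hE bthK.
Qed.

Section EndoBimodule.
Variables (A : pzRingType) (T : lmodType A).

Fact endo_bthD : {morph (id : T -> endo_lmod T) : x y / x + y}.
Proof. by []. Qed.
Fact endo_bcomm (a : A) (r : endo T) (t : T) :
  (a *: (r *: (t : endo_lmod T) : T) : endo_lmod T) = r *: (a *: t : endo_lmod T).
Proof. exact: esym (linZ (r : {linear T -> T}) a t). Qed.

Definition endo_bimodule : bimodule A (endo T) :=
  @Bimodule A (endo T) T (endo_lmod T) id id (frefl _) (frefl _) endo_bthD endo_bcomm.

Lemma endo_bimodule_full : full_endo endo_bimodule.
Proof. by split=> [r h|phi]; [apply: endoP|exists phi]. Qed.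

Fact endo_rev_bcomm (a : A) (r : (endo T)^c^c) (t : T) :
  (a *: (r *: (t : endo_rmod T) : T) : endo_rmod T) = r *: (a *: t : endo_rmod T).
Proof. exact: esym (linZ (r : {linear T -> T}) a t). Qed.

(** Right modules over [tilt_alg T] are left modules over the doubly opposite ring of End(T), hence
    this second form of the bimodule. *)
Definition endo_rbimodule : bimodule A (endo T)^c^c :=
  @Bimodule A (endo T)^c^c T (endo_rmod T) id id (frefl _) (frefl _)
    (fun _ _ => erefl) endo_rev_bcomm.

Lemma endo_rbimodule_full : full_endo endo_rbimodule.
Proof.
by split=> [r h|phi]; [apply: (@endoP _ _ (r : endo T) 0)|exists (phi : endo T)].
Qed.

End EndoBimodule.

Section AlgebraIsos.
Variable k : comPzRingType.
Implicit Types A B C : kalg k.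

Lemma alg_iso_refl A : alg_iso A A.
Proof. by exists idfun; split=> //; exists id. Qed.

Lemma alg_iso_sym A B : alg_iso A B -> alg_iso B A.
Proof.
move=> [f [fB fk]]; have [g [fK gK]] := rmorphism_inverse fB.
by exists g; split=> [|c]; [exists f|rewrite -fk fK].
Qed.

Lemma alg_iso_trans A B C : alg_iso A B -> alg_iso B C -> alg_iso A C.
Proof.
move=> [f [fB fk]] [g [gB gk]]; exists (g \o f); split; first exact: bij_comp.
by move=> c; rewrite /= fk gk.
Qed.

Lemma alg_iso_op A B : alg_iso A B -> alg_iso (op_alg A) (op_alg B).
Proof.
move=> [f [fB fk]].
have [|||g gE] := @make_rmorphism (op_alg A) (op_alg B) (f : A -> B).
- exact: (rmorphB f).
- exact: (rmorph1 f).
- by move=> x y; exact: (rmorphM f y x).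
exists g; split=> [|c]; last by rewrite gE; exact: fk.
by apply: (eq_bij fB) => x; rewrite gE.
Qed.

Lemma alg_iso_opK A : alg_iso (op_alg (op_alg A)) A.
Proof.
have [|||g gE] := @make_rmorphism (op_alg (op_alg A)) A id => //.
by exists g; split=> [|c]; [exists id => x; rewrite gE|rewrite gE].
Qed.

Lemma alg_iso_endo A (M N : lmodType A) : mod_iso M N ->
  alg_iso (endo_alg M) (endo_alg N).
Proof.
move=> /mod_isoP[u [v [uK vK]]].
have [|||f fE] := @make_rmorphism (endo_alg M) (endo_alg N)
  (fun h : endo M => u \o (h \o v) : endo N).
- by move=> g h; apply: endoP => x; rewrite /= linearB.
- by apply: endoP => x; rewrite /= vK.
- by move=> g h; apply: endoP => x; rewrite /= uK.
exists f; split.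
  exists (fun h : endo N => v \o (h \o u) : endo M) => h; rewrite ?fE.
    by apply: endoP => x; rewrite /= !uK.
  by apply: endoP => x; rewrite /= !vK.
by move=> c; rewrite fE; apply: endoP => x; rewrite /= /homothety linZ vK.
Qed.

Lemma alg_iso_twist A B (f : {rmorphism A -> B}) (M : lmodType B) : bijective f ->
  (forall c, f (kalg_map A c) = kalg_map B c) ->
  alg_iso (endo_alg (twist f M)) (endo_alg M).
Proof.
move=> fB fk; have [g [fK gK]] := rmorphism_inverse fB.
have hlin (h : endo (twist f M)) : exists h' : {linear M -> M}, forall x, h' x = h x.
  apply: linear_ext => a x y.
  by have := linearP h (g a) x y; rewrite !twistE gK.
have [F FE] := choice hlin.
have [|||G GE] := @make_rmorphism (endo_alg (twist f M)) (endo_alg M) F.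
- by move=> u v; apply: endoP => x; rewrite /= !FE.
- by apply: endoP => x; rewrite /= !FE.
- by move=> u v; apply: endoP => x; rewrite /= !FE.
have klin (h : endo M) : exists h' : {linear twist f M -> twist f M}, forall x, h' x = h x.
  exact: twist_linear.
have [K KE] := choice klin.
exists G; split.
  exists K => h; last by rewrite GE; apply: endoP => x; rewrite FE KE.
  by apply: (@endoP _ _ (K (G h)) h) => x; rewrite KE GE FE.
by move=> c; rewrite GE; apply: endoP => x; rewrite FE /= /homothety twistE fk.
Qed.

Lemma double_centralizer A B (b : bimodule A B) : full_endo (flip b) ->
  (forall c (t : bL b), bth (kalg_map A c *: t) = kalg_map B c *: bth t) ->
  alg_iso A (endo_alg (bR b)).
Proof.
move=> /full_endo_iso[f [fB fE]] bk; exists f; split=> // c.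
apply: endoP => t; rewrite fE /= /homothety.
exact: etrans (bk c _) (congr1 _ (@bhtK _ _ b t)).
Qed.

End AlgebraIsos.

(** * Basic strong tilting modules: uniqueness and transport *)

Section StrongBasic.
Variable k : comPzRingType.
Implicit Types A B C : kalg k.

Definition basic_strong A (T : lmodType A) := basic_module T /\ strong_tilting T.

Lemma strong_fg A (T : lmodType A) : strong_tilting T -> finitely_generated T.
Proof. by move=> [[[]]]. Qed.

Lemma noetherian_endo A (T : lmodType A) : artin_algebra A -> finitely_generated T ->
  noetherian (endo T).
Proof. by move=> hA Tfg; apply: (artin_noetherian (artin_endo hA Tfg)). Qed.

Lemma basic_strong_unique A (T T1 : lmodType A) : artin_algebra A ->
  basic_strong T -> basic_strong T1 -> mod_iso T T1.
Proof.
move=> hA [Tb Ts] [Tb1 Ts1].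
have add (U V : lmodType A) : strong_tilting U -> strong_tilting V -> in_add U V.
  move=> Us Vs; apply: (strong_in_add (b := endo_bimodule U)) => //.
  - exact: artin_noetherian.
  - exact: noetherian_endo (strong_fg Us).
  - exact: endo_bimodule_full.
by apply: (basic_add_unique hA) => //; try exact: strong_fg; apply: add.
Qed.

Lemma basic_strong_transfer A B (f : {rmorphism A -> B}) (T : lmodType B) :
  bijective f -> basic_strong T -> basic_strong (twist f T).
Proof.
move=> /rmorphism_inverse[g [fK gK]] [Tb Ts]; split; first exact: twist_basic Tb.
exact: twist_strong_tilting Ts.
Qed.

Lemma tilt_unique A B (T : lmodType A) (T1 : lmodType B) : artin_algebra A ->
  alg_iso A B -> basic_strong T -> basic_strong T1 ->
  alg_iso (endo_alg T) (endo_alg T1).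
Proof.
move=> hA [f [fB fk]] hT hT1.
apply: alg_iso_trans (alg_iso_twist T1 fB fk).
exact/alg_iso_endo/(basic_strong_unique hA hT)/basic_strong_transfer.
Qed.

Lemma strong_endo_of_full (A R : pzRingType) (b : bimodule A R) : full_endo b ->
  strong_tilting (bR b) -> strong_tilting (endo_lmod (bL b) : lmodType (endo (bL b))).
Proof.
move=> /full_endo_iso[f [fB fE]] hs; have [g [fK gK]] := rmorphism_inverse fB.
apply: strong_tilting_iso (twist_strong_tilting gK fK hs).
have [|h hE] := @linear_ext (endo (bL b)) (twist g (bR b)) (endo_lmod (bL b)) (bht b).
  move=> a x y; rewrite twistE bhtD; congr (_ + _).
  by rewrite -{2}[a]gK -[RHS]/(f (g a) (bht b x)) fE bhtK.
by exists h, (@bth _ _ b) => x; rewrite hE ?bhtK ?bthK.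
Qed.

(** Conjugation by the isomorphism of T with the twisted W identifies the two endomorphism rings,
    and that isomorphism becomes linear over them. *)
Lemma strong_endo_rmod (A C : pzRingType) (f : {rmorphism A -> C}) (T : lmodType A)
    (W : lmodType C) : bijective f -> mod_iso T (twist f W) ->
  strong_tilting (endo_lmod W : lmodType (endo W)) ->
  strong_tilting (endo_rmod T : lmodType (endo T)^c^c).
Proof.
move=> /rmorphism_inverse[g [fK gK]] /mod_isoP[u [v [uK vK]]] hs.
have klin (h : endo T) : exists h' : {linear W -> W}, forall x, h' x = u (h (v x)).
  apply: linear_ext => a x y.
  by have := linearP (u \o (h \o v)) (g a) x y; rewrite /= !twistE gK.
have hlin (h : endo W) : exists h' : {linear T -> T}, forall x, h' x = v (h (u x)).
  apply: linear_ext => a x y.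
  have -> : h (u (a *: x + y)) = a *: (h (u x) : twist f W) + h (u y).
    by rewrite (linearP u) twistE [LHS](linearP h).
  exact: linearP v _ _ _.
have [F FE] := choice klin; have [G GE] := choice hlin.
have [|||F' FE'] := @make_rmorphism (endo T)^c^c (endo W) F.
- by move=> x y; apply: endoP => w; rewrite /= !FE; exact: (linearB u).
- by apply: endoP => w; rewrite FE; exact: vK.
- by move=> x y; apply: endoP => w; rewrite [RHS]/= !FE uK.
have [g' [gK1 gK2]] : exists g' : {rmorphism endo W -> (endo T)^c^c},
    cancel F' g' /\ cancel g' F'.
  apply: rmorphism_inverse; exists G => h.
    by apply: (@endoP _ T (G (F' h)) h) => x; rewrite GE FE' FE !uK.
  by apply: endoP => w; rewrite FE' FE GE !vK.
apply: strong_tilting_iso (twist_strong_tilting gK1 gK2 hs).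
have [|w wE] := @linear_ext (endo T)^c^c (twist F' (endo_lmod W)) (endo_rmod T) v.
  move=> a x y; rewrite twistE.
  rewrite [LHS](linearD v); congr (_ + _).
  by rewrite FE' -[LHS]/(v (F a x)) FE uK.
by exists w, u => x; rewrite wE ?uK ?vK.
Qed.

End StrongBasic.

(** * Iterated strong tilting *)

Section Main.
Variables (k : comPzRingType) (Lambda : kalg k).
Hypotheses (Lambda_artin : artin_algebra Lambda) (Lambda_basic : basic_ring Lambda).
Variable T : lmodType Lambda.
Hypotheses (T_basic : basic_module T) (T_strong : strong_tilting T).
Variable T' : rmodType (tilt_alg T).
Hypotheses (T'_basic : basic_module T') (T'_strong : strong_tilting T').

Local Notation B := (tilt_alg T).
Local Notation C := (endo_alg T').

Let T_fg : finitely_generated T := strong_fg T_strong.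
Let T'_fg : finitely_generated T' := strong_fg T'_strong.

Lemma tilt_alg_artin : artin_algebra B.
Proof. exact: (artin_op (artin_endo Lambda_artin T_fg)). Qed.

Lemma tilt_alg_op_artin : artin_algebra (op_alg B).
Proof. exact: artin_op tilt_alg_artin. Qed.

Lemma tilt_alg_basic : basic_ring B.
Proof. by have [_] := basic_endo Lambda_artin T_fg T_basic. Qed.

Let tilt_alg_op_noetherian : noetherian (op_alg B).
Proof. exact: artin_noetherian tilt_alg_op_artin. Qed.

Let endo_T'_noetherian : noetherian (endo T').
Proof. exact: noetherian_endo tilt_alg_op_artin T'_fg. Qed.

Let T_flip : tilting (endo_rmod T : rmodType B) /\ full_endo (flip (endo_rbimodule T)).
Proof.
apply: (tilting_flip (b := endo_rbimodule T) (artin_noetherian Lambda_artin)) T_strong.1.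
exact: endo_rbimodule_full.
Qed.

Let T'_flip : tilting (endo_lmod T' : lmodType C) /\ full_endo (flip (endo_bimodule T')).
Proof.
apply: (tilting_flip (b := endo_bimodule T') tilt_alg_op_noetherian) T'_strong.1.
exact: endo_bimodule_full.
Qed.

Lemma endo_T'_strong : strong_tilting (endo_lmod T' : lmodType C).
Proof.
apply: (strong_flip (b := endo_bimodule T')) => //; first exact: endo_bimodule_full.
apply: (@torsionless_hom_detects _ _ (endo_bimodule T') (endo_rmod T : rmodType B)).
  apply: (strong_hom_detects (b := endo_rbimodule T)) => //.
  - exact: artin_noetherian.
  - exact: endo_rbimodule_full.
have [/tiltingP[Tfin _ _] _] := T_flip.
have /strong_tiltingP[_ _ Tstr] := T'_strong.
by have [] := fin_pd_reflexive tilt_alg_op_noetherian endo_T'_noetherian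
  (endo_bimodule_full T') T'_strong.1 Tfin (Tstr _ Tfin).
Qed.

Lemma Lambda_double_centralizer :
  alg_iso Lambda (endo_alg (endo_rmod T : rmodType B)).
Proof. exact: (double_centralizer (b := endo_rbimodule T : bimodule Lambda (op_alg B)) T_flip.2). Qed.

Lemma tilt_alg_double_centralizer :
  alg_iso (op_alg B) (endo_alg (endo_lmod T' : lmodType C)).
Proof. exact: (double_centralizer (b := endo_bimodule T' : bimodule (op_alg B) C) T'_flip.2). Qed.

(** Multiplicities are visible in the endomorphism ring, which is the basic ring Lambda by the
    double centralizer property. *)
Lemma endo_rmod_basic : basic_module (endo_rmod T : rmodType B).
Proof.
apply: basic_module_of_idempotents.
have [f [fB _]] := alg_iso_sym Lambda_double_centralizer.
exact: no_iso_idempotents_iso fB (basic_ring_idempotents Lambda_basic).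
Qed.

Lemma endo_T'_basic : basic_module (endo_lmod T' : lmodType C).
Proof.
apply: basic_module_of_idempotents.
have [f [fB _]] := alg_iso_sym tilt_alg_double_centralizer.
apply: no_iso_idempotents_iso fB _.
exact/no_iso_idempotents_op/basic_ring_idempotents/tilt_alg_basic.
Qed.

Let T'_bs : basic_strong T'. Proof. by []. Qed.
Let CT'_bs : basic_strong (endo_lmod T' : lmodType C).
Proof. by split; [exact: endo_T'_basic|exact: endo_T'_strong]. Qed.

Lemma tilt_alg_endo : alg_iso B (op_alg (endo_alg (endo_lmod T' : lmodType C))).
Proof.
apply: alg_iso_trans (alg_iso_sym (alg_iso_opK B)) _.
exact: alg_iso_op tilt_alg_double_centralizer.
Qed.

Lemma strong_tilting_unlimited : unlimited_strong_tilting Lambda.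
Proof.
(* The sequence is Lambda, B, C, B, C, ...; it alternates after the first term because tilting C by
   T' returns B. *)
pose L i := if i is j.+1 then (if odd j then C : kalg k else B) else Lambda.
exists L; split=> //.
- case=> [|i] /=; first by [].
  case: (odd i); last by split; [exact: tilt_alg_artin|exact: tilt_alg_basic].
  split; first exact (artin_endo tilt_alg_op_artin T'_fg).
  by have [] := basic_endo tilt_alg_op_artin T'_fg T'_basic.
- case=> [_|i] /=; first by exists T; split=> //; apply: alg_iso_refl.
  rewrite negbK => oi; rewrite oi /=.
  exists (endo_lmod T' : lmodType C); case: CT'_bs => h1 h2; split=> //.
  exact: tilt_alg_endo.
- case=> //= i /negbTE ->; rewrite /=.
  by exists T'; split=> //; apply: alg_iso_refl.
Qed.

(** By [tilt_unique] each term is determined up to isomorphism by the previous one, so every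
    sequence follows the one constructed above. *)
Lemma sequence_terms (L : nat -> kalg k) : strong_tilting_sequence Lambda L ->
  forall i, alg_iso (L i.+1) (if odd i then C : kalg k else B).
Proof.
move=> [L0 Lartin Ltl Ltr].
have hB (U : kalg k) (S : lmodType U) : artin_algebra U -> alg_iso U Lambda ->
    basic_strong S -> alg_iso (tilt_alg S) B.
  by move=> hU hUL hS; apply: alg_iso_op; apply: tilt_unique hU hUL hS _.
elim=> [|i IHi] /=.
  have [T1 [h1 h2 h3]] := Ltl 0%N isT; apply: alg_iso_trans h3 _.
  apply: hB => //; first by case: (Lartin 0%N).
  by rewrite L0; apply: alg_iso_refl.
have [hA _] := Lartin i.+1.
case oi : (odd i) IHi => /= IHi.
  have [|T1 [h1 h2 h3]] := Ltl i.+1; first by rewrite /= oi.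
  apply: alg_iso_trans h3 _; apply: alg_iso_trans (alg_iso_sym tilt_alg_endo).
  exact/alg_iso_op/(tilt_unique hA IHi).
have [|T1 [h1 h2 h3]] := Ltr i.+1; first by rewrite /= oi.
apply: alg_iso_trans h3 _.
exact: tilt_unique (artin_op hA) (alg_iso_op IHi) _ _.
Qed.

Lemma both_sides_unique : left_strong_both_sides T <->
  mod_iso (endo_rmod T : rmodType B) T'.
Proof.
split=> [[_ h]|h].
  apply: basic_strong_unique tilt_alg_op_artin _ T'_bs.
  by split=> //; exact: endo_rmod_basic.
by split=> //; apply: strong_tilting_iso (mod_iso_sym h) T'_strong.
Qed.

(** If Lambda and C are isomorphic, uniqueness identifies T with T' as a left C-module. The strength
    of T' over the opposite of B, which is End_C(T'), then becomes strength of T over its own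
    endomorphism ring. *)
Lemma both_sides_alg_iso : alg_iso Lambda C <-> left_strong_both_sides T.
Proof.
split=> [[f [fB fk]]|/both_sides_unique h]; last first.
  exact: alg_iso_trans Lambda_double_centralizer (alg_iso_endo h).
split=> //.
have TW := basic_strong_unique Lambda_artin (conj T_basic T_strong)
  (basic_strong_transfer fB CT'_bs).
apply: (strong_endo_rmod fB TW).
exact: (strong_endo_of_full (b := flip (endo_bimodule T')) T'_flip.2 T'_strong).
Qed.

End Main.

Theorem theorem3p1 (k : comPzRingType) (Lambda : kalg k)
  (Lambda_artin : artin_algebra Lambda) (Lambda_basic : basic_ring Lambda)
  (Lambda_cf : contravariantly_finite Lambda)
  (T : lmodType Lambda) (T_basic : basic_module T) (T_strong : strong_tilting T)
  (tilt_cf : contravariantly_finite (op_alg (tilt_alg T)))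
  (T' : rmodType (tilt_alg T)) (T'_basic : basic_module T')
  (T'_strong : strong_tilting T') :
  [/\ right_strong_both_sides T',
      unlimited_strong_tilting Lambda
    & forall L : nat -> kalg k, strong_tilting_sequence Lambda L ->
      [/\ forall i j : nat, (0 < i)%N -> (0 < j)%N -> odd i = odd j ->
            alg_iso (L i) (L j),
          alg_iso (L 0%N) (L 2%N) <-> left_strong_both_sides T
        & left_strong_both_sides T <->
            mod_iso (endo_rmod T : rmodType (tilt_alg T)) T']].
Proof.
split; first by split=> //; apply: endo_T'_strong.
  exact: strong_tilting_unlimited T'_basic T'_strong.
move=> L hL.
have hL' := sequence_terms Lambda_artin T_basic T_strong T'_basic T'_strong hL.
split.
- move=> [//|i] [//|j] _ _ /= /(can_inj negbK) ij.
  by apply: alg_iso_trans (hL' i) (alg_iso_sym _); rewrite ij; apply: hL'.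
- have [L0 _ _ _] := hL; rewrite L0.
  have h2 : alg_iso (L 2%N) (endo_alg T') := hL' 1%N.
  have main := both_sides_alg_iso Lambda_artin Lambda_basic T_basic T_strong T'_basic T'_strong.
  split=> h.
    by apply/main; apply: alg_iso_trans h h2.
  by move/main: h => h; apply: alg_iso_trans h (alg_iso_sym h2).
- exact: both_sides_unique.
Qed.
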